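(* Let $n\ge1$, let $p\in(1,+\infty)$ and let $\{\phi_s\}_{s\in\partial\mathbb{D}}$ be a measurable family of convex functions on $\mathbb{C}^n$ satisfying the $p$-uniform growth conditions. Then for almost any $s\in\partial\mathbb{D}$, $$[\phi]_{rs}\longrightarrow\phi_s\qquad\text{as } r\to1^-,$$ locally uniformly in $\mathbb{C}^n$.
   Context: $\mathbb{D}=\{t\in\mathbb{C}:|t|<1\}$, and $\sigma$ is the rotation-invariant probability measure on $\partial\mathbb{D}$ (''almost any'' refers to $\sigma$). For $h\in L^1(\partial\mathbb{D},\sigma)$, $P[h](t)=P[h(s)](t)=\int_{\partial\mathbb{D}}\frac{1-|t|^2}{|s-t|^2}h(s)\,d\sigma(s)$, $t\in\mathbb{D}$, is its Poisson integral. $H^r(\mathbb{D},\mathbb{C}^n)$ is the Hardy space of $\mathbb{C}^n$-valued holomorphic functions on $\mathbb{D}$, each identified with its radial boundary values $F(s)=\lim_{r\to1^-}F(rs)$, defined for a.e. $s\in\partial\mathbb{D}$. For $z,w\in\mathbb{C}^n$, $z\cdot w=\sum_j z_jw_j$ (no conjugation), and $|\cdot|$ is the Euclidean norm. Measurable family of convex functions: a Borel measurable function $\phi$ on $\partial\mathbb{D}\times\mathbb{C}^n$ such that each $\phi_s=\phi(s,\cdot)$ is convex on $\mathbb{C}^n\cong\mathbb{R}^{2n}$. $p$-uniform growth conditions ($1<p<\infty$): there are $c,C,A>0$ with $c|w|^p-A\le\phi_s(w)\le C|w|^p+A$ for all $s\in\partial\mathbb{D}$, $w\in\mathbb{C}^n$.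 Fiberwise (conjugate) Legendre transform: $\phi_s^*(z)=\sup_{w\in\mathbb{C}^n}\{\mathrm{Re}(z\cdot w)-\phi(s,w)\}$. Interpolated family: with $q=p/(p-1)$, $[\phi]_t(w)=[\phi](t,w)$, $(t,w)\in\mathbb{D}\times\mathbb{C}^n$, is defined by $$[\phi](t,w)=\sup_{f\in H^q(\mathbb{D},\mathbb{C}^n)}\big\{\mathrm{Re}(f(t)\cdot w)-P[\phi_s^*(f(s))](t)\big\},$$ which (by another result of the paper) also equals $\inf\{P[\phi(s,f(s))](t): f\in H^p(\mathbb{D},\mathbb{C}^n),\ f(t)=w\}$. *)

(* Defs.v *)
From HB Require Import structures.
From mathcomp Require Import all_boot all_order all_algebra.
From mathcomp Require Import all_classical all_reals all_analysis.
From mathcomp Require Import complex.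

Set Implicit Arguments.
Unset Strict Implicit.
Unset Printing Implicit Defensive.

Import Order.TTheory GRing.Theory Num.Theory.
Import numFieldNormedType.Exports.
Import ComplexField.Normc.

Local Open Scope classical_set_scope.
Local Open Scope ring_scope.
Local Open Scope complex_scope.

(* [R[i]] with the topology of its complex norm and as a normed space over
   itself, so that [derivable f t 1] is complex differentiability at [t]. *)
HB.instance Definition _ (R : realType) := PseudoPointedMetric.copy R[i] R[i]^o.
HB.instance Definition _ (R : realType) := NormedModule.copy R[i] R[i]^o.

Notation borel T := (g_sigma_algebraType (@open T)).

Definition unit_disc (R : realType) : set R[i] := [set t | normc t < 1].

Definition unit_circle (R : realType) : set R[i] := [set s | normc s = 1].

Definition circle_param (R : realType) (x : measurableTypeR R) : borel R[i] :=
  (cos (pi *+ 2 * (x : R)) +i* sin (pi *+ 2 * (x : R)))%C.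

Lemma continuous_circle_param (R : realType) :
  continuous (@circle_param R : R -> R[i]).
Proof.
move=> x; apply/cvgrPdist_lt => /= e.
rewrite ltcE/= => /andP[/eqP e2 e1].
have e3 : 0 < complex.Re e / 2 by rewrite divr_gt0.
have cl : {for x, continuous (fun y : R => pi *+ 2 * y)}.
  by apply: continuousM; [exact: cst_continuous|exact: cvg_id].
have cc : {for x, continuous (fun y : R => cos (pi *+ 2 * y))}.
  by apply: continuous_comp cl _; exact: continuous_cos.
have cs : {for x, continuous (fun y : R => sin (pi *+ 2 * y))}.
  by apply: continuous_comp cl _; exact: continuous_sin.
move/cvgrPdist_lt : cc => /(_ _ e3) cc.
move/cvgrPdist_lt : cs => /(_ _ e3) cs.
near=> y.
have : `|sin (pi *+ 2 * x) - sin (pi *+ 2 * y)| < complex.Re e / 2.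
  by near: y; exact: cs.
have : `|cos (pi *+ 2 * x) - cos (pi *+ 2 * y)| < complex.Re e / 2.
  by near: y; exact: cc.
set a := cos _ - _; set b := sin _ - _ => aE bE.
rewrite -[X in `|X|]/((a +i* b)%C : R[i]) normc_def ltcE/= e2 eqxx/=.
apply: (@le_lt_trans _ _ (`|a| + `|b|)); last first.
  by rewrite [ltRHS]splitr ltrD.
rewrite -[leRHS]ger0_norm ?addr_ge0// -sqrtr_sqr ler_wsqrtr//.
rewrite [leRHS]sqrrD !real_normK ?num_real//.
by rewrite lerD2r lerDl mulrn_wge0 ?mulr_ge0.
Unshelve. all: by end_near. Qed.

Lemma measurable_circle_param (R : realType) :
  measurable_fun [set: measurableTypeR R] (@circle_param R).
Proof.
apply: (@measurability _ _ (measurableTypeR R) (borel R[i]) _ _ (@open R[i])) => //.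
move=> _ [U oU <-]; rewrite setTI.
apply: measurable_realfun.open_measurable; move/continuousP : (@continuous_circle_param R).
exact.
Qed.

HB.instance Definition _ (R : realType) :=
  isMeasurableFun.Build _ _ _ _ (@circle_param R) (@measurable_circle_param R).

(* Law of [exp (2 pi i X)] for [X] uniform on [0, 1]: the rotation-invariant
   probability measure of the circle, as a Borel measure on the plane. *)
Definition sigma (R : realType) : probability (borel R[i]) R :=
  distribution (uniform_prob (@ltr01 R)) (@circle_param R).

Definition poisson (R : realType) (h : R[i] -> \bar R) (t : R[i]) : \bar R :=
  (\int[@sigma R]_(s in @unit_circle R)
     (((1 - normc t ^+ 2) / normc (s - t) ^+ 2)%:E * h s))%E.

Section interpolation.
Context (R : realType) (n : nat).
Local Notation C := R[i].
Local Notation Cn := 'rV[R[i]]_n.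

Definition cdot (z w : Cn) : C := \sum_(j < n) z 0 j * w 0 j.

(* The library norm of a row vector is the sup norm. *)
Definition enorm (w : Cn) : R := Num.sqrt (\sum_(j < n) normc (w 0 j) ^+ 2).

Definition hardy (r : R) : set (C -> Cn) := [set f |
  (forall t, unit_disc t -> derivable f t 1) /\
  (ereal_sup [set \int[@sigma R]_(s in @unit_circle R)
                    ((enorm (f (rho%:C * s)) `^ r)%:E)
             | rho in [set rho : R | 0 < rho < 1]%R] < +oo)%E].

(* [lim] is a fixed default vector at the points [s] without radial limit; for
   [f] in a Hardy space these form a null set. *)
Definition radial_limit (f : C -> Cn) (s : C) : Cn :=
  lim (f (rho%:C * s) @[rho --> (1 : R)^'-]).

Definition measurable_convex_family (phi : C -> Cn -> R) : Prop :=
  measurable_fun [set sw : borel (C * Cn)%type | unit_circle sw.1]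
    (fun sw => phi sw.1 sw.2) /\
  forall s, unit_circle s -> forall (x y : Cn) (a : R), 0 <= a <= 1 ->
    phi s (a%:C *: x + (1 - a)%:C *: y) <= a * phi s x + (1 - a) * phi s y.

Definition uniform_growth (p : R) (phi : C -> Cn -> R) : Prop :=
  exists c K A : R, [/\ 0 < c, 0 < K, 0 < A &
    forall s, unit_circle s -> forall w : Cn,
      c * enorm w `^ p - A <= phi s w <= K * enorm w `^ p + A].

Definition legendre (phi : C -> Cn -> R) (s : C) (z : Cn) : \bar R :=
  ereal_sup [set (complex.Re (cdot z w) - phi s w)%:E | w in [set: Cn]].

Definition interpolated (p : R) (phi : C -> Cn -> R) (t : C) (w : Cn) : \bar R :=
  ereal_sup [set ((complex.Re (cdot (f t) w))%:E
                  - poisson (fun s => legendre phi s (radial_limit f s)) t)%E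
            | f in hardy (p / (p - 1))].

(* Locally uniform convergence as [r -> 1^-] of extended-real-valued functions
   to a real-valued one; the estimate forces [F r w] to be finite. *)
Definition cvg_left1_locally_uniformly (F : R -> Cn -> \bar R) (g : Cn -> R) :
    Prop :=
  forall w0 : Cn, exists2 U : set Cn, nbhs w0 U &
    forall e : R, 0 < e -> \forall r \near (1 : R)^'-,
      forall w, U w -> (`|F r w - (g w)%:E| < e%:E)%E.

End interpolation.

(* Main.v *)
Require Import Defs.
From HB Require Import structures.
From mathcomp Require Import all_boot all_order all_algebra.
From mathcomp Require Import all_classical all_reals all_analysis.
From mathcomp Require Import measurable_realfun.
From mathcomp Require Import complex ring lra.

Set Implicit Arguments.
Unset Strict Implicit.
Unset Printing Implicit Defensive.

Import Order.TTheory GRing.Theory Num.Theory.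
Import numFieldNormedType.Exports.
Import ComplexField.Normc.

Local Open Scope classical_set_scope.
Local Open Scope ring_scope.
Local Open Scope complex_scope.

(** Each function [interpolated p phi t] is squeezed between Poisson integrals. For [f]
    in the Hardy space of the conjugate exponent, the definition of the conjugate gives
    [Re (f(s) . w) <= phi_s(w) + conj_phi_s(f(s))] on the circle, and [Re (f . w)] is the
    Poisson integral of its boundary values; hence every competitor in the supremum is
    at most [P[phi_s(w)](t)] ([interpolated_le]). The constant competitor [z] gives the
    lower bound [Re (z . w) - P[conj_phi_s(z)](t)] ([interpolated_ge]). By Fatou's theorem
    ([fatou_radial]) both Poisson integrals converge along almost every radius,
    simultaneously for all rational [w] and [z]. The limit at a rational [w] is thus
    between the supremum over [z] of [Re (z . w) - conj_phi_s(z)] and [phi_s(w)], which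
    are equal by the Fenchel-Moreau theorem ([fenchel_moreau]). Finally the functions are
    convex and bounded on bounded sets uniformly in [t], hence equi-Lipschitz
    ([convex_lipschitz]), and convergence at rational points is locally uniform.

    The analytic input concerns a holomorphic function [g] on the disc. Poisson's formula
    ([poisson_formula]) follows from Green's theorem in polar coordinates, in Goursat's
    form ([goursat_rectangle]). Fatou's theorem dominates the Poisson kernel by
    indicators of dyadic intervals and uses Lebesgue points. For exponents above 1, a
    function with bounded [L^q] means is the Poisson integral of its radial limits
    ([hardy_radial]): with [psi a = sqrt (1 + a^2)] the means of [psi (Re g)] over circles
    increase to a finite limit, and strict convexity of [psi] then forces the dilates of
    [Re g] to be Cauchy in [L^1], large values being controlled by the [q]-th power. This
    replaces weak compactness in [L^q]. *)

(** * Green's theorem on a rectangle, without continuous derivatives *)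

(** Bisection: a rectangle where [K] fails has a quarter where it fails, and the nested
    quarters shrink to a point near which [K] holds. *)
Lemma rect_bisection (R : realType) (K : R -> R -> R -> R -> Prop) (a b c d : R) :
  a <= b -> c <= d ->
  (forall x1 x2 y1 y2, a <= x1 -> x1 <= x2 -> x2 <= b ->
     c <= y1 -> y1 <= y2 -> y2 <= d ->
     K x1 ((x1 + x2) / 2) y1 ((y1 + y2) / 2) ->
     K ((x1 + x2) / 2) x2 y1 ((y1 + y2) / 2) ->
     K x1 ((x1 + x2) / 2) ((y1 + y2) / 2) y2 ->
     K ((x1 + x2) / 2) x2 ((y1 + y2) / 2) y2 -> K x1 x2 y1 y2) ->
  (forall x0 y0, a <= x0 <= b -> c <= y0 <= d ->
     exists2 e, 0 < e & forall x1 x2 y1 y2,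
       a <= x1 -> x1 <= x0 <= x2 -> x2 <= b -> x2 - x1 < e ->
       c <= y1 -> y1 <= y0 <= y2 -> y2 <= d -> y2 - y1 < e -> K x1 x2 y1 y2) ->
  K a b c d.
Proof.
move=> ab cd Ksplit Kloc; apply: contrapT => nK.
pose W k : R := (b - a) / 2 ^+ k; pose H k : R := (d - c) / 2 ^+ k.
have WS k : W k = W k.+1 + W k.+1.
  by rewrite /W exprS; field; rewrite expf_neq0.
have HS k : H k = H k.+1 + H k.+1.
  by rewrite /H exprS; field; rewrite expf_neq0.
have W0 k : 0 <= W k by rewrite divr_ge0 ?subr_ge0// exprn_ge0.
have H0 k : 0 <= H k by rewrite divr_ge0 ?subr_ge0// exprn_ge0.
pose bad k (p : R * R) := ~ K p.1 (p.1 + W k) p.2 (p.2 + H k).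
pose mv k (p : R * R) (ij : bool * bool) : R * R :=
  (p.1 + W k.+1 *+ ij.1, p.2 + H k.+1 *+ ij.2).
pose next k p := mv k p (odflt (false, false) [pick ij | `[< bad k.+1 (mv k p ij) >]]).
pose s := fix s k := if k is j.+1 then next j (s j) else (a, c).
have nextP k p : a <= p.1 -> p.1 + W k <= b -> c <= p.2 -> p.2 + H k <= d ->
    bad k p -> bad k.+1 (next k p).
  move=> p1 p2 p3 p4 bkp; rewrite /next; case: pickP => [ij /asboolP//|none].
  exfalso; apply: bkp.
  have Q i j : K (p.1 + W k.+1 *+ nat_of_bool i) (p.1 + W k.+1 *+ nat_of_bool i + W k.+1)
      (p.2 + H k.+1 *+ nat_of_bool j) (p.2 + H k.+1 *+ nat_of_bool j + H k.+1).
    by apply: contrapT => nQ; have /asboolP := none (i, j); apply.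
  have e1 : (p.1 + (p.1 + W k)) / 2 = p.1 + W k.+1 by rewrite WS; lra.
  have e2 : (p.2 + (p.2 + H k)) / 2 = p.2 + H k.+1 by rewrite HS; lra.
  apply: Ksplit => //; rewrite ?lerDl// ?e1 ?e2.
  - by have := Q false false; rewrite !addr0.
  - by have := Q true false; rewrite !addr0 -addrA -WS.
  - by have := Q false true; rewrite !addr0 -addrA -HS.
  - by have := Q true true; rewrite -!addrA -HS -WS.
have sP k : [/\ a <= (s k).1, (s k).1 + W k <= b, c <= (s k).2,
    (s k).2 + H k <= d & bad k (s k)].
  elim: k => [|k [p1 p2 p3 p4 bk]] /=.
    by split=> //; rewrite /bad /W /H ?expr0 ?divr1/= ?subrKC//.
  have := nextP _ _ p1 p2 p3 p4 bk; rewrite /next.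
  set ij := odflt _ _; move=> bad'; split => //; rewrite /mv/=.
  - by rewrite (le_trans p1)// lerDl mulrn_wge0.
  - move: p2; rewrite WS; case: (ij.1) => /=; rewrite ?mulr1n ?mulr0n ?addr0 ?addrA//.
    by have := W0 k.+1; lra.
  - by rewrite (le_trans p3)// lerDl mulrn_wge0.
  - move: p4; rewrite HS; case: (ij.2) => /=; rewrite ?mulr1n ?mulr0n ?addr0 ?addrA//.
    by have := H0 k.+1; lra.
have sX k : (s k).1 <= (s k.+1).1 /\ (s k.+1).1 + W k.+1 <= (s k).1 + W k.
  rewrite /= /next; set ij := odflt _ _; rewrite /mv/= (WS k).
  by case: (ij.1) => /=; rewrite ?mulr1n ?mulr0n; have := W0 k.+1; lra.
have sY k : (s k).2 <= (s k.+1).2 /\ (s k.+1).2 + H k.+1 <= (s k).2 + H k.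
  rewrite /= /next; set ij := odflt _ _; rewrite /mv/= (HS k).
  by case: (ij.2) => /=; rewrite ?mulr1n ?mulr0n; have := H0 k.+1; lra.
have nest (X L : nat -> R) : (forall k, 0 <= L k) ->
    (forall k, X k <= X k.+1 /\ X k.+1 + L k.+1 <= X k + L k) ->
    exists x0, forall k, X k <= x0 <= X k + L k.
  move=> L0 XL.
  have Xm j k : X j <= X (j + k)%N.
    by elim: k => [|k IH]; rewrite ?addn0// addnS (le_trans IH)// (XL _).1.
  have Lm j k : X (j + k)%N + L (j + k)%N <= X j + L j.
    elim: k => [|k IH]; rewrite ?addn0// addnS; apply: le_trans IH.
    exact: (XL _).2.
  have XLjk j k : X j <= X k + L k.
    have [jk|/ltnW kj] := leqP j k.
      by rewrite -(subnKC jk); apply: le_trans (Xm j (k - j)%N) _; rewrite lerDl.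
    by apply: le_trans (Lm k (j - k)%N); rewrite subnKC// lerDl.
  exists (sup (range X)) => k; apply/andP; split.
    apply: ub_le_sup; last by exists k.
    by exists (X 0%N + L 0%N) => _ [j _ <-].
  apply: ge_sup; first by exists (X 0%N), 0%N.
  by move=> _ [j _ <-].
have [x0 x0P] := nest (fun k => (s k).1) W W0 sX.
have [y0 y0P] := nest (fun k => (s k).2) H H0 sY.
have := Kloc x0 y0; case.
- have [/= s1 s2 _ _ _] := sP 0%N; have /andP[xl xr] := x0P 0%N.
  by rewrite (le_trans s1 xl) (le_trans xr).
- have [/= _ _ s1 s2 _] := sP 0%N; have /andP[xl xr] := y0P 0%N.
  by rewrite (le_trans s1 xl) (le_trans xr).
move=> e e0 Ke.
have small (L : R) : 0 <= L -> \forall k \near \oo, L / 2 ^+ k < e.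
  move=> L0; have : (fun k => L / 2 ^+ k) @ \oo --> (0 : R).
    by have := @cvg_geometric R L 2^-1; rewrite /geometric/=; under eq_fun do rewrite exprVn; apply; rewrite ger0_norm//; lra.
  move/cvgrPdist_lt => /(_ _ e0); apply: filterS => k.
  by rewrite sub0r normrN ger0_norm// divr_ge0// exprn_ge0.
have [k [Wk Hk]] : exists k, W k < e /\ H k < e.
  have ab0 : 0 <= b - a by rewrite subr_ge0.
  have cd0 : 0 <= d - c by rewrite subr_ge0.
  have [k [? ?]] := filter_ex (filterI (small _ ab0) (small _ cd0)).
  by exists k.
have [sx1 sx2 sy1 sy2] := sP k; apply.
by apply: Ke; rewrite ?x0P ?y0P// addrAC subrr add0r.
Qed.

Section interval_integrals.
Context {R : realType}.
Local Notation mu := (@lebesgue_measure R).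
Local Notation "\int_( a , b ) f" := (Rintegral mu `[a, b] f)
  (at level 36, a, b at level 35, f at level 36).
Implicit Types (f g : R -> R) (a b : R).

Definition continuous_on a b f := forall x, a <= x <= b -> {for x, continuous f}.

Lemma continuous_on_integrable a b f : continuous_on a b f ->
  mu.-integrable `[a, b] (EFin \o f).
Proof.
move=> cf; apply: continuous_compact_integrable; first exact: segment_compact.
by apply: continuous_in_subspaceT => x; rewrite inE/= in_itv/=; exact: cf.
Qed.

Lemma continuous_on_sub a b a' b' f : a <= a' -> b' <= b ->
  continuous_on a b f -> continuous_on a' b' f.
Proof.
move=> aa bb cf x /andP[ax xb]; apply: cf.
by rewrite (le_trans aa)// (le_trans xb).
Qed.

Lemma Rint_split a m b f : a <= m -> m <= b ->
  mu.-integrable `[a, b] (EFin \o f) ->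
  \int_(a, b) f = \int_(a, m) f + \int_(m, b) f.
Proof.
move=> am mb intf; have := @Rintegral_itvB R f (BLeft a) (BRight b) m intf.
rewrite !bnd_simp => /(_ am mb) H.
rewrite -(Rintegral_itv_obnd_cbnd (r := m)).
  by rewrite -H addrC subrK.
apply: integrableS intf => //; apply: subset_itvr; rewrite bnd_simp//.
Qed.

Lemma Rint_cst a b (k : R) : a <= b -> \int_(a, b) (fun=> k) = k * (b - a).
Proof.
move=> ab; rewrite Rintegral_cst//= lebesgue_measure_itv/= lte_fin.
by move: ab; rewrite le_eqVlt => /predU1P[->|->//]; rewrite ltxx subrr.
Qed.

Lemma Rint_dist a b f g (k e : R) : a <= b ->
  mu.-integrable `[a, b] (EFin \o f) -> mu.-integrable `[a, b] (EFin \o g) ->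
  (forall x, a <= x <= b -> `|f x - g x - k| <= e) ->
  `|\int_(a, b) f - \int_(a, b) g - k * (b - a)| <= e * (b - a).
Proof.
move=> ab intf intg fe.
have intc (r : R) : mu.-integrable `[a, b] (EFin \o (fun=> r)).
  by apply: continuous_on_integrable => x _; exact: cst_continuous.
have iB : mu.-integrable `[a, b] (EFin \o (fun x => f x - g x)).
  by have := integrableB _ intf intg; apply.
have iBB : mu.-integrable `[a, b] (EFin \o (fun x => f x - g x - k)).
  by have := integrableB _ iB (intc k); apply.
rewrite -!Rint_cst// -!RintegralB//.
apply: le_trans (le_normr_Rintegral _ iBB) _ => //.
by apply: le_Rintegral => //; exact: integrable_norm.
Qed.

(** Goursat's argument. The circulation of [P dx + Q dy] is additive under bisection, and
    on a small rectangle it is at most [e] times the square of the half perimeter: at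
    each point the partial derivatives [dP/dy] and [dQ/dx] exist in a uniform sense and
    agree, [k] being their common value. These derivatives need not be continuous, which
    is what complex differentiability alone provides. *)
Lemma goursat_rectangle (P Q : R -> R -> R) a b c d : a <= b -> c <= d ->
  (forall y, c <= y <= d -> continuous_on a b (P^~ y)) ->
  (forall x, a <= x <= b -> continuous_on c d (Q x)) ->
  (forall x0 y0, a <= x0 <= b -> c <= y0 <= d -> exists k, forall e, 0 < e ->
     exists2 r, 0 < r & forall x1 x2 y1 y2,
       a <= x1 -> x1 <= x0 <= x2 -> x2 <= b -> x2 - x1 < r ->
       c <= y1 -> y1 <= y0 <= y2 -> y2 <= d -> y2 - y1 < r ->
       (forall x, x1 <= x <= x2 -> `|P x y1 - P x y2 - k * (y1 - y2)| <=
          e * ((x2 - x1) + (y2 - y1))) /\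
       (forall y, y1 <= y <= y2 -> `|Q x2 y - Q x1 y - k * (x2 - x1)| <=
          e * ((x2 - x1) + (y2 - y1)))) ->
  \int_(a, b) (P^~ c) + \int_(c, d) (Q b) =
  \int_(a, b) (P^~ d) + \int_(c, d) (Q a).
Proof.
move=> ab cd cP cQ dPQ.
pose E x1 x2 y1 y2 := \int_(x1, x2) (P^~ y1) - \int_(x1, x2) (P^~ y2) +
  (\int_(y1, y2) (Q x2) - \int_(y1, y2) (Q x1)).
suff E0 : E a b c d = 0.
  move: E0; rewrite /E; clear.
  do 4 move: (Rintegral _ _ _) => ?; lra.
have iP x1 x2 y : a <= x1 -> x2 <= b -> c <= y <= d ->
    mu.-integrable `[x1, x2] (EFin \o (P^~ y)).
  by move=> ? ? ?; apply: continuous_on_integrable;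
    apply: continuous_on_sub (cP _ _).
have iQ y1 y2 x : c <= y1 -> y2 <= d -> a <= x <= b ->
    mu.-integrable `[y1, y2] (EFin \o (Q x)).
  by move=> ? ? ?; apply: continuous_on_integrable;
    apply: continuous_on_sub (cQ _ _).
suff small e : 0 < e -> `|E a b c d| <= e * ((b - a) + (d - c)) ^+ 2.
  apply/eqP; rewrite -normr_le0; apply/ler_addgt0Pl => /= e e0; rewrite addr0.
  pose s := ((b - a) + (d - c)) ^+ 2.
  have s0 : 0 <= s by exact: sqr_ge0.
  have s1 : 0 < s + 1 by rewrite ltr_wpDl.
  apply: le_trans (small (e / (s + 1)) _) _; first by rewrite divr_gt0.
  by rewrite -[X in _ * X]/s mulrAC ler_pdivrMr// mulrDr mulr1 lerDl ltW.
(* The bound [e * (half perimeter)^2] is additive over the four quarters. *)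
move=> e0.
apply: (@rect_bisection R (fun x1 x2 y1 y2 =>
  `|E x1 x2 y1 y2| <= e * ((x2 - x1) + (y2 - y1)) ^+ 2) a b c d) => //.
- move=> x1 x2 y1 y2 ax1 x12 x2b cy1 y12 y2d.
  set m := (x1 + x2) / 2; set n := (y1 + y2) / 2.
  have [x1m mx2] : x1 <= m /\ m <= x2 by rewrite /m; split; lra.
  have [y1n ny2] : y1 <= n /\ n <= y2 by rewrite /n; split; lra.
  have sP y : c <= y <= d -> \int_(x1, x2) (P^~ y) =
      \int_(x1, m) (P^~ y) + \int_(m, x2) (P^~ y).
    by move=> ?; apply: Rint_split => //; exact: iP.
  have sQ x : a <= x <= b -> \int_(y1, y2) (Q x) =
      \int_(y1, n) (Q x) + \int_(n, y2) (Q x).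
    by move=> ?; apply: Rint_split => //; exact: iQ.
  have -> : E x1 x2 y1 y2 = E x1 m y1 n + E m x2 y1 n + E x1 m n y2 + E m x2 n y2.
    have x1P : a <= x1 <= b by apply/andP; split; lra.
    have x2P : a <= x2 <= b by apply/andP; split; lra.
    have y1P : c <= y1 <= d by apply/andP; split; lra.
    have y2P : c <= y2 <= d by apply/andP; split; lra.
    rewrite /E (sP y1)// (sP y2)// (sQ x1)// (sQ x2)//; clear.
    do 12 move: (Rintegral _ _ _) => ?; ring.
  set e1 := E x1 m y1 n; set e2 := E m x2 y1 n; set e3 := E x1 m n y2.
  set e4 := E m x2 n y2 => h1 h2 h3 h4.
  apply: (@le_trans _ _ (`|e1| + `|e2| + `|e3| + `|e4|)).
    by rewrite !(le_trans (ler_normD _ _))// !lerD// !(le_trans (ler_normD _ _))// !lerD// ler_normD.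
  apply: le_trans (lerD (lerD (lerD h1 h2) h3) h4) _.
  by rewrite le_eqVlt; apply/orP; left; apply/eqP; rewrite /m /n; field.
- move=> x0 y0 x0P y0P; have [k kP] := dPQ _ _ x0P y0P.
  have [r r0 rP] := kP _ e0; exists r => //.
  move=> x1 x2 y1 y2 ax1 xx x2b x12r cy1 yy y2d y12r.
  have [Pk Qk] := rP _ _ _ _ ax1 xx x2b x12r cy1 yy y2d y12r.
  have x12 : x1 <= x2 by move: xx => /andP[/le_trans]; exact.
  have y12 : y1 <= y2 by move: yy => /andP[/le_trans]; exact.
  have x1P : a <= x1 <= b by rewrite ax1 (le_trans x12).
  have x2P : a <= x2 <= b by rewrite x2b andbT (le_trans _ x12).
  have y1P : c <= y1 <= d by rewrite cy1 (le_trans y12).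
  have y2P : c <= y2 <= d by rewrite y2d andbT (le_trans _ y12).
  have := Rint_dist x12 (iP _ _ _ ax1 x2b y1P) (iP _ _ _ ax1 x2b y2P) Pk.
  have := Rint_dist y12 (iQ _ _ _ cy1 y2d x2P) (iQ _ _ _ cy1 y2d x1P) Qk.
  rewrite /E; set IQ := Rintegral _ _ _ - Rintegral _ _ _.
  set IP := Rintegral _ _ _ - Rintegral _ _ _ => bQ bP.
  have -> : IP + IQ = (IP - k * (y1 - y2) * (x2 - x1)) + (IQ - k * (x2 - x1) * (y2 - y1)).
    by ring.
  apply: le_trans (ler_normD _ _) _; apply: le_trans (lerD bP bQ) _.
  by rewrite -mulrDr expr2 mulrA.
Qed.

End interval_integrals.

(** * Complex numbers and the circle *)

Section complex_preliminaries.
Context {R : realType}.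
Implicit Types (z w s t : R[i]) (x y : R).

Lemma normr_normc z : `|z| = (normc z)%:C.
Proof. by case: z => a b; rewrite normc_def. Qed.

Lemma normc_ge0 z : 0 <= normc z.
Proof. by case: z => a b; rewrite sqrtr_ge0. Qed.

Lemma sqr_normcE z : normc z ^+ 2 = complex.Re z ^+ 2 + complex.Im z ^+ 2.
Proof. by case: z => a b /=; rewrite sqr_sqrtr// addr_ge0// sqr_ge0. Qed.

Lemma normc_Re z : `|complex.Re z| <= normc z.
Proof.
rewrite -(ler_pXn2r (n := 2))// ?nnegrE ?normc_ge0//.
by rewrite real_normK ?num_real// sqr_normcE lerDl sqr_ge0.
Qed.

Lemma normc_Im z : `|complex.Im z| <= normc z.
Proof.
rewrite -(ler_pXn2r (n := 2))// ?nnegrE ?normc_ge0//.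
by rewrite real_normK ?num_real// sqr_normcE lerDr sqr_ge0.
Qed.

Lemma normc_real x : normc x%:C = `|x|.
Proof. by rewrite /= expr0n /= addr0 sqrtr_sqr. Qed.

Lemma normc_gt0 z : (0 < normc z) = (z != 0).
Proof.
rewrite lt_neqAle normc_ge0 andbT eq_sym; apply/idP/idP; apply: contra => /eqP.
  by move=> ->; rewrite normc0.
by move=> /eq0_normc ->.
Qed.

Lemma normc_sum2 z : normc z <= `|complex.Re z| + `|complex.Im z|.
Proof.
rewrite -(ler_pXn2r (n := 2))// ?nnegrE ?normc_ge0// ?addr_ge0//.
rewrite sqr_normcE sqrrD !real_normK ?num_real// lerD2r lerDl.
by rewrite mulrn_wge0// mulr_ge0.
Qed.

Lemma normcB z w : normc (z - w) <= normc z + normc w.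
Proof. by rewrite -(normcN w); exact: le_normcD. Qed.

Lemma normc_distC z w : normc (z - w) = normc (w - z).
Proof. by rewrite -normcN opprB. Qed.

Lemma normc_near z (P : set R[i]) : (\forall w \near z, P w) <->
  exists2 e, 0 < e & forall w, normc (w - z) < e -> P w.
Proof.
split.
  move=> /nbhs_ballP[e /= e0 zP]; exists (complex.Re e).
    by move: e0; rewrite ltcE => /andP[].
  move=> w wz; apply: zP; rewrite -ball_normE /ball_/= distrC normr_normc.
  by move: e0; rewrite !ltcE/= => /andP[/eqP -> _]; rewrite eqxx.
move=> [e e0 eP]; apply/nbhs_ballP; exists e%:C; first by rewrite /= ltcR.
by move=> w; rewrite -ball_normE /ball_/= distrC normr_normc ltcR; exact: eP.
Qed.

Lemma continuous_Re : continuous (@complex.Re R).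
Proof.
move=> z; apply/(@cvgrPdist_lt _ _ _ (nbhs z)) => e e0; apply/normc_near; exists e => // w wz.
by rewrite (le_lt_trans _ wz)// normc_distC -raddfB normc_Re.
Qed.

Lemma continuous_Im : continuous (@complex.Im R).
Proof.
move=> z; apply/(@cvgrPdist_lt _ _ _ (nbhs z)) => e e0; apply/normc_near; exists e => // w wz.
by rewrite (le_lt_trans _ wz)// normc_distC -raddfB normc_Im.
Qed.

Lemma continuous_real_complex : continuous (fun x : R => x%:C).
Proof.
move=> x; apply/cvgrPdist_lt => e; rewrite ltcE/= => /andP[/eqP e2 e0].
near=> y; rewrite -rmorphB normr_normc normc_real ltcE/= e2 eqxx/=.
by near: y; apply: cvgr_dist_lt.
Unshelve. all: by end_near. Qed.

End complex_preliminaries.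

Lemma derivable_littleo (K : numFieldType) (f : K -> K^o) x : derivable f x 1 ->
  forall e, 0 < e ->
    \forall z \near x, `|f z - f x - 'D_1 f x * (z - x)| <= e * `|z - x|.
Proof.
move=> /derivable_nbhs /eqaddoP fo e e0.
have := fo _ e0; rewrite !near_simpl (near_shift x 0) /=.
apply: filterS => z; rewrite /= sub0r => H; rewrite (le_trans _ H)//.
rewrite le_eqVlt; apply/orP; left; apply/eqP; congr (`|_|).
rewrite -[RHS]/(f ((z - x) * 1 + x) - (f x + (z - x) * 'D_1 f x)).
by rewrite mulr1 subrK opprD addrA mulrC.
Qed.

Section circle.
Context {R : realType}.
Implicit Types (z w s t : R[i]) (x y : R).

(** [exp (2 pi i y)], read as a complex number instead of a point of the Borel space. *)
Definition e_ y : R[i] := circle_param y.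

Lemma e_E y : e_ y = (cos (pi *+ 2 * y) +i* sin (pi *+ 2 * y))%C.
Proof. by []. Qed.

Lemma normc_e y : normc (e_ y) = 1.
Proof. by rewrite /= cos2Dsin2 sqrtr1. Qed.

Lemma e_periodic y : e_ (y + 1) = e_ y.
Proof. by rewrite !e_E mulrDr mulr1 cosD2pi sinD2pi. Qed.

Lemma continuous_e : continuous e_.
Proof. exact: continuous_circle_param. Qed.

(** [2 pi i], so that [tau_i * e_ y] is the derivative of [e_] at [y]. *)
Definition tau_i : R[i] := (0 +i* (pi *+ 2))%C.

Lemma e_littleo y0 e : 0 < e ->
  \forall y \near y0, normc (e_ y - e_ y0 - tau_i * e_ y0 * (y - y0)%:C) <= e * `|y - y0|.
Proof.
move=> e0; have e2 : 0 < e / 2 by rewrite divr_gt0.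
have dc : is_derive y0 1 (fun y : R => cos (pi *+ 2 * y) : R^o) (- (pi *+ 2) * sin (pi *+ 2 * y0)).
  by apply: is_derive_eq; rewrite [_%:A]mulr1; ring.
have ds : is_derive y0 1 (fun y : R => sin (pi *+ 2 * y) : R^o) ((pi *+ 2) * cos (pi *+ 2 * y0)).
  by apply: is_derive_eq; rewrite [_%:A]mulr1; ring.
have := derivable_littleo (@ex_derive _ _ _ _ _ _ _ dc) e2.
rewrite (@derive_val _ _ _ _ _ _ _ dc) => lc.
have := derivable_littleo (@ex_derive _ _ _ _ _ _ _ ds) e2.
rewrite (@derive_val _ _ _ _ _ _ _ ds) => ls.
near=> y; apply: le_trans (normc_sum2 _) _.
rewrite [leRHS](_ : _ = e / 2 * `|y - y0| + e / 2 * `|y - y0|); last by field.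
rewrite !e_E; apply: lerD.
  rewrite (_ : complex.Re _ = cos (pi *+ 2 * y) - cos (pi *+ 2 * y0) -
     - (pi *+ 2) * sin (pi *+ 2 * y0) * (y - y0)); first by near: y; exact: lc.
  by rewrite /tau_i; simpc; rewrite /=; ring.
rewrite (_ : complex.Im _ = sin (pi *+ 2 * y) - sin (pi *+ 2 * y0) -
    (pi *+ 2) * cos (pi *+ 2 * y0) * (y - y0)); first by near: y; exact: ls.
by rewrite /tau_i; simpc; rewrite /=; ring.
Unshelve. all: by end_near. Qed.

(** Complex differentiability at [z] as a first-order estimate between real numbers. *)
Lemma derivable_normc (f : R[i] -> R[i]) z : derivable f z 1 ->
  exists l, forall e, 0 < e -> exists2 d, 0 < d & forall w, normc (w - z) < d ->
    normc (f w - f z - l * (w - z)) <= e * normc (w - z).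
Proof.
move=> df; exists ('D_1 f z) => e e0.
have eC : 0 < e%:C :> R[i] by rewrite ltcR.
have /normc_near[d d0 dP] := derivable_littleo df eC.
exists d => // w /dP; rewrite !normr_normc -rmorphM lecR.
exact.
Qed.

Lemma derivable_normc_continuous (f : R[i] -> R[i]) z : derivable f z 1 ->
  {for z, continuous f}.
Proof. by move=> df; apply/differentiable_continuous/derivable1_diffP. Qed.

Lemma e_sub_neq0 t y : normc t < 1 -> e_ y - t != 0.
Proof.
by move=> t1; rewrite subr_eq0; apply: contraTneq t1 => <-; rewrite normc_e ltxx.
Qed.

Lemma normc_e_sub_ge t y : 1 - normc t <= normc (e_ y - t).
Proof. by rewrite lerBlDr -(normc_e y) -{1}(subrK t (e_ y)) le_normcD. Qed.

Lemma normc_e_sub_le t y : normc t < 1 -> normc (e_ y - t) <= 2.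
Proof.
by have := normcB (e_ y) t; rewrite normc_e; lra.
Qed.

Definition cauchy_kernel t y := e_ y / (e_ y - t).

Lemma normc_cauchy_kernel t y : normc t < 1 ->
  normc (cauchy_kernel t y) <= (1 - normc t)^-1.
Proof.
move=> t1; rewrite normcM normcV normc_e mul1r lef_pV2 ?normc_e_sub_ge//.
  by rewrite posrE normc_gt0 e_sub_neq0.
by rewrite posrE subr_gt0.
Qed.

Lemma continuous_cauchy_kernel t : normc t < 1 -> continuous (cauchy_kernel t).
Proof.
move=> t1 y; apply: cvgM; first exact: continuous_e.
apply: cvgV; first exact: e_sub_neq0.
by apply: cvgB; [exact: continuous_e|exact: cvg_cst].
Qed.

Lemma Re_add z w : complex.Re (z + w) = complex.Re z + complex.Re w.
Proof. by case: z; case: w. Qed.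

Lemma Im_add z w : complex.Im (z + w) = complex.Im z + complex.Im w.
Proof. by case: z; case: w. Qed.

Lemma Re_sub z w : complex.Re (z - w) = complex.Re z - complex.Re w.
Proof. by case: z; case: w. Qed.

Lemma Im_sub z w : complex.Im (z - w) = complex.Im z - complex.Im w.
Proof. by case: z; case: w. Qed.

Lemma Re_realM x z : complex.Re (x%:C * z) = x * complex.Re z.
Proof. by case: z => a b /=; simpc. Qed.

Lemma Im_realM x z : complex.Im (x%:C * z) = x * complex.Im z.
Proof. by case: z => a b /=; simpc. Qed.

Lemma Im_tauM x z : complex.Im (tau_i * z * x%:C) = pi *+ 2 * complex.Re z * x.
Proof. by case: z => a b /=; simpc. Qed.

Lemma le_abs_sub x1 x x2 : x1 <= x <= x2 ->
  forall x0, x1 <= x0 <= x2 -> `|x - x0| <= x2 - x1.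
Proof. by move=> /andP[a b] x0 /andP[c d]; rewrite ler_norml; lra. Qed.

(** * Cauchy's and Poisson's formulas *)

(** In the coordinates [z = t + x (e_ y - t)], with [x] in (0, 1], the real part of the
    closed form [F dz / (2 pi i (z - t))] is [P dx + Q dy].
    Since [P] has the same values at [y = 0] and [y = 1], Green's theorem shows that the
    mean of [Q x] does not depend on [x]. At [x = 1] this is the left-hand side, and
    as [x] tends to 0 the values of [F] tend to [F t]. *)
Lemma cauchy_mean (F : R[i] -> R[i]) t : normc t < 1 ->
  (forall z, normc z <= 1 -> derivable F z 1) ->
  Rintegral lebesgue_measure `[0, 1] (fun y => complex.Re (F (e_ y) * cauchy_kernel t y)) =
  Rintegral lebesgue_measure `[0, 1] (fun y => complex.Re (F t * cauchy_kernel t y)).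
Proof.
move=> t1 dF.
pose zz x y := t + x%:C * (e_ y - t).
have zz1 x y : 0 <= x <= 1 -> normc (zz x y) <= 1.
  move=> /andP[x0 x1]; rewrite (_ : zz x y = (1 - x)%:C * t + x%:C * e_ y); last first.
    by rewrite /zz rmorphB/= rmorph1; ring.
  rewrite (le_trans (le_normcD _ _))// !normcM normc_e !normc_real mulr1.
  rewrite !ger0_norm ?subr_ge0//.
  have : (1 - x) * normc t <= (1 - x) * 1 by rewrite ler_wpM2l ?subr_ge0// ltW.
  by lra.
have m0 : 0 < 1 - normc t by rewrite subr_gt0.
pose P x y := complex.Im (F (zz x y)) / (pi *+ 2 * x).
pose Q x y := complex.Re (F (zz x y) * cauchy_kernel t y).
have pi2 : 1 <= pi *+ 2 :> R.
  by have := pi_ge2 R; rewrite -mulr_natr; lra.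
have cQ x : 0 <= x <= 1 -> continuous (Q x).
  move=> x01 y; apply: (@continuous_comp _ _ _ (fun y => F (zz x y) * cauchy_kernel t y) (@complex.Re R)); last exact: continuous_Re.
  apply: cvgM; last exact: continuous_cauchy_kernel.
  apply: (@continuous_comp _ _ _ (zz x) F); last first.
    by apply: derivable_normc_continuous; apply: dF; exact: zz1.
  apply: cvgD; first exact: cvg_cst.
  apply: cvgM; first exact: cvg_cst.
  by apply: cvgB; [exact: continuous_e|exact: cvg_cst].
have key l0 : 0 < l0 -> l0 <= 1 ->
    Rintegral lebesgue_measure `[0, 1] (Q 1) = Rintegral lebesgue_measure `[0, 1] (Q l0).
  move=> l00 l01.
  have Pper : P^~ 0 = P^~ 1.
    by apply/funext => x; rewrite /P /zz -(e_periodic 0) add0r.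
  have := @goursat_rectangle R P Q l0 1 0 1 l01 ler01.
  rewrite Pper => H; apply: addrI; apply: H => {Pper}.
  - move=> y _ x /andP[lx x1].
    have x0 : 0 < x by exact: lt_le_trans lx.
    apply: cvgM.
      apply: (@continuous_comp _ _ _ (fun x => F (zz x y)) (@complex.Im R)); last exact: continuous_Im.
      apply: (@continuous_comp _ _ _ (fun x => zz x y) F); last first.
        by apply: derivable_normc_continuous; apply: dF; rewrite zz1// x1 ltW.
      apply: cvgD; first exact: cvg_cst.
      by apply: cvgM; [exact: continuous_real_complex|exact: cvg_cst].
    apply: cvgV; first by rewrite mulf_neq0 ?gt_eqF// (lt_le_trans ltr01).
    by apply: cvgM; [exact: cvg_cst|exact: cvg_id].
  - by move=> x /andP[lx x1] y _; apply: cQ; rewrite x1 (le_trans (ltW l00)).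
  move=> x0 y0 /andP[lx0 x01] _.
  have x00 : 0 < x0 by exact: lt_le_trans lx0.
  pose z0 := zz x0 y0.
  have /derivable_normc[F' F'P] : derivable F z0 1.
    by apply: dF; rewrite zz1// x01 ltW.
  (* The common value of the partial derivatives, by the chain rule. *)
  exists (complex.Re (F' * e_ y0)) => e e0.
  pose M := normc F' + 1.
  have M0 : 0 < M by rewrite ltr_wpDl// normc_ge0.
  pose L : R := pi *+ 2 + 1.
  have L2 : 2 <= L by rewrite /L; lra.
  have L0 : 0 < L by lra.
  pose c0 := Num.min (1 - normc t) l0.
  have c00 : 0 < c0 by rewrite lt_min m0.
  (* [L] is a Lipschitz constant of [e_] and bounds [e_ y - t]; [c0] bounds the two
     denominators from below; [e1] and [e2] are the accuracies required of the
     expansions of [F] and of [e_]. *)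
  pose e1 := e * c0 / (4 * L).
  have e10 : 0 < e1 by rewrite divr_gt0 ?mulr_gt0.
  pose e2 := e / (4 * M).
  have e20 : 0 < e2 by rewrite divr_gt0 ?mulr_gt0.
  have [d d0 dP] := F'P _ e10.
  have : \forall y \near y0, normc (e_ y - e_ y0) < e2 /\
    normc (e_ y - e_ y0 - tau_i * e_ y0 * (y - y0)%:C) <= Num.min 1 e2 * `|y - y0|.
    near=> y; split; last by near: y; apply: e_littleo; rewrite lt_min ltr01.
    rewrite normc_distC -ltcR -normr_normc; near: y.
    by apply: cvgr_dist_lt; [exact: continuous_e|rewrite ltcR].
  move=> /nbhs_ballP[r /= r0 rP].
  exists (Num.min r (d / (2 * L))); first by rewrite lt_min r0/= divr_gt0// mulr_gt0.
  move=> x1 x2 y1 y2 lx1 x1x0x2 x21; rewrite lt_min => /andP[xr xd].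
  move=> y01 y1y0y2 y21; rewrite lt_min => /andP[yr yd].
  set D := x2 - x1 + (y2 - y1).
  have x12 : x1 <= x2 by move: x1x0x2 => /andP[/le_trans]; exact.
  have y12 : y1 <= y2 by move: y1y0y2 => /andP[/le_trans]; exact.
  have D0 : 0 <= D by rewrite addr_ge0// subr_ge0.
  have near_e y : y1 <= y <= y2 -> [/\ normc (e_ y - e_ y0) <= e2,
      normc (e_ y - e_ y0) <= L * `|y - y0| &
      normc (e_ y - e_ y0 - tau_i * e_ y0 * (y - y0)%:C) <= e2 * `|y - y0|].
    move=> yy; have [|h1 h2] := rP y.
      by rewrite /ball/= distrC (le_lt_trans (le_abs_sub yy _)).
    split; first exact: ltW.
    - rewrite -(subrK (tau_i * e_ y0 * (y - y0)%:C) (e_ y - e_ y0)).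
      rewrite (le_trans (le_normcD _ _))// !normcM normc_e normc_real mulr1.
      rewrite /L mulrDl addrC mul1r lerD//.
        by rewrite /tau_i /= expr0n add0r sqrtr_sqr ger0_norm// (le_trans _ pi2).
      by rewrite (le_trans h2)// ler_piMl// ge_min lexx.
    - by rewrite (le_trans h2)// ler_wpM2r// ge_min lexx orbT.
  have near_z x y : x1 <= x <= x2 -> y1 <= y <= y2 ->
      normc (F (zz x y) - F z0 - F' * (zz x y - z0)) <= e1 * (L * D).
    move=> xx yy.
    have zL : normc (zz x y - z0) <= L * D.
      rewrite (_ : _ - _ = (x - x0)%:C * (e_ y - t) + x0%:C * (e_ y - e_ y0)); last first.
        by rewrite /z0 /zz rmorphB/=; ring.
      have [_ eL _] := near_e _ yy.
      rewrite (le_trans (le_normcD _ _))// !normcM !normc_real (ger0_norm (ltW x00)).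
      rewrite /D mulrDr lerD//.
        rewrite mulrC ler_pM// ?normc_ge0//; last exact: le_abs_sub.
        by rewrite (le_trans (normc_e_sub_le _ _)).
      rewrite (le_trans (ler_wpM2l (ltW x00) eL))// (le_trans (ler_piMl _ x01))//.
        by rewrite mulr_ge0// ltW.
      by rewrite ler_wpM2l ?(ltW L0)// le_abs_sub.
    rewrite (le_trans (dP _ _)) ?ler_wpM2l ?(ltW e10)//.
    rewrite (le_lt_trans zL)// -ltr_pdivlMl// /D (splitr (_ * d)) ltrD//.
      by rewrite (lt_le_trans xd)// invfM; lra.
    by rewrite (lt_le_trans yd)// invfM; lra.
  have e1L : e1 * (L * D) = e * D * c0 / 4.
    by rewrite /e1; field; rewrite gt_eqF.
  have c0m : c0 <= 1 - normc t by rewrite ge_min lexx.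
  have c0l : c0 <= l0 by rewrite ge_min lexx orbT.
  have F'M : normc F' <= M by rewrite lerDl.
  pose A z := F z - F z0 - F' * (z - z0).
  have e2M : M * e2 = e / 4 by rewrite /e2; field; rewrite gt_eqF.
  have y1P : y1 <= y1 <= y2 by rewrite lexx y12.
  have y2P : y1 <= y2 <= y2 by rewrite lexx y12.
  have x1P : x1 <= x1 <= x2 by rewrite lexx x12.
  have x2P : x1 <= x2 <= x2 by rewrite lexx x12.
  split.
  - move=> x xx.
    have lx : l0 <= x by case/andP: xx => /(le_trans lx1).
    have x_gt0 : 0 < x by exact: lt_le_trans lx.
    pose E y := e_ y - e_ y0 - tau_i * e_ y0 * (y - y0)%:C.
    have ED y : y1 <= y <= y2 -> normc (E y) <= e2 * D.
      move=> yy; have [_ _ h] := near_e _ yy; apply: (le_trans h).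
      rewrite ler_wpM2l ?(ltW e20)// (le_trans (le_abs_sub yy _))//.
      by rewrite /D lerDr subr_ge0.
    have -> : P x y1 - P x y2 - complex.Re (F' * e_ y0) * (y1 - y2) =
       complex.Im (A (zz x y1) - A (zz x y2)) / (pi *+ 2 * x) +
       complex.Im (F' * (E y1 - E y2)) / (pi *+ 2).
      have FE : F (zz x y1) - F (zz x y2) = (A (zz x y1) - A (zz x y2)) +
          x%:C * (F' * (E y1 - E y2)) + x%:C * (tau_i * (F' * e_ y0) * (y1 - y2)%:C).
        by rewrite /A /E /zz !rmorphB/=; ring.
      rewrite /P -mulrBl -Im_sub FE.
      move: (A _ - A _) (F' * (E _ - _)) (F' * e_ y0) => a1 a2 a3.
      rewrite !Im_add !Im_realM Im_tauM.
      have : pi *+ 2 != 0 :> R by rewrite gt_eqF// (lt_le_trans ltr01).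
      move: (pi *+ 2) => v v0.
      by field; rewrite v0 gt_eqF.
    rewrite (le_trans (ler_normD _ _))// (splitr (e * D)) lerD//.
      rewrite normrM normfV ler_pdivrMr; last by rewrite normr_gt0 mulf_neq0 ?gt_eqF// (lt_le_trans ltr01).
      rewrite (le_trans (normc_Im _))// (le_trans (normcB _ _))//.
      apply: le_trans (lerD (near_z _ _ xx y1P) (near_z _ _ xx y2P)) _.
      have cx : c0 <= pi *+ 2 * x.
        by rewrite (le_trans c0l)// (le_trans lx)// ler_peMl// ltW.
      have := mulr_ge0 (mulr_ge0 (ltW e0) D0) (_ : 0 <= pi *+ 2 * x - c0).
      rewrite subr_ge0 e1L (ger0_norm (le_trans (ltW c00) cx)) => /(_ cx).
      clear; move: (_ * x) => v; lra.
    rewrite normrM normfV ler_pdivrMr; last by rewrite normr_gt0 gt_eqF// (lt_le_trans ltr01).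
    rewrite (ger0_norm (le_trans ler01 pi2)).
    rewrite (le_trans (normc_Im _))// normcM.
    have h1 : normc (E y1 - E y2) <= e2 * D + e2 * D.
      by rewrite (le_trans (normcB _ _))// lerD// ED.
    apply: le_trans (ler_pM (normc_ge0 _) (normc_ge0 _) F'M h1) _.
    rewrite mulrDr mulrA e2M.
    have := mulr_ge0 (mulr_ge0 (ltW e0) D0) (_ : 0 <= pi *+ 2 - 1).
    rewrite subr_ge0 => /(_ pi2); clear; move: (_ *+ 2) => v; lra.
  move=> y yy; have [h1 _ _] := near_e _ yy.
  have -> : Q x2 y - Q x1 y - complex.Re (F' * e_ y0) * (x2 - x1) =
     complex.Re ((A (zz x2 y) - A (zz x1 y)) * cauchy_kernel t y) +
     (x2 - x1) * complex.Re (F' * (e_ y - e_ y0)).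
    have FE : (F (zz x2 y) - F (zz x1 y)) * cauchy_kernel t y =
        (A (zz x2 y) - A (zz x1 y)) * cauchy_kernel t y +
        (x2 - x1)%:C * (F' * (e_ y - e_ y0)) + (x2 - x1)%:C * (F' * e_ y0).
      have := e_sub_neq0 y t1; rewrite /A /zz /cauchy_kernel !rmorphB/= => nz.
      by field.
    rewrite /Q -Re_sub -mulrBl FE.
    move: ((A _ - A _) * _) (F' * (_ - _)) (F' * e_ y0) => a1 a2 a3.
    by rewrite !Re_add !Re_realM; ring.
  have x12D : 0 <= x2 - x1 <= D by rewrite subr_ge0 x12 /D lerDl subr_ge0.
  rewrite (le_trans (ler_normD _ _))// (splitr (e * D)) lerD//.
    rewrite (le_trans (normc_Re _))// normcM.
    have h2 : normc (A (zz x2 y) - A (zz x1 y)) <= e * D * c0 / 2.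
      rewrite (le_trans (normcB _ _))//.
      apply: le_trans (lerD (near_z _ _ x2P yy) (near_z _ _ x1P yy)) _.
      by rewrite e1L; clear; move: (_ * c0) => v; lra.
    apply: le_trans (ler_pM (normc_ge0 _) (normc_ge0 _) h2 (normc_cauchy_kernel y t1)) _.
    rewrite ler_pdivrMr//.
    have := mulr_ge0 (mulr_ge0 (ltW e0) D0) (_ : 0 <= 1 - normc t - c0).
    rewrite subr_ge0 => /(_ c0m); clear; move: (normc t) => v; lra.
  case/andP: x12D => x12D x12D'.
  rewrite normrM (ger0_norm x12D) mulrC.
  have h3 : `|complex.Re (F' * (e_ y - e_ y0))| <= M * e2.
    by rewrite (le_trans (normc_Re _))// normcM ler_pM// normc_ge0.
  apply: le_trans (ler_pM (normr_ge0 _) x12D h3 x12D') _.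
  by rewrite e2M; have := mulr_ge0 (ltW e0) D0; clear; move: D => v; lra.
have cRe (G : R -> R[i]) : continuous G ->
    lebesgue_measure.-integrable `[0, 1] (EFin \o (fun y => complex.Re (G y))).
  move=> cG; apply: continuous_on_integrable => y _.
  by apply: (@continuous_comp _ _ _ G (@complex.Re R)); [exact: cG|exact: continuous_Re].
apply/eqP; rewrite -subr_eq0 -normr_le0; apply/ler_addgt0Pl => /= e e0; rewrite addr0.
have : \forall z \near t, normc (F z - F t) < e * (1 - normc t).
  near=> z; rewrite normc_distC -ltcR -normr_normc; near: z.
  apply: cvgr_dist_lt; last by rewrite ltcR mulr_gt0.
  by apply: derivable_normc_continuous; apply: dF; rewrite ltW.
move=> /normc_near[d d0 dP].
pose l0 := Num.min 1 (d / 3).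
have l00 : 0 < l0 by rewrite lt_min ltr01 divr_gt0.
have l01 : l0 <= 1 by rewrite ge_min lexx.
have -> : (fun y => complex.Re (F (e_ y) * cauchy_kernel t y)) = Q 1.
  by apply/funext => y; rewrite /Q /zz rmorph1 mul1r subrKC.
rewrite (key _ l00 l01).
have l001 : 0 <= l0 <= 1 by rewrite l01 ltW.
have iQ : lebesgue_measure.-integrable `[0, 1] (EFin \o Q l0).
  by apply: continuous_on_integrable => y _; exact: cQ.
have iF : lebesgue_measure.-integrable `[0, 1]
    (EFin \o (fun y => complex.Re (F t * cauchy_kernel t y))).
  apply: cRe => y; apply: cvgM; first exact: cvg_cst.
  exact: continuous_cauchy_kernel.
have := Rint_dist (k := 0) (e := e) ler01 iQ iF.
rewrite mul0r subr0 subr0 mulr1; apply => y _.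
rewrite subr0 -Re_sub -mulrBl (le_trans (normc_Re _))// normcM.
have zzt : normc (zz l0 y - t) < d.
  rewrite /zz addrC addKr normcM normc_real (ger0_norm (ltW l00)).
  have l0d : l0 <= d / 3 by rewrite ge_min lexx orbT.
  apply: (@le_lt_trans _ _ (d / 3 * 2)); last by lra.
  by rewrite ler_pM// ?normc_ge0 ?normc_e_sub_le// ltW.
apply: le_trans (ler_pM (normc_ge0 _) (normc_ge0 _) (ltW (dP _ zzt)) (normc_cauchy_kernel y t1)) _.
by rewrite mulfK// gt_eqF.
Unshelve. all: by end_near. Qed.

Lemma derivable_mulC (g h : R[i] -> R[i]) z :
  derivable g z 1 -> derivable h z 1 -> derivable (fun w => g w * h w) z 1.
Proof. move=> dg dh; exact: (@derivableM R[i] R[i] g h z 1 dg dh). Qed.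

Lemma derivable_invC (h : R[i] -> R[i]) z : h z != 0 ->
  derivable h z 1 -> derivable (fun w => (h w)^-1) z 1.
Proof. move=> hz dh; exact: (@derivableV R[i] R[i] h z 1 hz dh). Qed.

Lemma derivable_subC (g h : R[i] -> R[i]) z :
  derivable g z 1 -> derivable h z 1 -> derivable (fun w => g w - h w) z 1.
Proof. move=> dg dh; exact: (@derivableB R[i] R[i] R[i] g h z 1 dg dh). Qed.

Lemma derivable_cstC (a z : R[i]) : derivable (fun _ : R[i] => a) z 1.
Proof. exact: (@derivable_cst R[i] R[i] R[i] a z 1). Qed.

Lemma derivable_idC (z : R[i]) : derivable (fun w : R[i] => w) z 1.
Proof. exact: (@derivable_id R[i] R[i] z 1). Qed.

Definition poisson_kernel t y := (1 - normc t ^+ 2) / normc (e_ y - t) ^+ 2.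

Lemma mulcJ z : z * z^*%C = (normc z ^+ 2)%:C.
Proof. by rewrite -sqr_normc normr_normc rmorphXn. Qed.

Lemma normc_conj z : normc z^*%C = normc z.
Proof. by case: z => a b /=; rewrite sqrrN. Qed.

Lemma divc_norm z w : w / z = (normc z ^- 2)%:C * (w * z^*%C).
Proof.
have [->|z0] := eqVneq z 0; first by rewrite invr0 conjc0 !mulr0.
have zJ : z^*%C != 0 by rewrite conjc_eq0.
rewrite fmorphV/= -mulcJ; move: (z^*%C) zJ => v v0; field.
by rewrite z0 v0.
Qed.

Lemma poisson_kernel_cauchy t y : normc t < 1 ->
  poisson_kernel t y = 2 * complex.Re (cauchy_kernel t y) - 1.
Proof.
move=> t1; have nz := e_sub_neq0 y t1.
have n2 : normc (e_ y - t) ^+ 2 != 0 by rewrite expf_neq0// gt_eqF// normc_gt0.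
have e2 : complex.Re (e_ y) ^+ 2 + complex.Im (e_ y) ^+ 2 = 1.
  by rewrite -sqr_normcE normc_e expr1n.
rewrite /cauchy_kernel divc_norm Re_realM /poisson_kernel.
suff -> : 1 - normc t ^+ 2 =
    2 * complex.Re (e_ y * (e_ y - t)^*%C) - normc (e_ y - t) ^+ 2.
  by move: n2; move: (normc (e_ y - t)) => v n2; field; apply: contraNneq n2 => ->; rewrite expr0n.
rewrite !sqr_normcE -[X in X - _ = _]e2 Re_sub Im_sub.
by case: (e_ y) => a b; case: t {t1 nz n2 e2} => c d /=; ring.
Qed.

Lemma continuous_poisson_kernel t : normc t < 1 -> continuous (poisson_kernel t).
Proof.
move=> t1; rewrite (_ : poisson_kernel t = fun y => 2 * complex.Re (cauchy_kernel t y) - 1).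
  move=> y; apply: cvgB; last exact: cvg_cst.
  apply: cvgM; first exact: cvg_cst.
  apply: (@continuous_comp _ _ _ (cauchy_kernel t) (@complex.Re R)).
    exact: continuous_cauchy_kernel.
  exact: continuous_Re.
by apply/funext => y; exact: poisson_kernel_cauchy.
Qed.

Lemma poisson_kernel_ge0 t y : normc t < 1 -> 0 <= poisson_kernel t y.
Proof.
move=> t1; rewrite divr_ge0 ?sqr_ge0// subr_ge0 expr_le1 ?normc_ge0//.
exact: ltW.
Qed.

Lemma poisson_kernel_le t y : normc t < 1 ->
  poisson_kernel t y <= (1 + normc t) / (1 - normc t).
Proof.
move=> t1; have m0 : 0 < 1 - normc t by rewrite subr_gt0.
rewrite /poisson_kernel ler_pdivrMr; last first.
  by rewrite exprn_gt0// normc_gt0 e_sub_neq0.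
rewrite mulrAC ler_pdivlMr//.
rewrite [leLHS](_ : _ = (1 + normc t) * (1 - normc t) ^+ 2); last by ring.
rewrite ler_wpM2l ?addr_ge0 ?normc_ge0// ler_pXn2r ?nnegrE ?normc_ge0 ?(ltW m0)//.
exact: normc_e_sub_ge.
Qed.

Let int01 (f : R -> R) := Rintegral lebesgue_measure `[0, 1] f.

(** Cauchy's mean applied to [g z (1 - |t|^2) / (1 - conj t z)], whose value at [t] is
    [g t] and whose product with the Cauchy kernel is, on the circle, [g] times the real
    Poisson kernel. *)
Lemma poisson_cauchy (g : R[i] -> R[i]) t : normc t < 1 ->
  (forall z, normc z <= 1 -> derivable g z 1) ->
  int01 (fun y => complex.Re (g (e_ y)) * poisson_kernel t y) =
  int01 (fun y => complex.Re (g t * cauchy_kernel t y)).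
Proof.
move=> t1 dg; pose c := (1 - normc t ^+ 2)%:C : R[i].
pose F z := g z * (c * (1 - t^*%C * z)^-1).
have nt z : normc z <= 1 -> 1 - t^*%C * z != 0.
  move=> z1; rewrite subr_eq0; apply: contraTneq t1 => /(congr1 (@normc R)).
  by rewrite normc1 normcM normc_conj => h; rewrite -leNgt h ler_piMr ?normc_ge0.
have c0 : c != 0.
  rewrite fmorph_eq0 gt_eqF// subr_gt0 expr_lt1 ?normc_ge0//.
have Ft : F t = g t.
  rewrite /F (_ : 1 - t^*%C * t = c) ?divff ?mulr1//.
  by rewrite mulrC mulcJ /c rmorphB/= rmorph1.
rewrite -Ft; transitivity (int01 (fun y => complex.Re (F (e_ y) * cauchy_kernel t y))); last first.
  apply: (@cauchy_mean F) => [//|z z1].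
  have d1 : derivable (fun w : R[i] => 1 - t^*%C * w) z 1 :=
    derivable_subC (@derivable_cstC 1 z) (derivable_mulC (@derivable_cstC _ z) (@derivable_idC z)).
  have d2 := @derivable_invC (fun w : R[i] => 1 - t^*%C * w) z (nt z z1) d1.
  have d3 := @derivable_mulC (fun=> c) (fun w : R[i] => (1 - t^*%C * w)^-1) z
    (@derivable_cstC c z) d2.
  exact: (@derivable_mulC g (fun w : R[i] => c * (1 - t^*%C * w)^-1) z (dg z z1) d3).
apply: eq_Rintegral => y _; rewrite mulrC -Re_realM; congr complex.Re.
have nz := e_sub_neq0 y t1.
have e1 : e_ y * (e_ y)^*%C = 1 by rewrite mulcJ normc_e expr1n.
have e0 : e_ y != 0 by apply: contra_eq_neq e1 => ->; rewrite mul0r eq_sym oner_neq0.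
rewrite /F /cauchy_kernel (_ : 1 - t^*%C * e_ y = e_ y * (e_ y - t)^*%C); last first.
  by rewrite rmorphB/= mulrBr e1 mulrC.
rewrite /poisson_kernel fmorph_div/= -mulcJ -/c.
have nzJ : (e_ y - t)^*%C != 0 by rewrite conjc_eq0.
move: (e_ y - t) (_^*%C) nz nzJ => v vJ nz nzJ; field.
by rewrite nz nzJ e0.
Qed.

Let integrable01 (f : R -> R) : continuous f ->
  lebesgue_measure.-integrable `[0, 1] (EFin \o f).
Proof. by move=> cf; apply: continuous_on_integrable => y _; exact: cf. Qed.

Let continuous_Re_kernel t : normc t < 1 ->
  continuous (fun y => complex.Re (cauchy_kernel t y)).
Proof.
move=> t1 y; apply: (@continuous_comp _ _ _ (cauchy_kernel t) (@complex.Re R)).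
  exact: continuous_cauchy_kernel.
exact: continuous_Re.
Qed.

Let continuous_Im_kernel t : normc t < 1 ->
  continuous (fun y => complex.Im (cauchy_kernel t y)).
Proof.
move=> t1 y; apply: (@continuous_comp _ _ _ (cauchy_kernel t) (@complex.Im R)).
  exact: continuous_cauchy_kernel.
exact: continuous_Im.
Qed.

Let int_Re_kernel t : normc t < 1 ->
  int01 (poisson_kernel t) = int01 (fun y => complex.Re (cauchy_kernel t y)).
Proof.
move=> t1; have := poisson_cauchy t1 (fun z _ => @derivable_cstC 1 z).
rewrite (_ : (fun y => _ * _) = poisson_kernel t); last first.
  by apply/funext => y; exact: mul1r.
by move=> ->; apply: eq_Rintegral => y _; rewrite mul1r.
Qed.

Let int_Im_kernel t : normc t < 1 ->
  int01 (fun y => complex.Im (cauchy_kernel t y)) = 0.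
Proof.
move=> t1; have := poisson_cauchy t1 (fun z _ => @derivable_cstC 'i%C z).
rewrite (_ : (fun y => _ * _) = (fun=> 0)); last first.
  by apply/funext => y; exact: mul0r.
rewrite (_ : (fun y => complex.Re _) = (fun y => -1 * complex.Im (cauchy_kernel t y))); last first.
  by apply/funext => y; rewrite mulrC ReiNIm mulN1r.
rewrite /int01 RintegralZl//; last exact/integrable01/continuous_Im_kernel.
by rewrite Rint_cst// mul0r mulN1r => /esym/eqP; rewrite oppr_eq0 => /eqP.
Qed.

(** With [g = 1], [poisson_cauchy] gives the mean of the Poisson kernel as that of the
    real part of the Cauchy kernel, while pointwise the former is twice the latter minus
    one; both means are therefore 1. Taking [g = i] instead kills the imaginary part. *)
Lemma int_poisson_kernel t : normc t < 1 -> int01 (poisson_kernel t) = 1.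
Proof.
move=> t1; have := int_Re_kernel t1.
rewrite {1}(_ : poisson_kernel t = fun y => 2 * complex.Re (cauchy_kernel t y) - 1); last first.
  by apply/funext => y; exact: poisson_kernel_cauchy.
have iR := integrable01 (continuous_Re_kernel t1).
rewrite {1}/int01 RintegralB ?RintegralZl ?Rint_cst//; last 2 first.
- by apply: integrable01 => y; apply: cvgM; [exact: cvg_cst|exact: continuous_Re_kernel].
- by apply: integrable01 => y; exact: cst_continuous.
by rewrite int_Re_kernel// /int01 => h; lra.
Qed.

(** Poisson's formula: the Cauchy kernel has mean 1, so the mean of [Re (g t * kernel)]
    is [Re (g t)]. *)
Lemma poisson_formula (g : R[i] -> R[i]) t : normc t < 1 ->
  (forall z, normc z <= 1 -> derivable g z 1) ->
  int01 (fun y => complex.Re (g (e_ y)) * poisson_kernel t y) = complex.Re (g t).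
Proof.
move=> t1 dg; rewrite poisson_cauchy//.
rewrite (_ : (fun y => complex.Re _) = (fun y => complex.Re (g t) * complex.Re (cauchy_kernel t y) -
   complex.Im (g t) * complex.Im (cauchy_kernel t y))); last first.
  by apply/funext => y; case: (g t) => a b; case: (cauchy_kernel t y).
have iR := integrable01 (continuous_Re_kernel t1).
have iI := integrable01 (continuous_Im_kernel t1).
rewrite /int01 RintegralB//; last 2 first.
- by apply: integrable01 => y; apply: cvgM; [exact: cvg_cst|exact: continuous_Re_kernel].
- by apply: integrable01 => y; apply: cvgM; [exact: cvg_cst|exact: continuous_Im_kernel].
rewrite !RintegralZl// [Rintegral _ _ _ in X in _ - X]int_Im_kernel// mulr0 subr0.
by rewrite -[Rintegral _ _ _]/(int01 _) -int_Re_kernel// int_poisson_kernel// mulr1.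
Qed.

End circle.

(** * Fatou's theorem *)

Section fatou.
Context {R : realType}.
Implicit Types (z w s t : R[i]) (x y : R).
Local Notation mu := (@lebesgue_measure R).
Local Notation int01 := (Rintegral (@lebesgue_measure R) `[0, 1]).

Lemma sqr_normc_e_sub x y :
  normc (e_ y - e_ x) ^+ 2 = 2 - 2 * cos (pi *+ 2 * (y - x)) :> R.
Proof.
rewrite sqr_normcE !e_E /= mulrBr cosB.
move: (cos2Dsin2 (pi *+ 2 * x)) (cos2Dsin2 (pi *+ 2 * y)).
move: (cos (_ * x)) (sin (_ * x)) (cos (_ * y)) (sin (_ * y)) => a b c d.
move=> h1 h2.
rewrite [LHS](_ : _ = (a ^+ 2 + b ^+ 2) + (c ^+ 2 + d ^+ 2) - 2 * (c * a + d * b)); last by ring.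
by rewrite h1 h2.
Qed.

(** On [0, 1] the parametrisation of the circle is injective away from the endpoints:
    parameters at distance [d] from an interior point have images at distance [m]. *)
Lemma e_far x d : 0 < x < 1 -> 0 < d ->
  exists2 m, 0 < m & forall y, 0 <= y <= 1 -> d <= `|y - x| -> m <= normc (e_ y - e_ x).
Proof.
move=> /andP[x0 x1] d0.
have [d1 [d10 dd d2 dx dx']] : exists d1,
    [/\ 0 < d1, d1 <= d, d1 <= 1 / 2, d1 <= x & d1 <= 1 - x].
  exists (Num.min (Num.min d (1 / 2)) (Num.min x (1 - x))).
  by rewrite !lt_min d0 x0 subr_gt0 x1 divr_gt0// !ge_min !lexx ?orbT.
have pi20 : 0 < pi *+ 2 :> R by rewrite pmulrn_lgt0 ?pi_gt0.
have pi0 := pi_gt0 R.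
have itv (v : R) : 0 <= v <= 1 / 2 -> pi *+ 2 * v \in `[0, pi].
  move=> /andP[v0 v2]; rewrite in_itv/= mulr_ge0 ?(ltW pi20)//.
  rewrite /= (_ : pi *+ 2 * v = pi * (v *+ 2)); last by rewrite mulrnAl mulrnAr.
  by apply: ler_piMr; [exact: ltW|rewrite -mulr_natr; lra].
have id1 : pi *+ 2 * d1 \in `[0, pi] by apply: itv; rewrite d2 ltW.
have i0 : (0 : R) \in `[0, pi] by rewrite in_itv/= lexx ltW.
have cd : cos (pi *+ 2 * d1) < 1 :> R by rewrite -(cos0 R) ltr_cos// mulr_gt0.
have far (u : R) : d1 <= u <= 1 / 2 -> cos (pi *+ 2 * u) <= cos (pi *+ 2 * d1) :> R.
  move=> /andP[du u2]; have := du; rewrite le_eqVlt => /predU1P[<-//|du'].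
  by rewrite ltW// ltr_cos ?ltr_pM2l// itv// u2 (le_trans (ltW d10)).
exists (Num.sqrt (2 - 2 * cos (pi *+ 2 * d1))); first by rewrite sqrtr_gt0; lra.
move=> y /andP[y0 y1] dyx.
rewrite -(ler_pXn2r (n := 2))// ?nnegrE ?normc_ge0 ?sqrtr_ge0//.
rewrite sqr_sqrtr ?sqr_normc_e_sub; last by lra.
rewrite lerD2l lerN2 ler_pM2l//.
have -> : cos (pi *+ 2 * (y - x)) = cos (pi *+ 2 * `|y - x|).
  by have [_|_] := ger0P (y - x); rewrite // mulrN cosN.
have yx1 : `|y - x| <= 1 - d1 by rewrite ler_norml; lra.
have [u2|u2] := leP `|y - x| (1 / 2).
  by apply: far; rewrite u2 (le_trans dd).
rewrite -cosN -cosD2pi (_ : _ + _ = pi *+ 2 * (1 - `|y - x|)); last by ring.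
by apply: far; lra.
Qed.

Lemma e_near x : exists2 d, 0 < d & forall y, `|y - x| < d -> `|y - x| <= normc (e_ y - e_ x).
Proof.
have /nbhs_ballP[d d0 dP] := e_littleo x (@ltr01 R).
exists d; first exact: d0.
move=> y yx; set N := normc (e_ y - e_ x); have {dP}h : normc (e_ y - e_ x - tau_i * e_ x * (y - x)%:C) <= 1 * `|y - x|.
  by apply: dP; rewrite /ball/= distrC.
have : normc (@tau_i R * e_ x * (y - x)%:C) <= N + `|y - x|.
  rewrite -[X in normc X](subKr (e_ y - e_ x)) (le_trans (normcB _ _))// lerD2l.
  by rewrite (le_trans h)// mul1r.
rewrite !normcM normc_e normc_real mulr1 (_ : normc tau_i = pi *+ 2); last first.
  by rewrite /tau_i /= expr0n add0r sqrtr_sqr ger0_norm// mulrn_wge0// pi_ge0.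
have : 2 * `|y - x| <= pi *+ 2 * `|y - x|.
  by rewrite ler_wpM2r//; have := pi_ge2 R; rewrite -mulr_natr; lra.
by clear; move: `|y - x| N (pi *+ 2) => a b c h1 h2; lra.
Qed.

Lemma normc_re r x : 0 <= r -> normc (r%:C * e_ x) = r.
Proof. by move=> r0; rewrite normcM normc_e normc_real mulr1 ger0_norm. Qed.

Lemma poisson_kernel_peak r x y : 0 <= r < 1 ->
  poisson_kernel (r%:C * e_ x) y <= 2 / (1 - r).
Proof.
move=> /andP[r0 r1]; have n1 : normc (r%:C * e_ x) < 1 by rewrite normc_re.
rewrite (le_trans (poisson_kernel_le _ n1))// normc_re//.
by rewrite ler_wpM2r ?invr_ge0 ?subr_ge0 ?(ltW r1)//; lra.
Qed.

Lemma poisson_kernel_tail r x y m : 0 <= r < 1 -> 0 < m -> m <= normc (e_ y - e_ x) ->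
  poisson_kernel (r%:C * e_ x) y <= 8 * (1 - r) / m ^+ 2.
Proof.
move=> /andP[r0 r1] m0 my; have n1 : normc (r%:C * e_ x) < 1 by rewrite normc_re.
have half : m / 2 <= normc (e_ y - r%:C * e_ x).
  rewrite ler_pdivrMr// (le_trans my)// mulrDr mulr1.
  rewrite -(subrK (r%:C * e_ x) (e_ y)) -addrA (le_trans (le_normcD _ _))// subrK.
  rewrite lerD2l; apply: le_trans (normc_e_sub_ge _ _).
  rewrite normc_re// (_ : _ - _ = (r - 1)%:C * e_ x); last first.
    by rewrite rmorphB/= rmorph1 mulrBl mul1r.
  by rewrite normcM normc_e mulr1 normc_real distrC ger0_norm// subr_ge0 ltW.
rewrite /poisson_kernel normc_re// ler_pdivrMr; last first.
  by rewrite exprn_gt0// (lt_le_trans _ half)// divr_gt0.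
apply: (@le_trans _ _ (8 * (1 - r) / m ^+ 2 * (m / 2) ^+ 2)).
  rewrite [leRHS](_ : _ = 2 * (1 - r)); last by field; rewrite gt_eqF.
  nra.
apply: ler_wpM2l; first by rewrite divr_ge0 ?exprn_ge0 ?mulr_ge0 ?(ltW m0)// subr_ge0 ltW.
by rewrite ler_pXn2r// nnegrE ?normc_ge0// divr_ge0 ?ltW.
Qed.

Let itv01 := `[0 : R, 1 : R]%classic.

(** The kernel at the point of radius [r] is dominated by a combination of indicators of
    balls of radii [2^j (1 - r)] about [x], with weights whose products with these radii
    sum geometrically, up to a remainder of order [1 - r]. *)
Lemma poisson_kernel_dyadic r x d m N y : 0 <= r < 1 -> 0 < m ->
  (forall y, `|y - x| < d -> `|y - x| <= normc (e_ y - e_ x)) ->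
  (forall y, 0 <= y <= 1 -> d <= `|y - x| -> m <= normc (e_ y - e_ x)) ->
  d <= 2 ^+ N * (1 - r) -> 0 <= y <= 1 ->
  poisson_kernel (r%:C * e_ x) y <=
    \sum_(j < N.+1) 32 / 4 ^+ j / (1 - r) * \1_(ball x (Num.min (2 ^+ j * (1 - r)) d)) y
    + 8 * (1 - r) / m ^+ 2.
Proof.
move=> r01 m0 nearP farP dN y01; have /andP[r0 r1] := r01.
have d0 : 0 < 1 - r by rewrite subr_gt0.
have tpos (j : nat) : 0 <= 32 / 4 ^+ j / (1 - r) * \1_(ball x (Num.min (2 ^+ j * (1 - r)) d)) y.
  by rewrite mulr_ge0// ?divr_ge0 ?exprn_ge0 ?(ltW d0)// indicE ler0n.
have far0 : 0 <= 8 * (1 - r) / m ^+ 2 by rewrite divr_ge0 ?mulr_ge0 ?exprn_ge0 ?(ltW d0) ?(ltW m0).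
have [dy|yd] := leP d `|y - x|.
  rewrite (le_trans (poisson_kernel_tail r01 m0 (farP _ y01 dy)))// lerDr.
  by apply: sumr_ge0 => j _.
have exj : exists j, `|y - x| < 2 ^+ j * (1 - r).
  by exists N; exact: lt_le_trans dN.
(* The first ball that contains [y]; its term alone dominates the kernel. *)
case: (ex_minnP exj) => j jy jmin.
have jN : (j < N.+1)%N by rewrite ltnS; apply: jmin; exact: lt_le_trans dN.
rewrite (bigD1 (Ordinal jN))//= -addrA -[leLHS]addr0 lerD//; last first.
  by rewrite addr_ge0//; apply: sumr_ge0 => i _.
rewrite indicE mem_set ?mulr1; last first.
  by rewrite /ball/= distrC lt_min jy.
case: j jy jmin {jN} => [|j] jy jmin.
  rewrite (le_trans (poisson_kernel_peak _ _ r01))// expr0 divr1 ler_wpM2r//.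
    by rewrite invr_ge0 ltW.
  by rewrite ler_nat.
have jy' : 2 ^+ j * (1 - r) <= `|y - x|.
  by rewrite leNgt; apply/negP => /jmin; rewrite ltnn.
have p0 : 0 < 2 ^+ j * (1 - r) by rewrite mulr_gt0 ?exprn_gt0.
rewrite (le_trans (poisson_kernel_tail r01 p0 (le_trans jy' (nearP _ yd))))//.
rewrite le_eqVlt; apply/orP; left; apply/eqP.
rewrite (_ : 4 = 2 * 2 :> R); last by rewrite -natrM.
rewrite (exprMn _ 2 2) !exprS; field.
by rewrite gt_eqF// expf_neq0.
Qed.

Lemma sum_half N : \sum_(j < N) (2 : R) ^- j <= 2.
Proof.
suff -> : \sum_(j < N) (2 : R) ^- j = 2 - 2 * 2 ^- N.
  by rewrite gerBl mulr_ge0// invr_ge0 exprn_ge0.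
elim: N => [|N IH]; first by rewrite big_ord0 expr0 invr1 mulr1 subrr.
by rewrite big_ord_recr/= IH exprS; field; rewrite expf_neq0.
Qed.

Lemma integrable_mul_bounded (f g : R -> R) (M : R) : mu.-integrable itv01 (EFin \o f) ->
  measurable_fun itv01 g -> (forall y, itv01 y -> `|g y| <= M) ->
  mu.-integrable itv01 (EFin \o (fun y => f y * g y)).
Proof.
have m01 : measurable itv01 by exact: measurable_itv.
move=> intf mg gM; rewrite (_ : _ \o _ = (EFin \o f) \* (EFin \o g))%E//.
apply: integrableMl => //; exists M; split; first exact: num_real.
by move=> N MN y /gM; move/le_trans; apply; exact: ltW.
Qed.

Lemma EFin_int01 (f : R -> R) : mu.-integrable itv01 (EFin \o f) ->
  ((int01 f)%:E = \int[mu]_(y in itv01) (f y)%:E)%E.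
Proof.
by move=> intf; rewrite /Rintegral fineK//; exact: integrable_fin_num.
Qed.

(** The hypothesis on [x] is that of a Lebesgue point. Integrating [|h - h x|] against the
    dyadic bound of the kernel gives a geometric series of averages over small balls. *)
Lemma fatou_pointwise (h : R -> R) x : mu.-integrable itv01 (EFin \o h) -> 0 < x < 1 ->
  (forall e : R, 0 < e -> exists2 d0 : R, 0 < d0 & forall d : R, 0 < d -> d <= d0 ->
    (\int[mu]_(y in ball x d) `|h y - h x|%:E <= (e * d)%:E)%E) ->
  int01 (fun y => h y * poisson_kernel (r%:C * e_ x) y) @[r --> (1 : R)^'-] --> h x.
Proof.
move=> ih x01 hx; apply/cvgrPdist_le => /= e e0.
have e1 : 0 < e / 128 by rewrite divr_gt0.
have [d0 d00 d0P] := hx _ e1.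
have [d1 d10 d1P] := e_near x.
have /andP[x0 x1] := x01.
have [d [dp dd0 dd1 dx dx']] : exists d,
    [/\ 0 < d, d <= d0, d <= d1, d <= x & d <= 1 - x].
  exists (Num.min (Num.min d0 d1) (Num.min x (1 - x))).
  by rewrite !lt_min d00 d10 x0 subr_gt0 x1 !ge_min !lexx ?orbT.
have [m m0 mP] := e_far x01 dp.
have m01 : measurable itv01 by exact: measurable_itv.
pose k y := `|h y - h x|.
have ic (c : R) : mu.-integrable itv01 (EFin \o (fun=> c)).
  by apply: continuous_on_integrable => y _; exact: cst_continuous.
have ihB : mu.-integrable itv01 (EFin \o (fun y => h y - h x)).
  by have := integrableB _ ih (ic (h x)); apply.
have ik : mu.-integrable itv01 (EFin \o k) by exact: integrable_norm.
have mk : measurable_fun itv01 k.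
  by apply/measurable_EFinP; case/integrableP : ik.
have k0 y : 0 <= k y by exact: normr_ge0.
pose Ik := int01 k.
have Ik0 : 0 <= Ik by apply: Rintegral_ge0 => y _; exact: normr_ge0.
have Ik1 : 0 < 16 * (Ik + 1) by rewrite mulr_gt0// ltr_wpDl.
near=> r.
have r01 : 0 <= r < 1 by apply/andP; split; near: r; [exact: nbhs_left_ge|exact: nbhs_left_lt].
have n1 : normc (r%:C * e_ x) < 1 by case/andP: r01 => ? ?; rewrite normc_re.
set pk := poisson_kernel (r%:C * e_ x).
have delta0 : 0 < 1 - r by case/andP: r01 => _; rewrite subr_gt0.
have small : 8 * (1 - r) / m ^+ 2 * Ik <= e / 2.
  have rm : 1 - r <= e * m ^+ 2 / (16 * (Ik + 1)).
    rewrite lerBlDr -lerBlDl; near: r; apply: nbhs_left_ge.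
    by rewrite gtrBl; apply: divr_gt0 => //; apply: mulr_gt0 => //; exact: exprn_gt0.
  apply: (@le_trans _ _ (8 * (e * m ^+ 2 / (16 * (Ik + 1))) / m ^+ 2 * Ik)).
    by rewrite ler_wpM2r// ler_wpM2r ?invr_ge0 ?exprn_ge0 ?(ltW m0)// ler_wpM2l.
  rewrite [leLHS](_ : _ = e / 2 * (Ik / (Ik + 1))); last first.
    by field; rewrite !gt_eqF// ltr_wpDl.
  by rewrite ler_piMr ?divr_ge0 ?(ltW e0)// ler_pdivrMr ?mul1r ?lerDl// ltr_wpDl.
have [N NP] : exists N, d <= 2 ^+ N * (1 - r).
  exists (Num.bound (d / (1 - r))); rewrite -ler_pdivrMr//.
  have : 0 <= d / (1 - r) by rewrite divr_ge0 ?ltW.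
  move=> /archi_boundP/ltW/le_trans; apply.
  by rewrite -natrX ler_nat ltnW// ltn_expl.
have cpk := continuous_poisson_kernel n1.
have pk0 y : 0 <= pk y by exact: poisson_kernel_ge0.
have mpk : measurable_fun itv01 pk.
  by apply: measurable_funTS; exact: continuous_measurable_fun.
have bpk y : itv01 y -> `|pk y| <= (1 + r) / (1 - r).
  move=> _; rewrite ger0_norm//; have := poisson_kernel_le y n1.
  by rewrite normc_re//; case/andP: r01.
have ihpk := integrable_mul_bounded ih mpk bpk.
have ikpk := integrable_mul_bounded ik mpk bpk.
have ihBpk := integrable_mul_bounded ihB mpk bpk.
have icpk := integrable_mul_bounded (ic (h x)) mpk bpk.
have ipk : mu.-integrable itv01 (EFin \o pk).
  by apply: continuous_on_integrable => y _; exact: cpk.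
have -> : h x = int01 (fun y => h x * pk y) by rewrite RintegralZl// int_poisson_kernel// mulr1.
rewrite distrC -RintegralB//.
have -> : (fun y => h y * pk y - h x * pk y) = (fun y => (h y - h x) * pk y).
  by apply/funext => y; rewrite mulrBl.
apply: (@le_trans _ _ (int01 (fun y => `|(h y - h x) * pk y|))).
  by apply: le_normr_Rintegral => //; exact: measurable_itv.
have -> : (fun y => `|(h y - h x) * pk y|) = (fun y => k y * pk y).
  by apply/funext => y; rewrite normrM (ger0_norm (pk0 y)).
rewrite -lee_fin EFin_int01//.
pose c (j : nat) := 32 / 4 ^+ j / (1 - r).
have c0 j : 0 <= c j by rewrite divr_ge0 ?(ltW delta0)// divr_ge0// exprn_ge0.
pose B (j : nat) : set R := ball x (Num.min (2 ^+ j * (1 - r)) d).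
have kB0 j y : 0 <= k y * \1_(B j) y by rewrite mulr_ge0// indicE ler0n.
have mB j : measurable (B j : set (measurableTypeR R)) by exact: measurable_ball.
have mkB j : measurable_fun itv01 (fun y => (k y * \1_(B j) y)%:E).
  by apply/measurable_EFinP; apply: measurable_funM => //; exact: (measurable_indic (mB j)).
have far0 : 0 <= 8 * (1 - r) / m ^+ 2 by rewrite divr_ge0 ?mulr_ge0 ?exprn_ge0 ?(ltW delta0) ?(ltW m0).
apply: (@le_trans _ _ (\int[mu]_(y in itv01)
   (\sum_(j < N.+1) ((c j)%:E * (k y * \1_(B j) y)%:E) + (8 * (1 - r) / m ^+ 2)%:E * (k y)%:E))%E).
  apply: ge0_le_integral => //.
  - by move=> y _; rewrite lee_fin mulr_ge0.
  - by apply/measurable_EFinP; exact: measurable_funM.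
  - apply: emeasurable_funD.
      apply: emeasurable_sum => j; apply: measurable_funeM; exact: mkB.
    by apply: measurable_funeM; exact/measurable_EFinP.
  move=> y; rewrite /itv01/= in_itv/= => y01.
  under eq_bigr do rewrite -EFinM.
  rewrite sumEFin -EFinM -EFinD lee_fin.
  have nearP (z : R) : `|z - x| < d -> `|z - x| <= normc (e_ z - e_ x).
    by move=> zd; apply: d1P; exact: lt_le_trans dd1.
  have := poisson_kernel_dyadic r01 m0 nearP mP NP y01 => /(ler_wpM2l (normr_ge0 (h y - h x))).
  rewrite -/(k y) mulrDr mulr_sumr => /le_trans; apply.
  rewrite [leRHS]addrC addrC lerD ?[k y * _]mulrC//.
  by apply: ler_sum => j _; rewrite mulrCA.
rewrite ge0_integralD//; last 4 first.
- by move=> y _; apply: sume_ge0 => j _; rewrite mule_ge0// lee_fin.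
- apply: emeasurable_sum => j; apply: measurable_funeM; exact: mkB.
- by move=> y _; rewrite mule_ge0// lee_fin.
- by apply: measurable_funeM; exact/measurable_EFinP.
rewrite (splitr e) EFinD; apply: leeD; last first.
  rewrite ge0_integralZl//; last 2 first.
  - exact/measurable_EFinP.
  - by move=> y _; rewrite lee_fin.
  by rewrite -EFin_int01// -EFinM lee_fin.
rewrite ge0_integral_sum//; last 2 first.
- move=> j; apply: measurable_funeM; exact: mkB.
- by move=> j y _; rewrite mule_ge0// lee_fin.
apply: (@le_trans _ _ (\sum_(j < N.+1) (32 * (e / 128) * 2 ^- j)%:E)%E); last first.
  rewrite sumEFin lee_fin -mulr_sumr.
  rewrite [leRHS](_ : _ = 32 * (e / 128) * 2); last by field.
  by rewrite ler_wpM2l ?sum_half// mulr_ge0// ltW.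
apply: lee_sum => j _.
rewrite ge0_integralZl//; last 3 first.
- exact: mkB.
- by move=> y _; rewrite lee_fin.
- by rewrite lee_fin.
have -> : (\int[mu]_(y in itv01) (k y * \1_(B j) y)%:E = \int[mu]_(y in B j) (k y)%:E)%E.
  have BD : B j `<=` itv01.
    move=> y; rewrite /B /ball/= /itv01/= in_itv/= lt_min => /andP[_].
    by rewrite ltr_norml => /andP[]; move: dx dx'; clear; lra.
  rewrite -[in RHS](setIidr BD) integral_mkcondr; apply: eq_integral => y _.
  by rewrite epatch_indic EFinM.
set bj := Num.min (2 ^+ j * (1 - r)) d.
have bj0 : 0 < bj by rewrite lt_min dp mulr_gt0 ?exprn_gt0.
have bjd : bj <= d0 by rewrite ge_min dd0 orbT.
apply: (@le_trans _ _ ((c j)%:E * (e / 128 * bj)%:E)%E).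
  by apply: lee_wpmul2l; [rewrite lee_fin|exact: d0P].
rewrite -EFinM lee_fin.
have bj2 : bj <= 2 ^+ j * (1 - r) by rewrite ge_min lexx.
apply: (@le_trans _ _ (c j * (e / 128 * (2 ^+ j * (1 - r))))).
  by rewrite ler_wpM2l// ler_wpM2l// ltW.
rewrite le_eqVlt; apply/orP; left; apply/eqP; rewrite /c.
rewrite (_ : 4 = 2 * 2 :> R); last by rewrite -natrM.
rewrite (exprMn _ 2 2); field.
by rewrite expf_neq0//= gt_eqF.
Unshelve. all: by end_near. Qed.

(** Almost every point is a Lebesgue point of [h], extended by zero outside [0, 1]. *)
Lemma fatou_radial (h : R -> R) : mu.-integrable itv01 (EFin \o h) ->
  {ae mu, forall x, 0 < x < 1 ->
    int01 (fun y => h y * poisson_kernel (r%:C * e_ x) y) @[r --> (1 : R)^'-] --> h x}.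
Proof.
move=> ih; have li : locally_integrable setT (h \_ itv01).
  by apply: integrable_locally_restrict => //; exact: measurable_itv.
have [M [mM M0 subM]] := lebesgue_differentiation li; exists M; split => // x nPx.
apply: subM => /= hx; apply: nPx => x01.
have /andP[x0 x1] := x01.
have x01' : x \in itv01 by rewrite inE /itv01/= in_itv/= !ltW.
apply: fatou_pointwise => // e e0.
have e2 : 0 < e / 2 by rewrite divr_gt0.
move: hx; rewrite /lebesgue_pt => /fine_cvgP[dfin].
move=> /cvgrPdist_lt /(_ _ e2) dsmall.
have dnear : \forall c \near (0 : R), 0 < c ->
    (davg (h \_ itv01) x c \is a fin_num /\ `|0 - fine (davg (h \_ itv01) x c)| < e / 2) :=
  filterI dfin dsmall.
have /nbhs_ballP[d d0 dP] := dnear (at_right_proper_filter 0).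
exists (Num.min (d / 2) (Num.min x (1 - x))).
  by rewrite !lt_min x0 subr_gt0 x1 divr_gt0.
move=> c c0; rewrite !le_min => /and3P[cd cx cx'].
have cd2 : c < d by rewrite (le_lt_trans cd)// ltr_pdivrMr// ltr_pMr// ltrDl.
have [|] := dP c _ c0.
  by rewrite /ball/= sub0r normrN gtr0_norm.
rewrite sub0r normrN; set D := davg _ _ _ => Dfin Dlt.
have -> : (\int[mu]_(y in ball x c) `|h y - h x|%:E)%E = ((c *+ 2)%:E * D)%E.
  rewrite /D /davg /iavg lebesgue_measure_ball ?(ltW c0)//.
  have c2 : c *+ 2 != 0 by rewrite mulrn_eq0/= gt_eqF.
  rewrite muleA inver (negbTE c2) -EFinM divff// mul1e.
  apply: eq_integral => y yB; congr (_%:E).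
  have yI : y \in itv01.
    move: yB; rewrite !inE /ball/= /itv01/= in_itv/= ltr_norml => /andP[].
    by move: cx cx'; clear; lra.
  by rewrite /= !patchE x01' yI.
rewrite -(fineK Dfin) -EFinM lee_fin.
apply: (@le_trans _ _ (c *+ 2 * (e / 2))).
  by rewrite ler_pM2l ?pmulrn_lgt0// (le_trans (ler_norm _))// ltW.
by rewrite le_eqVlt; apply/orP; left; apply/eqP; rewrite -mulr_natr; field.
Qed.

End fatou.

(** * A strictly convex function of linear growth *)

Section psi.
Context {R : realType}.
Implicit Types a b : R.

Definition psi a : R := Num.sqrt (1 + a ^+ 2).

Lemma psi_ge1 a : 1 <= psi a.
Proof. by rewrite -sqrtr1 ler_wsqrtr// lerDl sqr_ge0. Qed.

Lemma psi_gt0 a : 0 < psi a.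
Proof. exact: lt_le_trans (psi_ge1 a). Qed.

Lemma sqr_psi a : psi a ^+ 2 = 1 + a ^+ 2.
Proof. by rewrite sqr_sqrtr// addr_ge0// sqr_ge0. Qed.

Lemma psi_le a : psi a <= 1 + `|a|.
Proof.
rewrite -(ler_pXn2r (n := 2))// ?nnegrE ?(ltW (psi_gt0 _)) ?addr_ge0//.
rewrite sqr_psi sqrrD expr1n mul1r real_normK ?num_real// -addrA lerD2l lerDr.
by rewrite mulrn_wge0.
Qed.

Lemma psi_mul_ge a b : 1 + a * b <= psi a * psi b.
Proof.
apply: le_trans (ler_norm _) _.
rewrite -(ler_pXn2r (n := 2))// ?nnegrE ?mulr_ge0 ?(ltW (psi_gt0 _))//.
rewrite real_normK ?num_real// exprMn !sqr_psi.
by have := sqr_ge0 (a - b); nra.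
Qed.

Lemma psi_tangent a b : psi a + a / psi a * (b - a) <= psi b.
Proof.
have p := psi_gt0 a; rewrite -(ler_pM2l p).
have -> : psi a * (psi a + a / psi a * (b - a)) = psi a ^+ 2 + a * (b - a).
  by field; rewrite gt_eqF.
rewrite sqr_psi; have := psi_mul_ge a b; lra.
Qed.

Lemma psi_lipschitz a b : `|psi a - psi b| <= `|a - b|.
Proof.
wlog ab : a b / psi b <= psi a.
  move=> H; have [/H//|/ltW/H] := leP (psi b) (psi a).
  by rewrite distrC [leRHS]distrC.
rewrite ger0_norm ?subr_ge0//.
have h1 : psi a - psi b <= a / psi a * (a - b).
  by have := psi_tangent a b; lra.
apply: (le_trans h1); apply: (le_trans (ler_norm _)); rewrite normrM ler_piMl//.
rewrite normrM normfV ler_pdivrMr ?normr_gt0 ?gt_eqF ?psi_gt0// mul1r.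
rewrite (ger0_norm (ltW (psi_gt0 a))) -sqrtr_sqr ler_wsqrtr//.
by rewrite lerDr.
Qed.

(** The defect in the midpoint convexity of [psi]. *)
Definition psi_gap a b := psi a + psi b - 2 * psi ((a + b) / 2).

(** Rationalising the square roots twice. *)
Lemma psi_gap_identity a b :
  psi_gap a b * ((psi a * psi b + (1 + a * b)) * (psi a + psi b + 2 * psi ((a + b) / 2))) =
  2 * (a - b) ^+ 2.
Proof.
have hA := sqr_psi a; have hB := sqr_psi b; have hC := sqr_psi ((a + b) / 2).
rewrite /psi_gap; move: (psi a) (psi b) (psi ((a + b) / 2)) hA hB hC => A B C hA hB hC.
have hC4 : 4 * C ^+ 2 = 4 + (a + b) ^+ 2 by rewrite hC; field.
have e1 : (A + B - 2 * C) * (A + B + 2 * C) = 2 * (A * B - (1 + a * b)).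
  rewrite [LHS](_ : _ = 2 * A * B + (A ^+ 2 + B ^+ 2 - 4 * C ^+ 2)); last by ring.
  by rewrite hA hB hC4; ring.
rewrite [LHS](_ : _ = (A * B + (1 + a * b)) * ((A + B - 2 * C) * (A + B + 2 * C))); last by ring.
rewrite e1 [LHS](_ : _ = 2 * (A ^+ 2 * B ^+ 2 - (1 + a * b) ^+ 2)); last by ring.
by rewrite hA hB; ring.
Qed.

Lemma psi_gap_ge0 a b : 0 <= psi_gap a b.
Proof.
have h := psi_tangent ((a + b) / 2) a; have h' := psi_tangent ((a + b) / 2) b.
rewrite /psi_gap; move: h h'; set c := (a + b) / 2.
have -> : a - c = (a - b) / 2 by rewrite /c; field.
have -> : b - c = - ((a - b) / 2) by rewrite /c; field.
by rewrite mulrN; lra.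
Qed.

(** Strict convexity of [psi], quantified on bounded sets: in the identity above the
    factors of the gap are bounded in terms of [K]. *)
Lemma psi_gap_strict a b K : 0 <= K -> `|a| <= K -> `|b| <= K ->
  (a - b) ^+ 2 <= 4 * (1 + K) ^+ 3 * psi_gap a b.
Proof.
move=> K0 aK bK; have := psi_gap_identity a b; have g0 := psi_gap_ge0 a b.
have cK : `|(a + b) / 2| <= K.
  rewrite normrM (ger0_norm (_ : 0 <= 2^-1)) ?invr_ge0// ler_pdivrMr//.
  by rewrite (le_trans (ler_normD _ _))//; lra.
have psiK c : `|c| <= K -> psi c <= 1 + K by move=> ?; rewrite (le_trans (psi_le c))// lerD2l.
have pA := psiK _ aK; have pB := psiK _ bK; have pC := psiK _ cK.
have A1 := psi_gt0 a; have B1 := psi_gt0 b; have C1 := psi_gt0 ((a + b) / 2).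
have AB := psi_mul_ge a b.
set S := psi a + psi b + _; set T := psi a * psi b + _; set g := psi_gap a b => id.
have S4 : 0 <= S <= 4 * (1 + K) by rewrite /S; lra.
have T2 : T <= 2 * (1 + K) ^+ 2.
  apply: (@le_trans _ _ (2 * (psi a * psi b))); first by rewrite /T; lra.
  by rewrite ler_pM2l// expr2 ler_pM// ltW.
have : g * (T * S) <= g * (2 * (1 + K) ^+ 2 * (4 * (1 + K))).
  rewrite ler_wpM2l//; have [T0|/ltW T0] := leP 0 T.
    by case/andP: S4 => *; rewrite ler_pM.
  case/andP: S4 => S0 _; apply: (@le_trans _ _ 0); first by rewrite mulr_le0_ge0.
  by rewrite !mulr_ge0 ?exprn_ge0// ?addr_ge0.
rewrite id [X in _ <= X](_ : _ = 2 * (4 * (1 + K) ^+ 3 * g)); last by ring.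
by rewrite ler_pM2l.
Qed.

(** The gap controls [a - b] while both are at most [K]; otherwise the larger one is
    controlled by its [q]-th power, with a constant that tends to 0 with [1 / K]. *)
Lemma abs_sub_le_gap a b q K e : 1 < q -> 0 < K -> 0 < e ->
  `|a - b| <= e + 4 * (1 + K) ^+ 3 / e * psi_gap a b +
     2 * K `^ (1 - q) * (`|a| `^ q + `|b| `^ q).
Proof.
move=> q1 K0 e0; have g0 := psi_gap_ge0 a b.
have K1 : 0 < 1 + K by rewrite addr_gt0.
have t1 : 0 <= 4 * (1 + K) ^+ 3 / e * psi_gap a b.
  by rewrite mulr_ge0// divr_ge0 ?(ltW e0)// mulr_ge0// exprn_ge0// ltW.
have t2 : 0 <= 2 * K `^ (1 - q) * (`|a| `^ q + `|b| `^ q).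
  by rewrite mulr_ge0 ?addr_ge0 ?mulr_ge0 ?powR_ge0.
have large (c d : R) : `|d| <= `|c| -> K < `|c| ->
    `|c| + `|d| <= 2 * K `^ (1 - q) * (`|c| `^ q + `|d| `^ q).
  move=> dc Kc; apply: (@le_trans _ _ (2 * (K `^ (1 - q) * `|c| `^ q))); last first.
    by rewrite -mulrA ler_pM2l// ler_wpM2l ?powR_ge0// lerDl powR_ge0.
  apply: (@le_trans _ _ (2 * `|c|)); first by lra.
  rewrite ler_pM2l//.
  have c0 : 0 < `|c| by exact: lt_trans Kc.
  have -> : `|c| `^ q = `|c| * `|c| `^ (q - 1).
    rewrite -{1}(subrKC 1 q) powRD ?powRr1 ?ltW//.
    by apply/implyP => _; rewrite gt_eqF.
  rewrite mulrCA ler_peMr ?(ltW c0)// -(opprB q 1) powRN mulrC.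
  rewrite ler_pdivlMr ?powR_gt0// mul1r ge0_ler_powR ?nnegrE ?(ltW K0) ?(ltW c0) ?(ltW Kc)//.
  by rewrite subr_ge0 ltW.
have [aK|Ka] := leP `|a| K; have [bK|Kb] := leP `|b| K.
- have [ab|ab] := leP `|a - b| e; first by rewrite -addrA ler_wpDr// addr_ge0.
  apply: (@le_trans _ _ (4 * (1 + K) ^+ 3 / e * psi_gap a b)); last by lra.
  rewrite mulrAC ler_pdivlMr// (le_trans _ (psi_gap_strict (ltW K0) aK bK))//.
  by rewrite -real_normK ?num_real// expr2 ler_wpM2l// ltW.
all: have [ba|ab] := leP `|b| `|a|;
     apply: le_trans (ler_normB _ _) _; rewrite -addrA ler_wpDl ?(ltW e0)// ler_wpDl//.
all: try by (apply: large; lra).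
all: by rewrite addrC [X in _ * X]addrC; apply: large; lra.
Qed.

End psi.

(** * Boundary values of scalar Hardy functions *)

Section harmonic_means.
Context {R : realType}.
Local Notation mu := (@lebesgue_measure R).
Local Notation int01 := (Rintegral (@lebesgue_measure R) `[0, 1]).
Implicit Types (z t : R[i]) (x y : R).
Let itv01 := `[0 : R, 1 : R]%classic.

Lemma fubini01 (f : R -> R -> R) :
  measurable_fun setT (fun p : measurableTypeR R * measurableTypeR R => f p.1 p.2) ->
  (forall x y, 0 <= f x y) ->
  (\int[mu]_(x in itv01) \int[mu]_(y in itv01) (f x y)%:E =
   \int[mu]_(y in itv01) \int[mu]_(x in itv01) (f x y)%:E)%E.
Proof.
move=> mf f0.
pose F (p : measurableTypeR R * measurableTypeR R) : \bar R :=
  (f p.1 p.2 * (\1_itv01 p.1 * \1_itv01 p.2))%:E.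
have m01 : measurable (itv01 : set (measurableTypeR R)) by exact: measurable_itv.
have mF : measurable_fun setT F.
  apply/measurable_EFinP; apply: measurable_funM => //.
  by apply: measurable_funM; (apply: measurableT_comp;
    [exact: measurable_indic|by []]).
have F0 p : (0 <= F p)%E by rewrite lee_fin !mulr_ge0// indicE ler0n.
have FE (g : R -> R -> R) (F' : R -> R -> \bar R) :
    (forall x y, F' x y = (g x y * (\1_itv01 x * \1_itv01 y))%:E) ->
    (\int[mu]_(x in itv01) \int[mu]_(y in itv01) (g x y)%:E =
     \int[mu]_x \int[mu]_y F' x y)%E.
  move=> F'E; rewrite [LHS]integral_mkcond; apply: eq_integral => x _.
  rewrite patchE; case: ifPn => xD.
    rewrite integral_mkcond; apply: eq_integral => y _.
    by rewrite F'E patchE !indicE xD mul1r; case: ifPn => _; rewrite ?mulr1 ?mulr0.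
  rewrite -[LHS](integral0 mu setT); apply: eq_integral => y _.
  by rewrite F'E !indicE (negbTE xD) mul0r mulr0.
rewrite (FE f (fun x y => F (x, y)) (fun _ _ => erefl)).
rewrite (FE (fun y x => f x y) (fun y x => F (x, y))); last first.
  by move=> y x; rewrite /F/= [_ * \1_itv01 y]mulrC.
exact: (@fubini_tonelli _ _ _ _ R lebesgue_measure lebesgue_measure F mF F0).
Qed.

Lemma measurable_fubini01 (f : R -> R -> R) :
  measurable_fun setT (fun p : measurableTypeR R * measurableTypeR R => f p.1 p.2) ->
  (forall x y, 0 <= f x y) ->
  measurable_fun itv01 (fun x => \int[mu]_(y in itv01) (f x y)%:E)%E.
Proof.
move=> mf f0; have m01 : measurable (itv01 : set (measurableTypeR R)) by exact: measurable_itv.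
pose F (p : measurableTypeR R * measurableTypeR R) : \bar R := (f p.1 p.2 * \1_itv01 p.2)%:E.
have mF : measurable_fun setT F.
  apply/measurable_EFinP; apply: measurable_funM => //.
  by apply: measurableT_comp => //; exact: measurable_indic.
have F0 p : (0 <= F p)%E by rewrite lee_fin !mulr_ge0// indicE ler0n.
have mFF := @measurable_fun_fubini_tonelli_F _ _ _ _ R lebesgue_measure F mF F0.
apply: measurable_funTS; rewrite (_ : (fun x => _) = fubini_F lebesgue_measure F)//.
apply/funext => x; rewrite integral_mkcond /fubini_F; apply: eq_integral => y _.
by rewrite patchE /F/= indicE; case: ifPn => _; rewrite ?mulr1 ?mulr0.
Qed.

Lemma poisson_kernel_cos r x y : 0 <= r ->
  poisson_kernel (r%:C * e_ x) y =
  (1 - r ^+ 2) / (1 + r ^+ 2 - 2 * r * cos (pi *+ 2 * (y - x))).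
Proof.
move=> r0; rewrite /poisson_kernel normc_re//; congr (_ / _).
rewrite sqr_normcE !e_E mulrBr cosB.
move: (cos2Dsin2 (pi *+ 2 * x)) (cos2Dsin2 (pi *+ 2 * y)).
move: (cos (_ * x)) (sin (_ * x)) (cos (_ * y)) (sin (_ * y)) => a b c d h1 h2.
rewrite Re_sub Im_sub Re_realM Im_realM /=.
rewrite [LHS](_ : _ = (c ^+ 2 + d ^+ 2) + r ^+ 2 * (a ^+ 2 + b ^+ 2) - 2 * r * (c * a + d * b)).
  by rewrite h1 h2 mulr1.
by ring.
Qed.

Lemma poisson_kernelC r x y : 0 <= r ->
  poisson_kernel (r%:C * e_ x) y = poisson_kernel (r%:C * e_ y) x.
Proof.
by move=> r0; rewrite !poisson_kernel_cos// -(opprB x y) mulrN cosN.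
Qed.

Lemma measurable_poisson_kernel2 r : 0 <= r < 1 -> measurable_fun setT
  (fun p : measurableTypeR R * measurableTypeR R => poisson_kernel (r%:C * e_ p.1) p.2).
Proof.
move=> /andP[r0 r1].
rewrite (_ : (fun p => _) = poisson_kernel (r%:C * e_ 0) \o (fun p => p.2 - p.1)); last first.
  by apply/funext => p /=; rewrite !poisson_kernel_cos// subr0.
apply: measurableT_comp; last exact: measurable_funB.
by apply: continuous_measurable_fun; apply: continuous_poisson_kernel; rewrite normc_re.
Qed.

Lemma derivable_scaleC (g : R[i] -> R[i]) (a z : R[i]) :
  derivable g (a * z) 1 -> derivable (fun w => g (a * w)) z 1.
Proof.
move=> /derivable1_diffP dg; apply/derivable1_diffP.
have dm : differentiable (fun w : R[i] => a * w) z.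
  apply/derivable1_diffP.
  exact: (@derivable_mulC R (fun=> a) id z (@derivable_cstC R a z) (@derivable_idC R z)).
exact: (@differentiable_comp _ _ _ _ (fun w : R[i] => a * w) g z dm dg).
Qed.

Lemma derivable_addC (g h : R[i] -> R[i]) (z : R[i]) :
  derivable g z 1 -> derivable h z 1 -> derivable (fun w => g w + h w) z 1.
Proof. move=> dg dh; exact: (@derivableD R[i] R[i] R[i] g h z 1 dg dh). Qed.

Lemma continuous_integrable01 (f : R -> R) : continuous f ->
  mu.-integrable itv01 (EFin \o f).
Proof. by move=> cf; apply: continuous_on_integrable => y _; exact: cf. Qed.

Lemma continuous_psi : continuous (@psi R).
Proof.
move=> a; apply: (@continuous_comp _ _ _ (fun a : R => 1 + a ^+ 2 : R) (@Num.sqrt R)).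
  by apply: cvgD; [exact: cvg_cst|exact: exprn_continuous].
exact: sqrt_continuous.
Qed.

Lemma continuous_Re_circle (g : R[i] -> R[i]) r :
  (forall y, derivable g (r%:C * e_ y) 1) ->
  continuous (fun y => complex.Re (g (r%:C * e_ y))).
Proof.
move=> dg y; apply: (@continuous_comp _ _ _ (fun y => g (r%:C * e_ y)) (@complex.Re R)).
  apply: (@continuous_comp _ _ _ (fun y => r%:C * e_ y) g).
    by apply: cvgM; [exact: cvg_cst|exact: continuous_e].
  exact: derivable_normc_continuous.
exact: continuous_Re.
Qed.

(** Means of [psi u] over circles increase with the radius: the Poisson formula makes
    [u] at the smaller radius an average of its boundary values, [psi] lies above its
    tangent (Jensen), and Fubini's theorem applies because the kernel is symmetric. *)
Lemma psi_mean_le (G : R[i] -> R[i]) r : 0 <= r < 1 ->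
  (forall z, normc z <= 1 -> derivable G z 1) ->
  int01 (fun x => psi (complex.Re (G (r%:C * e_ x)))) <=
  int01 (fun y => psi (complex.Re (G (e_ y)))).
Proof.
move=> r01 dG; have /andP[r0 r1] := r01.
have m01 : measurable (itv01 : set (measurableTypeR R)) by exact: measurable_itv.
have n1 x : normc (r%:C * e_ x) < 1 by rewrite normc_re.
pose v y := complex.Re (G (e_ y)).
have cv : continuous v.
  have -> : v = fun y => complex.Re (G (1%:C * e_ y)).
    by apply/funext => y; rewrite rmorph1 mul1r.
  by apply: continuous_Re_circle => y; apply: dG; rewrite rmorph1 mul1r normc_e.
have cpv : continuous (fun y => psi (v y)).
  by move=> y; apply: (@continuous_comp _ _ _ v (@psi R)); [exact: cv|exact: continuous_psi].
have cpr : continuous (fun x => psi (complex.Re (G (r%:C * e_ x)))).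
  move=> x; apply: (@continuous_comp _ _ _ (fun x => complex.Re (G (r%:C * e_ x))) (@psi R)).
    by apply: continuous_Re_circle => y; apply: dG; rewrite ltW.
  exact: continuous_psi.
have cpk x := continuous_poisson_kernel (n1 x).
have cM (f : R -> R) x : continuous f ->
    continuous (fun y => f y * poisson_kernel (r%:C * e_ x) y).
  by move=> cf y; apply: cvgM; [exact: cf|exact: cpk].
have jensen x : psi (complex.Re (G (r%:C * e_ x))) <=
    int01 (fun y => psi (v y) * poisson_kernel (r%:C * e_ x) y).
  set a := complex.Re _; pose c := a / psi a.
  have ca : int01 (fun y => v y * poisson_kernel (r%:C * e_ x) y) = a.
    by rewrite /v poisson_formula.
  have -> : psi a = int01 (fun y => (psi a - c * a) * poisson_kernel (r%:C * e_ x) y +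
      c * (v y * poisson_kernel (r%:C * e_ x) y)).
    rewrite RintegralD//; last 2 first.
    - by apply: continuous_integrable01; apply: cM => y; exact: cvg_cst.
    - apply: continuous_integrable01 => y; apply: cvgM; first exact: cvg_cst.
      exact: cM.
    rewrite (@RintegralZl _ _ _ mu _ (poisson_kernel (r%:C * e_ x)))//; last first.
      by apply: continuous_integrable01; exact: cpk.
    rewrite (@RintegralZl _ _ _ mu _ (fun y => v y * poisson_kernel (r%:C * e_ x) y))//; last first.
      by apply: continuous_integrable01; exact: cM.
    by rewrite ca int_poisson_kernel// mulr1 subrK.
  apply: le_Rintegral => //.
  - apply: continuous_integrable01 => y; apply: cvgD.
      by apply: (cM (fun=> _)) => ?; exact: cvg_cst.
    by apply: cvgM; [exact: cvg_cst|exact: cM].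
  - by apply: continuous_integrable01; exact: cM.
  move=> y _; rewrite mulrA -mulrDl ler_wpM2r ?poisson_kernel_ge0//.
  by have := psi_tangent a (v y); rewrite -/c; lra.
have pk0 x y : 0 <= psi (v y) * poisson_kernel (r%:C * e_ x) y.
  by rewrite mulr_ge0 ?poisson_kernel_ge0// ltW// psi_gt0.
have mpk2 := measurable_poisson_kernel2 r01.
have m2 : measurable_fun setT (fun p : measurableTypeR R * measurableTypeR R =>
    psi (v p.2) * poisson_kernel (r%:C * e_ p.1) p.2).
  apply: measurable_funM => //; apply: (measurableT_comp (f := fun y => psi (v y))) => //.
  exact: continuous_measurable_fun.
rewrite -lee_fin !EFin_int01; last 2 first.
- exact: continuous_integrable01.
- exact: continuous_integrable01.
apply: (@le_trans _ _ (\int[mu]_(x in itv01) \int[mu]_(y in itv01)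
    (psi (v y) * poisson_kernel (r%:C * e_ x) y)%:E)%E).
  apply: ge0_le_integral => //.
  - by move=> x _; rewrite lee_fin ltW// psi_gt0.
  - by apply/measurable_EFinP; apply: measurable_funTS; exact: continuous_measurable_fun.
  - exact: measurable_fubini01.
  move=> x _; rewrite -EFin_int01 ?lee_fin ?jensen//.
  by apply: continuous_integrable01; exact: cM.
rewrite (fubini01 m2)//.
rewrite le_eqVlt; apply/orP; left; apply/eqP; apply: eq_integral => y _.
under eq_integral do rewrite EFinM.
rewrite ge0_integralZl//; last 3 first.
- apply/measurable_EFinP.
  have -> : (fun x => poisson_kernel (r%:C * e_ x) y) = poisson_kernel (r%:C * e_ y).
    by apply/funext => x; rewrite poisson_kernelC.
  by apply: measurable_funTS; apply: continuous_measurable_fun; exact: cpk.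
- by move=> x _; rewrite lee_fin poisson_kernel_ge0.
- by rewrite lee_fin ltW// psi_gt0.
under eq_integral do rewrite poisson_kernelC//.
rewrite -EFin_int01; last by apply: continuous_integrable01; exact: cpk.
by rewrite int_poisson_kernel// mule1.
Qed.

Lemma integrable01D (f h : R -> R) : mu.-integrable itv01 (EFin \o f) ->
  mu.-integrable itv01 (EFin \o h) -> mu.-integrable itv01 (EFin \o (fun y => f y + h y)).
Proof.
move=> intf inth; have m01 : measurable (itv01 : set (measurableTypeR R)) by exact: measurable_itv.
rewrite (_ : _ \o _ = (EFin \o f) \+ (EFin \o h))%E//; exact: integrableD.
Qed.

Lemma integrable01B (f h : R -> R) : mu.-integrable itv01 (EFin \o f) ->
  mu.-integrable itv01 (EFin \o h) -> mu.-integrable itv01 (EFin \o (fun y => f y - h y)).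
Proof.
move=> intf inth; have m01 : measurable (itv01 : set (measurableTypeR R)) by exact: measurable_itv.
rewrite (_ : _ \o _ = (EFin \o f) \- (EFin \o h))%E//; exact: integrableB.
Qed.

Lemma integrable01Z (c : R) (f : R -> R) : mu.-integrable itv01 (EFin \o f) ->
  mu.-integrable itv01 (EFin \o (fun y => c * f y)).
Proof.
move=> intf; have m01 : measurable (itv01 : set (measurableTypeR R)) by exact: measurable_itv.
rewrite (_ : _ \o _ = (fun y => c%:E * (EFin \o f) y))%E//; exact: integrableZl.
Qed.

Lemma int01D (f h : R -> R) : mu.-integrable itv01 (EFin \o f) ->
  mu.-integrable itv01 (EFin \o h) -> int01 (fun y => f y + h y) = int01 f + int01 h.
Proof. by move=> intf inth; rewrite RintegralD. Qed.

Lemma int01B (f h : R -> R) : mu.-integrable itv01 (EFin \o f) ->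
  mu.-integrable itv01 (EFin \o h) -> int01 (fun y => f y - h y) = int01 f - int01 h.
Proof. by move=> intf inth; rewrite RintegralB. Qed.

Lemma int01Z (c : R) (f : R -> R) : mu.-integrable itv01 (EFin \o f) ->
  int01 (fun y => c * f y) = c * int01 f.
Proof. by move=> intf; rewrite RintegralZl. Qed.

Lemma integrable01_norm (f : R -> R) : mu.-integrable itv01 (EFin \o f) ->
  mu.-integrable itv01 (EFin \o (fun y => `|f y|)).
Proof.
by move=> intf; apply: integrable_norm => //; exact: measurable_itv.
Qed.

Lemma le_norm_int01 (f : R -> R) : mu.-integrable itv01 (EFin \o f) ->
  `|int01 f| <= int01 (fun y => `|f y|).
Proof. by move=> intf; apply: le_normr_Rintegral. Qed.

Lemma integrable01_cst (c : R) : mu.-integrable itv01 (EFin \o (fun=> c)).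
Proof. by apply: continuous_integrable01 => y; exact: cst_continuous. Qed.

Lemma int01_cst (c : R) : int01 (fun=> c) = c.
Proof. by rewrite Rint_cst// subr0 mulr1. Qed.

Lemma continuous_bounded01 (f : R -> R) : continuous f ->
  exists2 C, 0 <= C & forall y, itv01 y -> `|f y| <= C.
Proof.
move=> cf; have /compact_bounded[C [_ CP]] :=
  continuous_compact (continuous_subspaceT cf) (@segment_compact R 0 1).
exists (`|C| + 1); first by rewrite addr_ge0.
move=> y y01; apply: (CP (`|C| + 1)); last by exists y.
by rewrite (le_lt_trans (ler_norm _))// ltrDl.
Qed.

Lemma powR_integrable01 (f : R -> R) q : 0 <= q -> continuous f ->
  mu.-integrable itv01 (EFin \o (fun y => `|f y| `^ q)).
Proof.
move=> q0 cf; have [C C0 CP] := continuous_bounded01 cf.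
have m01 : measurable (itv01 : set (measurableTypeR R)) by exact: measurable_itv.
apply: measurable_bounded_integrable => //.
- by rewrite /= lebesgue_measure_itv/= lte_fin ltr01 -EFinD ltry.
- apply: (measurableT_comp (measurable_powR q)).
  by apply: measurableT_comp => //; apply: measurable_funTS; exact: continuous_measurable_fun.
exists (C `^ q); split; first exact: num_real.
move=> N CN y yI /=; rewrite ger0_norm ?powR_ge0// (le_trans _ (ltW CN))//.
by apply: ge0_ler_powR => //; rewrite ?nnegrE//; exact: CP.
Qed.

(** The series of the norms of the differences is integrable, hence finite almost
    everywhere and a dominating function for the sequence. The limit is taken as an
    upper limit to make it measurable on the whole interval. *)
Lemma L1_rapidly_cauchy_cvg (F : nat -> R -> R) :
  (forall j, mu.-integrable itv01 (EFin \o F j)) ->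
  (forall j, int01 (fun y => `|F j.+1 y - F j y|) <= 1 / (2 ^ (j + 1))%:R) ->
  exists2 h, mu.-integrable itv01 (EFin \o h) &
    int01 (fun y => `|F j y - h y|) @[j --> \oo] --> (0 : R).
Proof.
move=> iF dF; have m01 : measurable (itv01 : set (measurableTypeR R)) by exact: measurable_itv.
pose E j y : \bar R := `|F j.+1 y - F j y|%:E.
have iE j : mu.-integrable itv01 (E j) by apply: integrable01_norm; exact: integrable01B.
have E0 j y : (0 <= E j y)%E by rewrite lee_fin.
have mE j : measurable_fun itv01 (E j) by exact: measurable_int (iE j).
pose S y : \bar R := (\sum_(0 <= j <oo) E j y)%E.
have S0 y : (0 <= S y)%E by apply: nneseries_ge0 => j _ _; exact: E0.
have mS : measurable_fun itv01 S.
  by have := @ge0_emeasurable_sum _ _ R itv01 E predT (fun k x _ _ => E0 k x) (fun k _ => mE k).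
have iS : mu.-integrable itv01 S.
  apply/integrableP; split => //.
  under eq_integral do rewrite gee0_abs//.
  rewrite integral_nneseries//.
  apply: (@le_lt_trans _ _ (1%:E : \bar R)%E); last by rewrite ltry.
  have := @cvg_geometric_eseries_half R 1 0; rewrite expr0 divr1 => /cvg_lim => <-//.
  apply: lee_nneseries => [j _ _|j _].
    by apply: integral_ge0 => y _; exact: E0.
  rewrite -EFin_int01; last by apply: integrable01_norm; exact: integrable01B.
  by rewrite lee_fin; exact: dF.
pose T y : \bar R := (`|F 0 y|%:E + S y)%E.
have iT : mu.-integrable itv01 T.
  by apply: integrableD => //; exact: integrable01_norm.
have FT k y : (`|F k y|%:E <= T y)%E.
  rewrite /T; apply: (@le_trans _ _ (`|F 0 y|%:E + \sum_(0 <= j < k) E j y)%E); last first.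
    by rewrite leeD2l//; apply: nneseries_lim_ge => j _ _; exact: E0.
  elim: k => [|k IH]; first by rewrite big_geq// adde0.
  rewrite big_nat_recr//= addeA; apply: le_trans (leeD IH (lexx _)).
  rewrite -EFinD lee_fin addrC -{1}(subrK (F k y) (F k.+1 y)); exact: ler_normD.
pose H y : \bar R := limn_esup (fun j => (F j y)%:E).
have mH : measurable_fun itv01 H.
  by apply: measurable_fun_limn_esup => j; exact: measurable_int (iF j).
have cvgH y : S y \is a fin_num -> (F j y)%:E @[j --> \oo] --> H y /\ H y \is a fin_num.
  move=> Sy; have : cvgn (fun j => F j y).
    have cs : cvgn (series (fun j => F j.+1 y - F j y)).
      apply: normed_cvg; apply: nondecreasing_is_cvgn.
        by apply: nondecreasing_series => j _ _; exact: normr_ge0.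
      exists (fine (S y)) => _ [k _ <-]; rewrite -lee_fin fineK//.
      rewrite /series/= -sumEFin; apply: nneseries_lim_ge => j _ _; exact: E0.
    have -> : (fun j => F j y) = (fun j => F 0%N y + series (fun j => F j.+1 y - F j y) j).
      by apply/funext => j; rewrite /series/= telescope_sumr// subrKC.
    by apply: is_cvgD => //; exact: is_cvg_cst.
  move=> /cvg_ex[l Fl].
  have Fl' : (F j y)%:E @[j --> \oo] --> l%:E by apply: cvg_EFin Fl; exact: nearW.
  have -> : H y = l%:E; last by split.
  rewrite /H is_cvg_limn_esupE; last by apply/cvg_ex; exists l%:E.
  exact/cvg_lim.
have aeS := integrable_ae m01 iS.
have [] := @dominated_convergence _ (measurableTypeR R) R mu itv01 m01
   (fun j y => (F j y)%:E) H T (fun j => measurable_int _ (iF j)) mH.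
- case: aeS => N [mN N0 subN]; exists N; split => // y nP; apply: subN => /= Sfin.
  by apply: nP => y01; case: (cvgH y (Sfin y01)).
- exact: iT.
- by apply: aeW => y j _; exact: FT.
move=> iH cvgI _.
have ifH : mu.-integrable itv01 (EFin \o (fine \o H)).
  apply: (le_integrable m01 _ _ iH).
    by apply/measurable_EFinP; apply: measurableT_comp mH; exact: fine_measurable.
  by move=> y _ /=; case: (H y) => [r| |] //=; rewrite ?lee_fin ?normr0// leey.
exists (fine \o H); first exact: ifH.
move/fine_cvgP : cvgI => [_ cvgI].
rewrite [X in X @ _ --> _](_ : _ =
  fine \o (fun n => \int[mu]_(x in itv01) `|(F n x)%:E - H x|)%E)//.
apply/funext => j; rewrite /= /Rintegral; congr fine; apply: ae_eq_integral => //.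
- apply/measurable_EFinP; apply: measurableT_comp => //; apply: measurable_funB.
    by apply/measurable_EFinP; exact: measurable_int (iF j).
  by apply/measurable_EFinP; exact: measurable_int ifH.
- apply: measurableT_comp => //; apply: emeasurable_funB => //.
  exact: measurable_int (iF j).
case: aeS => N [mN N0 subN]; exists N; split => // y nP; apply: subN => /= Sfin.
apply: nP => /= y01; have [_ Hfin] := cvgH y (Sfin y01).
by rewrite -{2}(fineK Hfin).
Qed.

Let gap_arith (a b c d1 d2 i s th : R) : a <= s -> b <= s -> s - th < c ->
  c - (d1 + d2) / 2 <= i -> d1 <= th -> d2 <= th -> a + b - 2 * i <= 4 * th.
Proof. lra. Qed.

Let sum_arith (e a b c : R) : 0 < e -> a <= e / 4 -> b <= e / 4 -> e / 4 + a + b <= e.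
Proof. lra. Qed.

Section hardy.
Variables (g : R[i] -> R[i]) (q M : R).
Hypothesis q1 : 1 < q.
Hypothesis dg : forall z, normc z < 1 -> derivable g z 1.
Hypothesis gM : forall r, 0 < r < 1 ->
  int01 (fun y => `|complex.Re (g (r%:C * e_ y))| `^ q) <= M.

Let u z := complex.Re (g z).
Let rk k : R := 1 - k.+2%:R^-1.
Let uk k y := u ((rk k)%:C * e_ y).

Let rk01 k : 0 < rk k < 1.
Proof.
by rewrite /rk subr_gt0 invf_lt1// ltr1n/= gtrBl invr_gt0.
Qed.

Let rk_cvg : rk k @[k --> \oo] --> (1 : R).
Proof.
rewrite -[X in _ --> X]subr0; apply: cvgB; first exact: cvg_cst.
by have := @cvg_harmonic R; rewrite -(cvg_shiftS).
Qed.

Let u_cont r : 0 <= r < 1 -> continuous (fun y => u (r%:C * e_ y)).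
Proof.
by move=> /andP[r0 r1]; apply: continuous_Re_circle => y; apply: dg; rewrite normc_re.
Qed.

Let uk_cont k : continuous (uk k).
Proof. by apply: u_cont; case/andP: (rk01 k) => /ltW -> ->. Qed.

Lemma poisson_hardy r t : 0 <= r < 1 -> normc t < 1 ->
  int01 (fun y => u (r%:C * e_ y) * poisson_kernel t y) = u (r%:C * t).
Proof.
move=> /andP[r0 r1] t1; apply: (@poisson_formula R (fun z => g (r%:C * z))) => // z z1.
apply: derivable_scaleC; apply: dg; rewrite normcM normc_real ger0_norm//.
by rewrite (le_lt_trans _ r1)// ler_piMr.
Qed.

Let uk_le k : int01 (fun y => `|uk k y|) <= 1 + M.
Proof.
have i1 := integrable01_cst 1.
have iq : mu.-integrable itv01 (EFin \o (fun y => `|uk k y| `^ q)).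
  by apply: powR_integrable01 => //; rewrite ltW// (lt_trans ltr01).
apply: (@le_trans _ _ (int01 (fun y => 1 + `|uk k y| `^ q))).
  apply: le_Rintegral => //.
  - apply: continuous_integrable01 => y; apply: cvg_norm; exact: uk_cont.
  - exact: integrable01D.
  move=> y _; have [h|/ltW h] := leP `|uk k y| 1.
    by rewrite (le_trans h)// lerDl powR_ge0.
  by rewrite (le_trans (le1r_powR h (ltW q1)))// lerDr.
rewrite RintegralD// int01_cst lerD2l.
by have := gM (rk01 k); apply.
Qed.

Let M_ge0 : 0 <= M.
Proof.
apply: le_trans (gM (rk01 0)); apply: Rintegral_ge0 => y _; exact: powR_ge0.
Qed.

(* On the disc of radius [rk m] the Poisson formula on a slightly larger circle bounds
   [u] uniformly, which provides the dominating constant in [d_cvg]. *)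
Let dilate_bounded m : exists C, forall k y,
  `|u ((rk m)%:C * ((rk k)%:C * e_ y)) - u ((rk m)%:C * e_ y)| <= C.
Proof.
have /andP[m0 m1] := rk01 m.
pose r := (1 + rk m) / 2.
have r1 : r < 1 by rewrite /r; lra.
have mr : rk m < r by rewrite /r; lra.
have r0 : 0 < r by exact: lt_trans mr.
have rr : 0 <= r < 1 by rewrite r1 ltW.
have [C C0 CP] := continuous_bounded01 (u_cont rr).
pose a := rk m / r.
have a1 : a < 1 by rewrite ltr_pdivrMr// mul1r.
have a0 : 0 <= a by rewrite divr_ge0// ltW.
have bd z : normc z <= rk m -> `|u z| <= C * (2 / (1 - a)).
  move=> zm.
  have rC0 : r%:C != 0 :> R[i] by rewrite fmorph_eq0 gt_eqF.
  have ta : normc (r%:C^-1 * z) <= a.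
    rewrite normcM normcV normc_real (ger0_norm (ltW r0)) mulrC.
    by apply: ler_wpM2r => //; rewrite invr_ge0 ltW.
  have t1 : normc (r%:C^-1 * z) < 1 by exact: le_lt_trans a1.
  rewrite -(mulVKf rC0 z) -poisson_hardy//.
  have ipk := continuous_poisson_kernel t1.
  have iupk : continuous (fun y => u (r%:C * e_ y) * poisson_kernel (r%:C^-1 * z) y).
    by move=> y; apply: cvgM; [exact: u_cont|exact: ipk].
  apply: (le_trans (le_norm_int01 (continuous_integrable01 iupk))).
  apply: (@le_trans _ _ (int01 (fun=> C * (2 / (1 - a))))); last first.
    by rewrite int01_cst.
  apply: le_Rintegral => //.
  - by apply: integrable01_norm; exact: continuous_integrable01.
  - exact: integrable01_cst.
  move=> y yI; rewrite normrM (ger0_norm (poisson_kernel_ge0 _ t1)).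
  rewrite ler_pM ?poisson_kernel_ge0//; first exact: CP.
  apply: (le_trans (poisson_kernel_le _ t1)).
  apply: ler_pM; rewrite ?addr_ge0 ?normc_ge0 ?invr_ge0 ?subr_ge0 ?(ltW t1)//.
    by move: t1; lra.
  by rewrite lef_pV2 ?posrE ?subr_gt0// lerD2l lerN2.
exists (C * (2 / (1 - a)) + C * (2 / (1 - a))) => k y.
have /andP[k0 k1] := rk01 k.
apply: le_trans (ler_normB _ _) _; apply: lerD; apply: bd.
  rewrite normcM normc_real normc_re ?(ltW k0)// ger0_norm ?(ltW m0)//.
  by rewrite ler_piMr ?(ltW m0)// ltW.
by rewrite normc_re ?lexx// ltW.
Qed.

Let d m k y := `|u ((rk k)%:C * ((rk m)%:C * e_ y)) - uk m y|.

Let prod01 m k : 0 <= rk k * rk m < 1.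
Proof.
have /andP[k0 k1] := rk01 k; have /andP[m0 m1] := rk01 m.
by rewrite mulr_ge0 ?ltW//= (le_lt_trans _ m1)// ler_piMl// ltW.
Qed.

Let d_cont m k : continuous (d m k).
Proof.
have cu : continuous (fun y => u ((rk k)%:C * ((rk m)%:C * e_ y))).
  rewrite (_ : (fun y => _) = (fun y => u ((rk k * rk m)%:C * e_ y))).
    exact: (u_cont (prod01 m k)).
  by apply/funext => x; rewrite rmorphM mulrA.
by move=> y; apply: cvg_norm; apply: cvgB; [exact: cu|exact: uk_cont].
Qed.

Let u_radial_cont (r y : R) : 0 <= r < 1 ->
  {for r, continuous (fun r : R => u (r%:C * e_ y))}.
Proof.
move=> /andP[r0 r1].
apply: (@continuous_comp _ _ _ (fun r : R => g (r%:C * e_ y)) (@complex.Re R)); last exact: continuous_Re.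
apply: (@continuous_comp _ _ _ (fun r : R => r%:C * e_ y) g).
  by apply: cvgM; [exact: continuous_real_complex|exact: cvg_cst].
by apply: derivable_normc_continuous; apply: dg; rewrite normc_re.
Qed.

Let d_cvg m eta : 0 < eta -> \forall k \near \oo, int01 (d m k) <= eta.
Proof.
move=> eta0; have [C CP] := dilate_bounded m.
have C0 : 0 <= C by apply: le_trans (CP 0 0).
have /andP[m0 m1] := rk01 m.
have m01 : measurable (itv01 : set (measurableTypeR R)) by exact: measurable_itv.
have [] := @dominated_convergence _ (measurableTypeR R) R mu itv01 m01
   (fun k y => (d m k y)%:E) (cst 0) (cst C%:E).
- move=> k; apply/measurable_EFinP; apply: measurable_funTS.
  by apply: continuous_measurable_fun; exact: d_cont.
- exact: measurable_cst.
- apply: aeW => y _; apply: cvg_EFin; first by near=> k.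
  rewrite [X in _ --> X](_ : _ = `|u ((rk m)%:C * e_ y) - uk m y|); last by rewrite subrr normr0.
  apply: cvg_norm; apply: cvgB; last exact: cvg_cst.
  have rm : 0 <= rk m < 1 by rewrite (ltW m0).
  have rr : (rk k * rk m) @[k --> \oo] --> rk m.
    by rewrite -[X in _ --> X]mul1r; apply: cvgM; [exact: rk_cvg|exact: cvg_cst].
  have -> : (fun k => u ((rk k)%:C * ((rk m)%:C * e_ y))) =
      (fun r : R => u (r%:C * e_ y)) \o (fun k => rk k * rk m).
    by apply/funext => k /=; rewrite rmorphM mulrA.
  by apply: continuous_cvg rr; exact: (@u_radial_cont _ y rm).
- exact: integrable01_cst.
- by apply: aeW => y k _ /=; rewrite lee_fin ger0_norm ?normr_ge0// /d mulrCA; exact: CP.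
move=> _ _; rewrite integral0 => /fine_cvgP[_ /cvgrPdist_le /(_ _ eta0)].
by apply: filterS => k; rewrite sub0r normrN => /(le_trans (ler_norm _)).
Unshelve. all: by end_near. Qed.

Let J k := int01 (fun y => psi (uk k y)).

Let psi_uk_int k : mu.-integrable itv01 (EFin \o (fun y => psi (uk k y))).
Proof.
apply: continuous_integrable01 => y.
by apply: (@continuous_comp _ _ _ (uk k) (@psi R)); [exact: uk_cont|exact: continuous_psi].
Qed.

Let J_le k : J k <= 2 + M.
Proof.
apply: (@le_trans _ _ (int01 (fun y => 1 + `|uk k y|))).
  apply: le_Rintegral => //.
    apply: integrable01D; first exact: integrable01_cst.
    apply: integrable01_norm; apply: continuous_integrable01; exact: uk_cont.
  by move=> y _; exact: psi_le.
rewrite RintegralD//; [|exact: integrable01_cst|]; last first.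
  apply: integrable01_norm; apply: continuous_integrable01; exact: uk_cont.
by rewrite int01_cst; have := uk_le k; lra.
Qed.

Let mid k l y := (uk k y + uk l y) / 2.

Let mid_cont k l : continuous (fun y => psi (mid k l y)).
Proof.
move=> y; apply: (@continuous_comp _ _ _ (mid k l) (@psi R)); last exact: continuous_psi.
apply: cvgM; last exact: cvg_cst.
by apply: cvgD; exact: uk_cont.
Qed.

(* The midpoint of [uk k] and [uk l] is the boundary value of the real part of a
   holomorphic function [G]; at radius [rk m] that function is close to [uk m] for large
   [k] and [l], so the means of [psi] of the midpoint are almost as large as [J m]. *)
Let mid_ge m k l : J m - (int01 (d m k) + int01 (d m l)) / 2 <= int01 (fun y => psi (mid k l y)).
Proof.
have /andP[m0 m1] := rk01 m; have /andP[k0 k1] := rk01 k; have /andP[l0 l1] := rk01 l.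
pose G z := (2^-1)%:C * (g ((rk k)%:C * z) + g ((rk l)%:C * z)).
have ReG z : complex.Re (G z) = (u ((rk k)%:C * z) + u ((rk l)%:C * z)) / 2.
  by rewrite /G Re_realM Re_add mulrC.
have dG z : normc z <= 1 -> derivable G z 1.
  move=> z1; have dr r : 0 < r -> r < 1 -> derivable (fun z => g (r%:C * z)) z 1.
    move=> r0 r1; apply: derivable_scaleC; apply: dg.
    rewrite normcM normc_real ger0_norm ?(ltW r0)// (le_lt_trans _ r1)//.
    by rewrite ler_piMr// ltW.
  have dsum := @derivable_addC _ _ z (dr _ k0 k1) (dr _ l0 l1).
  exact: (@derivable_mulC R (fun=> (2^-1)%:C) _ z (@derivable_cstC R _ z) dsum).
have rm : 0 <= rk m < 1 by rewrite (ltW m0).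
apply: le_trans (_ : int01 (fun y => psi (complex.Re (G ((rk m)%:C * e_ y)))) <= _); last first.
  have -> : (fun y => psi (mid k l y)) = (fun y => psi (complex.Re (G (e_ y)))).
    by apply/funext => y; rewrite ReG.
  exact: psi_mean_le.
have id k' := continuous_integrable01 (@d_cont m k').
have idD := integrable01D (id k) (id l).
have -> : J m - (int01 (d m k) + int01 (d m l)) / 2 =
    int01 (fun y => psi (uk m y) - 2^-1 * (d m k y + d m l y)).
  rewrite RintegralB//; last exact: integrable01Z.
  by rewrite RintegralZl// RintegralD// mulrC.
apply: le_Rintegral => //.
- by apply: integrable01B => //; exact: integrable01Z.
- apply: continuous_integrable01 => y.
  apply: (@continuous_comp _ _ _ (fun y => complex.Re (G ((rk m)%:C * e_ y))) (@psi R)); last exact: continuous_psi.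
  by apply: continuous_Re_circle => x; apply: dG; rewrite normc_re ?ltW.
move=> y _; rewrite ReG lerBlDr -lerBlDl.
apply: le_trans (ler_norm _) _; apply: le_trans (psi_lipschitz _ _) _.
rewrite /d; set a := u _; set b := u _; set c := uk m y.
have -> : c - (a + b) / 2 = - (2^-1 * ((a - c) + (b - c))) by field.
by rewrite normrN normrM ger0_norm ?invr_ge0// ler_wpM2l ?invr_ge0// ler_normD.
Qed.

Let uk_dist k l := int01 (fun y => `|uk k y - uk l y|).

(** The means [J k] of [psi] over circles are bounded; when they are near their supremum
    the midpoint of [uk k] and [uk l] cannot have a much smaller mean, so the mean of the
    convexity gap is small. The gap controls the [L^1] distance except where the functions
    are large, and there the bound on the [q]-th powers takes over. *)
Lemma hardy_L1_cauchy e : 0 < e -> exists N, forall k l, (N <= k)%N -> (N <= l)%N ->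
  uk_dist k l <= e.
Proof.
move=> e0.
have supJ : has_sup (range J).
  split; first by exists (J 0%N), 0%N.
  by exists (2 + M) => _ [k _ <-]; exact: J_le.
pose S := sup (range J).
have JS k : J k <= S by apply: ub_le_sup; [case: supJ|exists k].
have M1 : 0 < M + 1 by rewrite ltr_wpDl.
have q10 : q - 1 != 0 by rewrite gt_eqF// subr_gt0.
have [K K0 Kq] : exists2 K, 0 < K & K `^ (1 - q) = e / (16 * (M + 1)).
  have x0 : 0 < 16 * (M + 1) / e by rewrite divr_gt0// mulr_gt0.
  exists ((16 * (M + 1) / e) `^ (q - 1)^-1); first by rewrite powR_gt0.
  by rewrite -powRrM -(opprB q 1) mulrN mulVf// powRN powRr1 ?(ltW x0)// invf_div.
have [CK CKE CK0] : exists2 CK, CK = 4 * (1 + K) ^+ 3 & 0 < CK.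
  by exists (4 * (1 + K) ^+ 3) => //; rewrite mulr_gt0// exprn_gt0// addr_gt0.
pose theta := e ^+ 2 / (64 * CK).
have th0 : 0 < theta by rewrite divr_gt0 ?exprn_gt0// mulr_gt0.
have [_ [m _ <-] Jm] := sup_adherent th0 supJ.
have [N _ NP] := d_cvg m th0.
exists N => k l Nk Nl.
have dk := NP _ Nk; have dl := NP _ Nl.
have := mid_ge m k l; rewrite /= in dk dl *; set Imid := int01 (fun y => psi (mid k l y)) => Imid_ge.
have e4 : 0 < e / 4 by rewrite divr_gt0.
have q0 : 0 <= q by rewrite ltW// (lt_trans ltr01).
have imid := continuous_integrable01 (@mid_cont k l).
have igap : mu.-integrable itv01 (EFin \o (fun y => psi_gap (uk k y) (uk l y))).
  apply: integrable01B; last exact: integrable01Z.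
  exact: integrable01D.
have gapE : int01 (fun y => psi_gap (uk k y) (uk l y)) = J k + J l - 2 * Imid.
  rewrite RintegralB//; [|exact: integrable01D|exact: integrable01Z].
  by rewrite RintegralD// (@RintegralZl _ _ _ mu _ (fun y => psi (mid k l y))).
have iq k' : mu.-integrable itv01 (EFin \o (fun y => `|uk k' y| `^ q)).
  by apply: powR_integrable01 => //; exact: uk_cont.
have iq2 := integrable01D (iq k) (iq l).
pose B y := (e / 4 + CK / (e / 4) * psi_gap (uk k y) (uk l y)) +
   2 * K `^ (1 - q) * (`|uk k y| `^ q + `|uk l y| `^ q).
have ig2 := integrable01Z (CK / (e / 4)) igap.
have i3 := integrable01Z (2 * K `^ (1 - q)) iq2.
have i4 := integrable01D (integrable01_cst (e / 4)) ig2.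
apply: (@le_trans _ _ (int01 B)).
  apply: le_Rintegral => //.
  - apply: continuous_integrable01 => y; apply: cvg_norm.
    by apply: cvgB; exact: uk_cont.
  - exact: integrable01D.
  by move=> y _; rewrite /B CKE; exact: abs_sub_le_gap.
rewrite /B (int01D i4 i3) (int01D (integrable01_cst _) ig2) int01_cst.
rewrite (int01Z _ igap) (int01Z _ iq2) (int01D (iq k) (iq l)) gapE.
have gk : int01 (fun y => `|uk k y| `^ q) <= M by have := gM (rk01 k); apply.
have gl : int01 (fun y => `|uk l y| `^ q) <= M by have := gM (rk01 l); apply.
have h1 : J k + J l - 2 * Imid <= 4 * theta.
  exact: (gap_arith (JS k) (JS l) Jm Imid_ge dk dl).
have h2 : CK / (e / 4) * (J k + J l - 2 * Imid) <= e / 4.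
  apply: (@le_trans _ _ (CK / (e / 4) * (4 * theta))).
    by rewrite ler_wpM2l// divr_ge0 ?ltW.
  by rewrite /theta le_eqVlt; apply/orP; left; apply/eqP; field; rewrite !gt_eqF.
have h3 : 2 * K `^ (1 - q) * (int01 (fun y => `|uk k y| `^ q) + int01 (fun y => `|uk l y| `^ q)) <= e / 4.
  rewrite Kq; move: gk gl; move: (int01 _) (int01 _) => a b aM bM.
  apply: (@le_trans _ _ (2 * (e / (16 * (M + 1))) * (M + M))).
    apply: ler_wpM2l; last exact: lerD.
    by rewrite mulr_ge0// divr_ge0 ?(ltW e0)// mulr_ge0// ltW.
  rewrite [leLHS](_ : _ = e / 4 * (M / (M + 1))); last by field; rewrite gt_eqF.
  by rewrite ler_piMr ?(ltW e4)// ler_pdivrMr// mul1r lerDl.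
exact: (sum_arith 0 e0 h2 h3).
Qed.

(** The limit [h] in [L^1] of a subsequence of dilates inherits the Poisson formula of the
    dilates. *)
Lemma hardy_boundary : exists2 h, mu.-integrable itv01 (EFin \o h) &
  forall t, normc t < 1 -> int01 (fun y => h y * poisson_kernel t y) = u t.
Proof.
have /choice[N NP] : forall j, exists N, forall k l, (N <= k)%N -> (N <= l)%N ->
    uk_dist k l <= 1 / (2 ^ (j + 1))%:R.
  by move=> j; apply: hardy_L1_cauchy; rewrite divr_gt0// ltr0n expn_gt0.
pose n j := (j + \sum_(i < j.+1) N i)%N.
have nN j : (N j <= n j)%N by rewrite /n big_ord_recr/= addnA leq_addl.
have nS j : (n j <= n j.+1)%N.
  by rewrite /n [X in (_ <= _ + X)%N]big_ord_recr/= leq_add// leq_addr.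
have nj j : (j <= n j)%N by rewrite leq_addr.
have iuk k : mu.-integrable itv01 (EFin \o uk k).
  by apply: continuous_integrable01; exact: uk_cont.
have [h ih hF] : exists2 h, mu.-integrable itv01 (EFin \o h) &
    int01 (fun y => `|uk (n j) y - h y|) @[j --> \oo] --> (0 : R).
  apply: L1_rapidly_cauchy_cvg => j; first exact: iuk.
  by apply: NP; rewrite ?nN// (leq_trans (nN j)).
exists h => // t t1.
have cpk := continuous_poisson_kernel t1.
have mpk : measurable_fun itv01 (poisson_kernel t).
  by apply: measurable_funTS; exact: continuous_measurable_fun.
have [C bpk] : exists C : R, forall y, itv01 y -> `|poisson_kernel t y| <= C.
  exists ((1 + normc t) / (1 - normc t)) => y _.
  by rewrite ger0_norm ?poisson_kernel_ge0// poisson_kernel_le.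
have ihpk := integrable_mul_bounded ih mpk bpk.
have lim1 : int01 (fun y => uk (n j) y * poisson_kernel t y) @[j --> \oo] -->
    int01 (fun y => h y * poisson_kernel t y).
  apply/cvgrPdist_le => e e0 /=.
  have C0 : 0 <= C.
    by apply: le_trans (bpk 0 _); rewrite ?normr_ge0// /itv01/= in_itv/= lexx ler01.
  have C1 : 0 < C + 1 by rewrite ltr_wpDl.
  have eC : 0 < e / (C + 1) by rewrite divr_gt0.
  move/cvgrPdist_le : hF => /(_ _ eC); apply: filterS => j.
  rewrite sub0r normrN => /(le_trans (ler_norm _)) => dist_small.
  have iB := integrable01B (iuk (n j)) ih.
  have iFpk := integrable_mul_bounded (iuk (n j)) mpk bpk.
  have iBpk := integrable_mul_bounded iB mpk bpk.
  rewrite distrC -(int01B iFpk ihpk).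
  have -> : (fun y => uk (n j) y * poisson_kernel t y - h y * poisson_kernel t y) =
      (fun y => (uk (n j) y - h y) * poisson_kernel t y).
    by apply/funext => y; rewrite mulrBl.
  apply: (le_trans (le_norm_int01 iBpk)).
  have iN := integrable01_norm iB.
  apply: (@le_trans _ _ (int01 (fun y => C * `|uk (n j) y - h y|))).
    apply: le_Rintegral => //.
    - exact: integrable01_norm.
    - exact: integrable01Z.
    by move=> y yI; rewrite normrM mulrC ler_wpM2r// bpk.
  rewrite (int01Z _ iN); apply: (@le_trans _ _ (C * (e / (C + 1)))).
    by apply: ler_wpM2l.
  by rewrite mulrCA ler_piMr ?(ltW e0)// ler_pdivrMr// mul1r lerDl.
have lim2 : int01 (fun y => uk (n j) y * poisson_kernel t y) @[j --> \oo] --> u t.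
  have -> : (fun j => int01 (fun y => uk (n j) y * poisson_kernel t y)) =
      (fun r : R => u (r%:C * t)) \o (fun j => rk (n j)).
    apply/funext => j /=; apply: poisson_hardy => //.
    by case/andP: (rk01 (n j)) => /ltW -> ->.
  have ct : {for (1 : R), continuous (fun r : R => u (r%:C * t))}.
    apply: (@continuous_comp _ _ _ (fun r : R => g (r%:C * t)) (@complex.Re R)); last exact: continuous_Re.
    apply: (@continuous_comp _ _ _ (fun r : R => r%:C * t) g).
      by apply: cvgM; [exact: continuous_real_complex|exact: cvg_cst].
    by apply: derivable_normc_continuous; apply: dg; rewrite rmorph1 mul1r.
  rewrite [X in _ --> X](_ : _ = u ((1 : R)%:C * t)); last by rewrite rmorph1 mul1r.
  have rn : rk (n j) @[j --> \oo] --> (1 : R).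
    apply: (@cvg_comp _ _ _ n rk _ \oo); last exact: rk_cvg.
    apply/cvgnyPge => A; near=> j; apply: leq_trans (nj j).
    by near: j; exact: nbhs_infty_ge.
  by apply: continuous_cvg rn; exact: ct.
exact: (cvg_unique _ lim1 lim2).
Unshelve. all: by end_near. Qed.

(** At the points [r e_ x] the Poisson formula of [hardy_boundary] is the integral whose
    limit is given by Fatou's theorem. *)
Lemma hardy_radial : exists h, [/\ mu.-integrable itv01 (EFin \o h),
  forall t, normc t < 1 -> int01 (fun y => h y * poisson_kernel t y) = u t &
  {ae mu, forall x, 0 < x < 1 -> u (r%:C * e_ x) @[r --> (1 : R)^'-] --> h x}].
Proof.
have [h ih hu] := hardy_boundary; exists h; split => //.
have [N [mN N0 subN]] := fatou_radial ih; exists N; split => // x nP; apply: subN => /= hx.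
apply: nP => x01; apply: cvg_trans (hx x01); apply: near_eq_cvg; near=> r.
rewrite hu// normc_re; first by near: r; exact: nbhs_left_lt.
by near: r; apply: nbhs_left_ge.
Unshelve. all: by end_near. Qed.

End hardy.

End harmonic_means.

(** * Convex functions on complex row vectors *)

Section convex_functions.
Context {R : realType} {n : nat}.
Local Notation C := R[i].
Local Notation Cn := 'rV[R[i]]_n.
Implicit Types (w z v : Cn) (a b : R) (f : Cn -> R).

(** A norm that dominates all others in use and in which coordinates are easy to handle.
    It is used for balls and Lipschitz constants in place of the sup and Euclidean norms,
    to which it is equivalent. *)
Definition l1norm w : R := \sum_(j < n) (`|complex.Re (w 0 j)| + `|complex.Im (w 0 j)|).

Lemma l1norm_ge0 w : 0 <= l1norm w.
Proof. by apply: sumr_ge0 => j _; rewrite addr_ge0. Qed.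

Lemma l1normD w z : l1norm (w + z) <= l1norm w + l1norm z.
Proof.
rewrite /l1norm -big_split/=; apply: ler_sum => j _.
by rewrite mxE Re_add Im_add addrACA lerD// ler_normD.
Qed.

Lemma l1normZ a w : l1norm (a%:C *: w) = `|a| * l1norm w.
Proof.
rewrite /l1norm mulr_sumr; apply: eq_bigr => j _.
by rewrite mxE Re_realM Im_realM !normrM mulrDr.
Qed.

Lemma l1norm_distC w z : l1norm (w - z) = l1norm (z - w).
Proof.
rewrite -opprB -scaleN1r -(rmorph1 (real_complex R)) -rmorphN l1normZ.
by rewrite normrN normr1 mul1r.
Qed.

Lemma l1norm0 : l1norm 0 = 0.
Proof. by rewrite /l1norm big1// => j _; rewrite mxE normr0 addr0. Qed.

Lemma l1norm_eq0 w : l1norm w = 0 -> w = 0.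
Proof.
move=> /eqP; rewrite psumr_eq0; last by move=> j _; rewrite addr_ge0.
move=> /allP w0; apply/rowP => j; rewrite mxE.
have := w0 j (mem_index_enum _); rewrite /= paddr_eq0// !normr_eq0.
by case: (w 0 j) => x y /= /andP[/eqP -> /eqP ->].
Qed.

Lemma normc_le_l1norm w j : normc (w 0 j) <= l1norm w.
Proof.
rewrite (le_trans (normc_sum2 _))// /l1norm (bigD1 j)//= lerDl.
by apply: sumr_ge0 => k _; rewrite addr_ge0.
Qed.

Lemma enorm_le_l1norm w : enorm w <= l1norm w.
Proof.
rewrite -(ler_pXn2r (n := 2))// ?nnegrE ?sqrtr_ge0 ?l1norm_ge0//.
rewrite sqr_sqrtr; last by apply: sumr_ge0 => j _; exact: sqr_ge0.
rewrite expr2 {1}/l1norm mulr_suml; apply: ler_sum => j _.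
by rewrite expr2 ler_pM ?normc_ge0 ?normc_sum2// normc_le_l1norm.
Qed.

Lemma l1norm_near w0 e : 0 < e -> \forall w \near w0, l1norm (w - w0) < e.
Proof.
move=> e0; pose d := e / (2 * n%:R + 1).
have n1 : 0 < 2 * n%:R + 1 :> R by rewrite ltr_wpDl// mulr_ge0.
have d0 : 0 < d by rewrite divr_gt0.
have : \forall w \near w0, forall j : 'I_n, normc ((w : Cn) 0 j - w0 0 j) < d.
  apply: (@filter_forall Cn 'I_n (fun j w => normc (w 0 j - w0 0 j) < d) (nbhs w0)) => j.
  have := @coord_continuous _ 1 n 0 j w0.
  move=> /(_ [set c | normc (c - w0 0 j) < d]); apply.
  by apply/normc_near; exists d.
apply: filterS => w wd; apply: (@le_lt_trans _ _ (\sum_(j < n) (d + d))).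
  apply: ler_sum => j _; rewrite !mxE lerD// ltW//.
    by rewrite (le_lt_trans (normc_Re _)).
  by rewrite (le_lt_trans (normc_Im _)).
rewrite sumr_const card_ord -mulr2n -mulrnA -mulr_natr natrM /d.
rewrite mulrAC ltr_pdivrMr// ltr_pM2l//.
by rewrite ltrDl.
Qed.

Definition convex_fun f := forall w z a, 0 <= a <= 1 ->
  f (a%:C *: w + (1 - a)%:C *: z) <= a * f w + (1 - a) * f z.

(** From [w] go through [z] to a point [v] of the larger ball at distance 1 beyond [z]:
    convexity on this segment bounds [f z - f w] by the oscillation times the length. *)
Lemma convex_lipschitz f w0 r M : convex_fun f ->
  (forall w, l1norm (w - w0) <= r + 1 -> `|f w| <= M) ->
  forall w z, l1norm (w - w0) <= r -> l1norm (z - w0) <= r ->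
  `|f w - f z| <= 2 * M * l1norm (w - z).
Proof.
move=> cf fM.
have M0 w : l1norm (w - w0) <= r -> 0 <= M.
  by move=> wr; rewrite (le_trans (normr_ge0 (f w)))// fM// (le_trans wr)// lerDl.
have half w z : l1norm (w - w0) <= r -> l1norm (z - w0) <= r ->
    f z - f w <= 2 * M * l1norm (z - w).
  move=> wr zr; have Mge0 := M0 _ wr; have [d0|d0] := eqVneq (l1norm (z - w)) 0.
    by move/l1norm_eq0 : (d0) => /eqP; rewrite subr_eq0 => /eqP ->; rewrite !subrr mulr_ge0// ?mulr_ge0// l1norm_ge0.
  have dgt0 : 0 < l1norm (z - w) by rewrite lt_neqAle eq_sym d0 l1norm_ge0.
  set d := l1norm (z - w) in d0 dgt0 *.
  pose v := z + (d^-1)%:C *: (z - w).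
  have vr : l1norm (v - w0) <= r + 1.
    rewrite /v addrAC (le_trans (l1normD _ _))// l1normZ lerD//.
    by rewrite ger0_norm ?invr_ge0 ?(ltW dgt0)// -/d mulVf.
  pose a := d / (1 + d).
  have d1 : 0 < 1 + d by rewrite addr_gt0.
  have a01 : 0 <= a <= 1.
    by rewrite divr_ge0 ?(ltW dgt0) ?(ltW d1)//= ler_pdivrMr// mul1r lerDr.
  have zE : z = a%:C *: v + (1 - a)%:C *: w.
    apply/rowP => j; rewrite /v !mxE.
    have h1 : a + a * d^-1 = 1 by rewrite /a; field; rewrite !gt_eqF.
    have h2 : 1 - a = a * d^-1 by rewrite -h1 addrC addKr.
    rewrite h2 mulrDr mulrA -rmorphM/= mulrBr addrA subrK -mulrDl -rmorphD/= h1.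
    by rewrite rmorph1 mul1r.
  have := cf v w a a01; rewrite -zE => h.
  have fv : f v <= M by rewrite (le_trans (ler_norm _))// fM.
  have fw : - M <= f w.
    by have := fM w; rewrite ler_norml => /(_ _)/andP[]//; rewrite (le_trans wr)// lerDl.
  have ad : a <= d by rewrite /a ler_pdivrMr// ler_peMr ?(ltW dgt0)// lerDl ltW.
  case/andP: a01 => a0 _.
  apply: (@le_trans _ _ (a * (f v - f w))); first by lra.
  apply: (@le_trans _ _ (a * (2 * M))); first by rewrite ler_wpM2l//; lra.
  by rewrite mulrC ler_wpM2l// mulr_ge0.
move=> w z wr zr; rewrite ler_norml; apply/andP; split.
  by rewrite lerNl opprB l1norm_distC; exact: half.
by rewrite l1norm_distC; rewrite l1norm_distC; exact: half.
Qed.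

End convex_functions.

(** * The Fenchel-Moreau theorem *)

Section fenchel_moreau.
Context {R : realType} {n : nat}.
Local Notation C := R[i].
Local Notation Cn := 'rV[R[i]]_n.
Implicit Types (w z v : Cn) (a b : R) (f : Cn -> R).

Definition locally_bounded f :=
  forall r : R, exists M : R, forall w, l1norm w <= r -> `|f w| <= M.

Lemma convex_continuous f : convex_fun f -> locally_bounded f -> continuous f.
Proof.
move=> cf lbf w0; have [M fM] := lbf (l1norm w0 + 2).
have fM' w : l1norm (w - w0) <= 1 + 1 -> `|f w| <= M.
  move=> ww0; apply: fM; rewrite -[w](subrK w0) addrC (le_trans (l1normD _ _))//.
  by rewrite lerD2l.
have lipf := convex_lipschitz cf fM'.
have M0 : 0 <= M.
  by rewrite (le_trans (normr_ge0 (f w0)))// fM' ?subrr ?l1norm0.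
apply/(@cvgrPdist_lt _ _ _ (nbhs w0)) => e e0.
have d0 : 0 < Num.min 1 (e / (2 * M + 1)).
  by rewrite lt_min ltr01 divr_gt0// ltr_wpDl// mulr_ge0.
have := l1norm_near w0 d0; apply: filterS => w; rewrite lt_min => /andP[w1 we].
rewrite distrC; have := lipf w w0 (ltW w1).
rewrite subrr l1norm0.
move=> /(_ ler01) h; apply: le_lt_trans h _.
move: we; rewrite ltr_pdivlMr; last by rewrite ltr_wpDl// mulr_ge0.
apply: le_lt_trans; rewrite mulrC ler_wpM2l ?l1norm_ge0//.
by rewrite lerDl.
Qed.

(** The real inner product underlying the complex coordinates. *)
Definition rdot w v : R :=
  \sum_(j < n) (complex.Re (w 0 j) * complex.Re (v 0 j) +
                complex.Im (w 0 j) * complex.Im (v 0 j)).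

Lemma rdotC w v : rdot w v = rdot v w.
Proof. by apply: eq_bigr => j _; rewrite mulrC [X in _ + X]mulrC. Qed.

Lemma rdotDr w v z : rdot w (v + z) = rdot w v + rdot w z.
Proof.
rewrite /rdot -big_split/=; apply: eq_bigr => j _.
by rewrite mxE Re_add Im_add !mulrDr addrACA.
Qed.

Lemma rdotZr a w v : rdot w (a%:C *: v) = a * rdot w v.
Proof.
rewrite /rdot mulr_sumr; apply: eq_bigr => j _.
by rewrite mxE Re_realM Im_realM mulrDr !(mulrCA a).
Qed.

Lemma rdotNr w v : rdot w (- v) = - rdot w v.
Proof.
rewrite /rdot -sumrN; apply: eq_bigr => j _; rewrite mxE.
by case: (v 0 j) => x y /=; rewrite !mulrN opprD.
Qed.

Lemma rdotDl w v z : rdot (v + z) w = rdot v w + rdot z w.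
Proof. by rewrite rdotC rdotDr !(rdotC w). Qed.

Lemma rdotZl a w v : rdot (a%:C *: v) w = a * rdot v w.
Proof. by rewrite rdotC rdotZr (rdotC w). Qed.

Lemma rdot_ge0 w : 0 <= rdot w w.
Proof. by apply: sumr_ge0 => j _; rewrite addr_ge0// -expr2 sqr_ge0. Qed.

Lemma coord_le_rdot w d (j : 'I_n) : 0 <= d -> rdot w w <= d ^+ 2 ->
  `|complex.Re (w 0 j)| <= d /\ `|complex.Im (w 0 j)| <= d.
Proof.
move=> d0 wd.
have : complex.Re (w 0 j) ^+ 2 + complex.Im (w 0 j) ^+ 2 <= d ^+ 2.
  rewrite (le_trans _ wd)// /rdot (bigD1 j)//= -!expr2 lerDl.
  by apply: sumr_ge0 => k _; rewrite addr_ge0// -expr2 sqr_ge0.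
move=> h; split; rewrite -(ler_pXn2r (n := 2))// ?nnegrE// real_normK ?num_real//;
  by rewrite (le_trans _ h)// ?lerDl ?lerDr sqr_ge0.
Qed.

Lemma l1norm_le_coord w d :
  (forall j, `|complex.Re (w 0 j)| <= d /\ `|complex.Im (w 0 j)| <= d) ->
  l1norm w <= (2 * n%:R) * d.
Proof.
move=> wd; apply: (@le_trans _ _ (\sum_(j < n) (d + d))).
  by apply: ler_sum => j _; have [? ?] := wd j; rewrite lerD.
rewrite sumr_const card_ord -[leLHS]mulr_natr le_eqVlt; apply/orP; left.
by apply/eqP; ring.
Qed.

Lemma l1norm_le_rdot w d : 0 <= d -> rdot w w <= d ^+ 2 ->
  l1norm w <= (2 * n%:R) * d.
Proof.
by move=> d0 wd; apply: l1norm_le_coord => j; exact: coord_le_rdot.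
Qed.

Lemma convex_rdot (w0 : Cn) b : 0 <= b ->
  convex_fun (fun w => b * rdot (w - w0) (w - w0)).
Proof.
move=> b0 w z a /andP[a0 a1].
have -> : a%:C *: w + (1 - a)%:C *: z - w0 =
    a%:C *: (w - w0) + (1 - a)%:C *: (z - w0).
  by apply/rowP => j; rewrite !mxE rmorphB rmorph1; ring.
move: (w - w0) (z - w0) => {}w {}z.
rewrite !(rdotDl, rdotDr) !(rdotZl, rdotZr) (rdotC z w).
have := rdot_ge0 (w + (-1)%:C *: z).
rewrite !(rdotDl, rdotDr) !(rdotZl, rdotZr) (rdotC z w).
move: (rdot w w) (rdot z z) (rdot w z) => p q s h.
have : 0 <= b * (a * (1 - a) * (p + -1 * s + (-1 * s + -1 * (-1 * q)))).
  by rewrite mulr_ge0// mulr_ge0// mulr_ge0// subr_ge0.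
lra.
Qed.

Lemma locally_bounded_rdot (w0 : Cn) b : 0 <= b ->
  locally_bounded (fun w => b * rdot (w - w0) (w - w0)).
Proof.
move=> b0 r; exists (b * (r + l1norm w0) ^+ 2) => w wr.
rewrite ger0_norm; last by rewrite mulr_ge0// rdot_ge0.
rewrite ler_wpM2l//; have wr0 : l1norm (w - w0) <= r + l1norm w0.
  rewrite (le_trans (l1normD _ _))// lerD//.
  by rewrite -sub0r l1norm_distC subr0.
apply: (@le_trans _ _ (l1norm (w - w0) ^+ 2)); last first.
  by rewrite ler_pXn2r// ?nnegrE ?l1norm_ge0// (le_trans (l1norm_ge0 _) wr0).
move: (w - w0) => v; rewrite /rdot expr2 {2}/l1norm mulr_suml; apply: ler_sum => j _.
have := ler_norm (complex.Re (v 0 j)).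
have vj := normc_le_l1norm v j.
have vR := le_trans (normc_Re _) vj; have vI := le_trans (normc_Im _) vj.
rewrite -!expr2 -(real_normK (num_real (complex.Re _))) -(real_normK (num_real (complex.Im _))).
by rewrite !expr2 mulrDl => _; rewrite lerD// ler_wpM2l.
Qed.

Lemma compact_box (w0 : Cn) (r : R) :
  compact [set w : Cn | forall j, `|complex.Re (w 0 j - w0 0 j)| <= r /\
                                  `|complex.Im (w 0 j - w0 0 j)| <= r].
Proof.
have := @rV_compact C n (fun j => [set c : C | `|complex.Re (c - w0 0 j)| <= r /\
                                  `|complex.Im (c - w0 0 j)| <= r]).
apply => j; set c0 : C := w0 0 j.
pose h (xy : R * R) : C := (c0 + (xy.1 +i* xy.2)%C)%R.
have -> : [set c : C | `|complex.Re (c - c0)| <= r /\ `|complex.Im (c - c0)| <= r]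
    = h @` (`[- r, r]%classic `*` `[- r, r]%classic).
  apply/seteqP; split => [c [c1 c2]|_ [[x y] [/= x1 y1]] <-].
    exists (complex.Re (c - c0), complex.Im (c - c0)).
      by split; rewrite /= in_itv/= -ler_norml.
    by rewrite /h/=; case: (c - c0) (subrKC c0 c) => /= x y ->.
  move: x1 y1; rewrite !in_itv/= -!ler_norml => x1 y1.
  by rewrite /h/= addrC addKr.
apply: continuous_compact; last by apply: compact_setX; exact: segment_compact.
apply: continuous_subspaceT => -[x y]; apply/cvg_ballP => e.
rewrite ltcE => /andP[/eqP/= e2 e1].
have e0 : 0 < complex.Re e / 2 by rewrite divr_gt0.
have : \forall z \near (x, y), `|x - z.1| < complex.Re e / 2 /\ `|y - z.2| < complex.Re e / 2.
  exists (ball x (complex.Re e / 2), ball y (complex.Re e / 2)).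
    by split => /=; exact: nbhsx_ballx.
  by move=> [x' y'] /= [].
apply: filterS => -[x' y'] /= [xx yy]; rewrite -ball_normE /ball_/=.
rewrite /h opprD addrACA subrr add0r normr_normc.
have : normc ((x +i* y)%C - (x' +i* y')%C) < complex.Re e.
  by rewrite (le_lt_trans (normc_sum2 _))// [ltRHS]splitr; exact: ltrD.
by move: (normc _) => k ke; rewrite ltcE/= e2 eqxx.
Qed.

(** [v] minimises [f] plus a steep quadratic well centred at [w0]. The minimum exists
    because [f] is bounded below, and moving from [v] towards [w] by a vanishing amount
    yields a subgradient of [f] at [v], proportional to [v - w0]. *)
Lemma proximal_point f A (w0 : Cn) b : convex_fun f -> locally_bounded f ->
  (forall w, - A <= f w) -> 0 < b ->
  exists2 v, b * rdot (v - w0) (v - w0) <= f w0 + A &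
    forall w, f v <= f w + 2 * b * rdot (v - w0) (w - v).
Proof.
move=> cf lbf fA b0; have b0' := ltW b0.
pose h w := f w + b * rdot (w - w0) (w - w0).
have ch : continuous h.
  move=> w; have c1 := (convex_continuous cf lbf) (w : Cn).
  have c2 := (convex_continuous (convex_rdot w0 b0') (locally_bounded_rdot w0 b0')) (w : Cn).
  exact: (@cvgD _ _ _ (nbhs w) _ f _ _ _ c1 c2).
pose B := f w0 + A.
have B0 : 0 <= B by rewrite /B addrC -lerBlDl sub0r fA.
(* Outside the box of half-width [r] the quadratic exceeds the value at its centre. *)
pose r := 1 + B / b.
have r1 : 1 <= r by rewrite lerDl divr_ge0.
have hw0 : h w0 = f w0.
  by rewrite /h subrr -(scale0r w0) -(rmorph0 (real_complex R)) rdotZl mul0r mulr0 addr0.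
pose D := [set w : Cn | forall j, `|complex.Re (w 0 j - w0 0 j)| <= r /\
                                  `|complex.Im (w 0 j - w0 0 j)| <= r].
have Dw0 : D w0.
  by move=> j; rewrite subrr /= normr0 (le_trans ler01).
have [v _ vmin'] : exists2 v, v \in D & forall w, w \in D -> h v <= h w.
  apply: compact_EVT_min; [by exists w0|exact: compact_box|].
  exact: continuous_subspaceT.
have vmin w : h v <= h w.
  have [wD|wD] := pselect (D w); first by apply: vmin'; rewrite inE.
  apply: (@le_trans _ _ (h w0)); first by apply: vmin'; rewrite inE.
  rewrite hw0 /h; have r0 : 0 <= r by rewrite (le_trans ler01).
  have rw : r ^+ 2 <= rdot (w - w0) (w - w0).
    rewrite leNgt; apply/negP => /ltW wr; apply: wD => j.
    by have := coord_le_rdot j r0 wr; rewrite !mxE.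
  have : B <= b * rdot (w - w0) (w - w0).
    apply: (@le_trans _ _ (b * r)).
      by rewrite /r mulrDr mulrCA divff ?gt_eqF// !mulr1 lerDr.
    by rewrite ler_wpM2l// (le_trans _ rw)// expr2 ler_peMr.
  by rewrite /B; have := fA w; lra.
exists v.
  by have := vmin w0; rewrite hw0 /h; have := fA v; lra.
move=> w; set q := rdot (v - w0) (w - v); set s := rdot (w - v) (w - v).
have s0 : 0 <= s by exact: rdot_ge0.
have key a : 0 < a -> a <= 1 -> f v <= f w + 2 * b * q + a * (b * s).
  move=> a0 a1; have := vmin (a%:C *: w + (1 - a)%:C *: v); rewrite /h.
  have -> : a%:C *: w + (1 - a)%:C *: v - w0 = (v - w0) + a%:C *: (w - v).
    by apply/rowP => j; rewrite !mxE rmorphB rmorph1; ring.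
  have := cf w v a; rewrite (ltW a0) a1 => /(_ isT).
  move: @q @s {s0} => /=; move: (v - w0) (w - v) => d g.
  rewrite !(rdotDl, rdotDr) !(rdotZl, rdotZr) (rdotC g d).
  move: (rdot d d) (rdot d g) (rdot g g) (f (_ + _)) (f w) (f v).
  move=> p q s y x u h1 h2.
  rewrite -(ler_pM2l a0); lra.
apply/ler_addgt0Pr => e e0; apply: (le_trans (key (Num.min 1 (e / (b * s + 1))) _ _)).
- by rewrite lt_min ltr01 divr_gt0// ltr_wpDl// mulr_ge0.
- by rewrite ge_min lexx.
rewrite lerD2l; have bs1 : 0 < b * s + 1 by rewrite ltr_wpDl// mulr_ge0.
apply: (@le_trans _ _ (e / (b * s + 1) * (b * s))).
  by rewrite ler_wpM2r ?mulr_ge0// ge_min lexx orbT.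
by rewrite mulrAC ler_pdivrMr// ler_pM2l// lerDl.
Qed.

(** Conjugation turns the inner product [rdot] into the bilinear pairing [cdot]. *)
Definition conjv w : Cn := map_mx (@conjc R) w.

Lemma Re_cdot_conjv w v : complex.Re (cdot (conjv w) v) = rdot w v.
Proof.
rewrite /cdot /rdot; elim/big_rec2 : _ => [//|j a b _ <-].
by rewrite Re_add; congr (_ + _); rewrite mxE; case: (w 0 j) (v 0 j) => x y [x' y'] /=; rewrite mulNr opprK.
Qed.

(** Some affine minorant of [f] comes within [e] of [f w0]: the one touching the graph
    at the proximal point [v], which tends to [w0] as the well gets steeper. *)
Lemma fenchel_moreau f A (w0 : Cn) e : convex_fun f -> locally_bounded f ->
  (forall w, - A <= f w) -> 0 < e ->
  exists z, forall w, complex.Re (cdot z w) - f w <=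
    complex.Re (cdot z w0) - f w0 + e.
Proof.
move=> cf lbf fA e0.
have [d d0 dP] : exists2 d, 0 < d & forall v, rdot (v - w0) (v - w0) <= d ^+ 2 ->
    f w0 - e <= f v.
  have [M fM] := lbf (l1norm w0 + 2).
  have fM' w : l1norm (w - w0) <= 1 + 1 -> `|f w| <= M.
    move=> ww0; apply: fM; rewrite -[w](subrK w0) addrC (le_trans (l1normD _ _))//.
    by rewrite lerD2l.
  have lipf := convex_lipschitz cf fM'.
  have l00 : l1norm (w0 - w0) = 0.
    by rewrite subrr l1norm0.
  have M0 : 0 <= M by rewrite (le_trans (normr_ge0 (f w0)))// fM' ?l00// addr_ge0.
  pose m : R := 2 * n%:R; have m0 : 0 <= m by rewrite mulr_ge0.
  have m1 : 0 < m + 1 by rewrite ltr_wpDl.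
  have k0 : 0 < Num.min 1 (e / (2 * M + 1)).
    by rewrite lt_min ltr01 divr_gt0// ltr_wpDl// mulr_ge0.
  exists (Num.min 1 (e / (2 * M + 1)) / (m + 1)); first by rewrite divr_gt0.
  move=> v /l1norm_le_rdot; rewrite -/m => /(_ (ltW (divr_gt0 k0 m1))) vm.
  have : l1norm (v - w0) <= Num.min 1 (e / (2 * M + 1)).
    by rewrite (le_trans vm)// mulrCA ger_pMr// ler_pdivrMr// mul1r lerDl.
  rewrite le_min => /andP[v1 ve]; have := lipf v w0 v1; rewrite l00.
  move=> /(_ ler01); rewrite ler_norml => /andP[h _].
  suff : 2 * M * l1norm (v - w0) <= e by lra.
  move: ve; rewrite ler_pdivlMr; last by rewrite ltr_wpDl// mulr_ge0.
  apply: le_trans; rewrite mulrC ler_wpM2l ?l1norm_ge0//.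
  by rewrite lerDl.
pose B := f w0 + A.
have B0 : 0 <= B by rewrite /B addrC -lerBlDl sub0r fA.
have b0 : 0 < (B + 1) / d ^+ 2 by rewrite divr_gt0 ?exprn_gt0// ltr_wpDl.
have [v vB vP] := proximal_point w0 cf lbf fA b0.
have dv : rdot (v - w0) (v - w0) <= d ^+ 2.
  move: vB; rewrite -/B mulrAC ler_pdivrMr ?exprn_gt0// => h.
  have : (B + 1) * rdot (v - w0) (v - w0) <= (B + 1) * d ^+ 2.
    by rewrite (le_trans h)// ler_wpM2r ?sqr_ge0// lerDl.
  by rewrite ler_pM2l// ltr_wpDl.
have fv := dP v dv.
exists (conjv ((- 2 * ((B + 1) / d ^+ 2))%:C *: (v - w0))) => w.
rewrite !Re_cdot_conjv !rdotZl; have := vP w.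
have -> : rdot (v - w0) (w - v) = rdot (v - w0) w - rdot (v - w0) v.
  by rewrite rdotDr rdotNr.
have : 0 <= rdot (v - w0) v - rdot (v - w0) w0.
  by have := rdot_ge0 (v - w0); rewrite [X in 0 <= X]rdotDr rdotNr.
move: b0 fv; move: ((B + 1) / d ^+ 2) (rdot _ v) (rdot _ w) (rdot _ w0) => b x y u b0 fv h1 h2.
have : 0 <= b * (x - u) by rewrite mulr_ge0// ltW.
lra.
Qed.

End fenchel_moreau.

(** * From the parameter interval to the circle *)

Section circle_measure.
Context {R : realType}.
Local Notation C := R[i].
Local Notation mu := (@lebesgue_measure R).
Local Notation int01 := (Rintegral (@lebesgue_measure R) `[0, 1]).
Local Notation itv01 := (`[0, 1]%classic : set R).
Local Notation circle := (@unit_circle R : set (borel C)).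
Implicit Types (F G : C -> \bar R).

Lemma measurable_closed (A : set C) : closed A -> measurable (A : set (borel C)).
Proof.
move=> cA; rewrite -[A]setCK; apply: measurableC.
by apply: sub_sigma_algebra; exact: closed_openC.
Qed.

Lemma continuous_normc : continuous (@normc R : C -> R).
Proof.
move=> z; apply/(@cvgrPdist_lt _ _ _ (nbhs z)) => e e0.
apply/normc_near; exists e => // w wz.
rewrite distrC (le_lt_trans _ wz)// ler_norml; apply/andP; split.
  by rewrite lerNl opprB normc_distC -lecR rmorphB/= -!normr_normc lerB_dist.
by rewrite -lecR rmorphB/= -!normr_normc lerB_dist.
Qed.

Lemma closed_circle : closed (@unit_circle R).
Proof.
apply: (@closed_comp _ _ (@normc R) [set x : R | x = 1]).
  by move=> z _; exact: continuous_normc.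
exact: closed_eq.
Qed.

Lemma measurable_circle : measurable circle.
Proof. exact: (measurable_closed closed_circle). Qed.

Lemma circle_e y : unit_circle (e_ y : C).
Proof. exact: normc_e. Qed.

Lemma sigma_preimage (A : set (borel C)) : measurable A ->
  mu (itv01 `&` (e_ : R -> C) @^-1` A) = 0 -> sigma R A = 0%E.
Proof.
move=> mA A0; rewrite /sigma /distribution /pushforward/=.
have mB : measurable (e_ @^-1` A : set (measurableTypeR R)).
  rewrite -[X in measurable X]setTI.
  exact: (@measurable_circle_param R measurableT _ mA).
have m01 : measurable (itv01 : set (measurableTypeR R)) by exact: measurable_itv.
rewrite /uniform_prob integral_uniform_pdf null_set_integral//.
- exact: measurableI.
- by apply/measurable_EFinP/measurable_funTS; exact: measurable_uniform_pdf.
- by rewrite setIC.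
Qed.

(** The image of a measurable set under [e_] is not obviously Borel. Inner regularity
    avoids the issue: up to a null set, the set of good parameters is a countable union of
    compact sets, and their images are compact. *)
Lemma ae_circle_set (Q : C -> Prop) : {ae mu, forall y, itv01 y -> Q (e_ y)} ->
  exists B : set (borel C), [/\ measurable B,
    mu (itv01 `&` (e_ : R -> C) @^-1` B) = 0 &
    forall s, unit_circle s -> ~ B s -> Q s].
Proof.
move=> [N [mN N0 subN]].
have m01 : measurable (itv01 : set (measurableTypeR R)) by exact: measurable_itv.
pose D := itv01 `\` N.
have mD : measurable D by exact: measurableD.
have D1 : (mu D < +oo)%E.
  rewrite (@le_lt_trans _ _ (mu itv01))//; last first.
    by rewrite lebesgue_measure_itv/= lte01 -EFinB ltry.
  by apply: le_measure; rewrite ?inE//; exact: subIsetl.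
have /choice[V VP] : forall k : nat, exists V : set R,
    [/\ compact V, V `<=` D & (mu (D `\` V) < (k.+1%:R^-1)%:E)%E].
  by move=> k; apply: lebesgue_regularity_inner.
have cV k : closed ((e_ : R -> C) @` V k).
  apply: compact_closed; first exact: norm_hausdorff.
  apply: continuous_compact; last by have [] := VP k.
  by apply: continuous_subspaceT; exact: continuous_e.
pose B := circle `\` \bigcup_k ((e_ : R -> C) @` V k).
have mB : measurable (B : set (borel C)).
  apply: measurableD; first exact: measurable_circle.
  by apply: bigcupT_measurable => k; exact: measurable_closed.
have mB' : measurable (e_ @^-1` B : set (measurableTypeR R)).
  rewrite -[X in measurable X]setTI.
  exact: (@measurable_circle_param R measurableT _ mB).
exists B; split=> //.
  apply/eqP; rewrite eq_le measure_ge0 andbT.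
  apply/lee_addgt0Pr => e e0; rewrite add0e.
  have [k ke] : exists k : nat, k.+1%:R^-1 <= e.
    exists (Num.truncn e^-1); rewrite -[leRHS]invrK lef_pV2 ?posrE ?invr_gt0//.
    by rewrite ltW// truncnS_gt.
  have [kV VD muV] := VP k.
  have mV : measurable (V k : set (measurableTypeR R)).
    by apply: closed_measurable; apply: compact_closed.
  apply: (@le_trans _ _ (mu (N `|` (D `\` V k)))).
    apply: le_measure; rewrite ?inE.
    - exact: measurableI.
    - by apply: measurableU => //; apply: measurableD.
    move=> y [y01 [_ yV]]; have [yN|yN] := pselect (N y); first by left.
    right; split => // Vy; apply: yV; exists k => //; by exists y.
  rewrite (le_trans (measureU2 _ _ _))//.
    exact: measurableD.
  have -> : (mu N + mu (D `\` V k) = mu (D `\` V k))%E by rewrite N0 add0e.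
  by rewrite (le_trans (ltW muV))// lee_fin.
move=> s s1 nB; apply: contrapT => nQ; apply: nB; split => // -[k _ [y Vy ys]].
have [kV /(_ _ Vy)[y01 yN] _] := VP k.
by apply: yN; apply: subN => /= /(_ y01); rewrite ys.
Qed.

Lemma ae_circle (Q : C -> Prop) : {ae mu, forall y, itv01 y -> Q (e_ y)} ->
  {ae sigma R, forall s, unit_circle s -> Q s}.
Proof.
move=> /ae_circle_set[B [mB B0 QB]]; exists B; split => //.
  exact: sigma_preimage.
by move=> s /not_implyP[s1 nQ]; apply: contrapT => /(QB s s1).
Qed.

Lemma measurable_comp_e F : measurable_fun circle F ->
  measurable_fun [set: measurableTypeR R] (fun y => F (e_ y)).
Proof.
move=> mF; apply: (@measurable_comp _ _ _ _ _ _ circle F [set: measurableTypeR R] e_) => //.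
- exact: measurable_circle.
- by move=> _ [y _ <-]; exact: circle_e.
Qed.

Lemma ge0_integral_circle F : measurable_fun circle F ->
  (forall s, unit_circle s -> (0 <= F s)%E) ->
  (\int[sigma R]_(s in circle) F s = \int[mu]_(y in itv01) F (e_ y))%E.
Proof.
move=> mF F0; rewrite /sigma /distribution ge0_integral_pushforward//.
- have -> : (@circle_param R) @^-1` circle = setT.
    by apply/seteqP; split => // y _; exact: circle_e.
  rewrite integral_uniform/=.
  + by rewrite subr0 invr1 mul1e.
  + exact: measurable_comp_e.
  + by move=> y; rewrite F0//; exact: circle_e.
- exact: measurable_circle.
- by move=> s; rewrite inE => /F0.
Qed.

Lemma integral_circle F : measurable_fun circle F ->
  (\int[sigma R]_(s in circle) F s = \int[mu]_(y in itv01) F (e_ y))%E.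
Proof.
move=> mF; rewrite integralE [RHS]integralE.
congr (_ - _)%E.
  rewrite (@ge0_integral_circle F^\+%E) => [|//|//]; last exact: measurable_funepos.
  by apply: eq_integral => y _; rewrite !funeposE.
rewrite (@ge0_integral_circle F^\-%E) => [|//|//]; last exact: measurable_funeneg.
by apply: eq_integral => y _; rewrite !funenegE.
Qed.

Lemma continuous_measurable_circle (h : C -> R) :
  (forall s, unit_circle s -> {for s, continuous h}) ->
  measurable_fun circle (EFin \o h).
Proof.
move=> ch; apply/measurable_EFinP.
move=> mD; apply: (measurability _ (RGenOpens.measurableE R)) => //.
move=> _ [U [a [b ->]] <-]; have oU : open (`]a, b[%classic : set R) by exact: interval_open.
move: (`]a, b[%classic : set R) oU => {}U oU.
have -> : circle `&` h @^-1` U = circle `&` (interior (h @^-1` U : set C) : set (borel C)).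
  apply/seteqP; split => s [s1 sU]; split => //.
    exact: (ch s s1 U (open_nbhs_nbhs _)).
  exact: (interior_subset sU).
apply: measurableI; first exact: measurable_circle.
by apply: sub_sigma_algebra; exact: open_interior.
Qed.

End circle_measure.

Section integral_monotonicity.
Local Open Scope ereal_scope.
Context d (T : measurableType d) (R : realType) (m : {measure set T -> \bar R}).

(** The integral of a nonnegative function is a supremum over simple functions below it,
    and this definition is monotone for arbitrary functions. The conjugate evaluated at
    boundary values is integrated without a proof of its measurability. *)
Lemma le_integral_nonmeasurable (D : set T) (f g : T -> \bar R) :
  (forall x, D x -> f x <= g x) -> \int[m]_(x in D) f x <= \int[m]_(x in D) g x.
Proof.
have ge0 (f1 f2 : T -> \bar R) : (forall x, D x -> 0 <= f1 x) ->
    (forall x, D x -> f1 x <= f2 x) ->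
    \int[m]_(x in D) f1 x <= \int[m]_(x in D) f2 x.
  move=> f10 f12; rewrite !ge0_integralE//; last first.
    by move=> x Dx; rewrite (le_trans (f10 x Dx))// f12.
  apply: le_ereal_sup => _ /= [h hf <-]; exists h => // x.
  by rewrite (le_trans (hf x))//; exact: lee_restrict.
move=> fg; rewrite integralE [leRHS]integralE; apply: leeB; apply: ge0 => // x Dx.
  by rewrite !funeposE ge_max !le_max lexx fg// orbT.
by rewrite !funenegE ge_max !le_max lexx orbT leeN2 fg.
Qed.

End integral_monotonicity.

Section poisson_integrals.
Context {R : realType}.
Local Notation C := R[i].
Local Notation mu := (@lebesgue_measure R).
Local Notation int01 := (Rintegral (@lebesgue_measure R) `[0, 1]).
Local Notation itv01 := (`[0, 1]%classic : set R).
Local Notation circle := (@unit_circle R : set (borel C)).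
Implicit Types (h : C -> R) (t s : C).

Definition circle_kernel t s : R := (1 - normc t ^+ 2) / normc (s - t) ^+ 2.

Lemma circle_kernel_e t y : circle_kernel t (e_ y) = poisson_kernel t y.
Proof. by []. Qed.

Lemma circle_kernel_ge0 t s : normc t < 1 -> 0 <= circle_kernel t s.
Proof.
move=> t1; rewrite /circle_kernel divr_ge0 ?sqr_ge0// subr_ge0.
by rewrite expr_le1 ?normc_ge0// ltW.
Qed.

Lemma continuous_circle_kernel t s : normc t < 1 -> unit_circle s ->
  {for s, continuous (circle_kernel t)}.
Proof.
move=> t1 s1; have cn : {for s, continuous (fun z : C => normc (z - t))}.
  apply/(@cvgrPdist_lt _ _ _ (nbhs s)) => e e0.
  have := @continuous_normc R (s - t) => /(@cvgrPdist_lt _ _ _ (nbhs (s - t))) /(_ e e0).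
  move=> /normc_near[d d0 dP]; apply/normc_near; exists d => // w ws.
  by apply: dP; rewrite opprB addrA subrK.
have n0 : normc (s - t) ^+ 2 != 0.
  rewrite expf_eq0/= gt_eqF// (@lt_le_trans _ _ (1 - normc t)) ?subr_gt0//.
  by rewrite -[X in X - _](_ : normc s = 1)//; rewrite -lecR rmorphB/= -!normr_normc lerB_dist.
have c2 : {for s, continuous (fun z : C => normc (z - t) ^+ 2)}.
  exact: (@continuousM _ _ _ _ _ cn cn).
have ci : {for s, continuous (fun z : C => (normc (z - t) ^+ 2)^-1)}.
  exact: (cvgV n0 c2).
exact: (cvgM (@cst_continuous C R (1 - normc t ^+ 2) s) ci).
Qed.

Lemma measurable_circle_kernel t : normc t < 1 ->
  measurable_fun circle (circle_kernel t).
Proof.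
move=> t1; apply/measurable_EFinP; apply: continuous_measurable_circle => s s1.
exact: continuous_circle_kernel.
Qed.

Lemma bounded_integrable01 (f : R -> R) M : measurable_fun itv01 f ->
  (forall y, itv01 y -> `|f y| <= M) -> mu.-integrable itv01 (EFin \o f).
Proof.
move=> mf fM; have := @integrable_mul_bounded R (fun=> 1) f M.
rewrite (_ : (fun y => 1 * f y) = f); last by apply/funext => y; rewrite mul1r.
by apply => //; apply: continuous_integrable01; exact: cst_continuous.
Qed.

Lemma integrable_poisson_kernel (f : R -> R) t : normc t < 1 ->
  mu.-integrable itv01 (EFin \o f) ->
  mu.-integrable itv01 (EFin \o (fun y => f y * poisson_kernel t y)).
Proof.
move=> t1 If; apply: (@integrable_mul_bounded _ _ _ ((1 + normc t) / (1 - normc t))) => //.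
  by apply: measurable_funTS; apply: continuous_measurable_fun; exact: continuous_poisson_kernel.
by move=> y _; rewrite ger0_norm ?poisson_kernel_ge0// poisson_kernel_le.
Qed.

(** The Poisson integral of a real function of the point of the circle, as an integral
    over the parameter; [poissonE] identifies the two for bounded Borel functions. *)
Definition circle_poisson h t : R := int01 (fun y => h (e_ y) * poisson_kernel t y).

Lemma circle_integrable h M : measurable_fun circle h ->
  (forall s, unit_circle s -> `|h s| <= M) ->
  mu.-integrable itv01 (EFin \o (fun y => h (e_ y))).
Proof.
move=> mh hM; apply: (@bounded_integrable01 _ M).
  have mhe : measurable_fun circle (EFin \o h) by apply/measurable_EFinP.
  by apply/measurable_EFinP/measurable_funTS; exact: (measurable_comp_e mhe).
by move=> y _; apply: hM; exact: circle_e.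
Qed.

Lemma circle_poisson_bounded h M t : normc t < 1 -> measurable_fun circle h ->
  (forall s, unit_circle s -> `|h s| <= M) -> `|circle_poisson h t| <= M.
Proof.
move=> t1 mh hM; have ih := circle_integrable mh hM.
have ihp := integrable_poisson_kernel t1 ih.
rewrite (le_trans (le_norm_int01 ihp))//.
have ip : mu.-integrable itv01 (EFin \o poisson_kernel t).
  by apply: continuous_integrable01; exact: continuous_poisson_kernel.
have <- : int01 (fun y => M * poisson_kernel t y) = M.
  by rewrite int01Z// (int_poisson_kernel t1) mulr1.
have m01 : measurable (itv01 : set (measurableTypeR R)) by exact: measurable_itv.
apply: le_Rintegral => //.
- exact: integrable01_norm.
- exact: integrable01Z.
- move=> y _; rewrite normrM (ger0_norm (poisson_kernel_ge0 _ t1)).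
  by rewrite ler_wpM2r ?poisson_kernel_ge0//; apply: hM; exact: circle_e.
Qed.

Lemma poissonE h M t : normc t < 1 -> measurable_fun circle h ->
  (forall s, unit_circle s -> `|h s| <= M) ->
  poisson (fun s => (h s)%:E) t = (circle_poisson h t)%:E.
Proof.
move=> t1 mh hM; have ih := circle_integrable mh hM.
rewrite /circle_poisson EFin_int01; last exact: integrable_poisson_kernel.
rewrite /poisson integral_circle; last first.
  under eq_fun do rewrite -EFinM; apply/measurable_EFinP.
  by apply: measurable_funM => //; exact: measurable_circle_kernel.
by apply: eq_integral => y _; rewrite -EFinM mulrC.
Qed.

Lemma circle_poisson_radial h M : measurable_fun circle h ->
  (forall s, unit_circle s -> `|h s| <= M) ->
  {ae mu, forall y, 0 < y < 1 ->
    circle_poisson h (r%:C * e_ y) @[r --> 1^'-] --> h (e_ y)}.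
Proof. by move=> mh hM; exact: (fatou_radial (circle_integrable mh hM)). Qed.

End poisson_integrals.

(** * Rational points and the bilinear pairing *)

Section vectors.
Context {R : realType} {n : nat}.
Local Notation C := R[i].
Local Notation Cn := 'rV[R[i]]_n.
Implicit Types (w z v : Cn) (a b : R).

(** A common radius for the finitely many coordinates of a neighbourhood. *)
Lemma nbhs_coord w0 (U : set Cn) : nbhs w0 U ->
  exists2 d : R, 0 < d & forall w, (forall j, normc (w 0 j - w0 0 j) < d) -> U w.
Proof.
move=> [P nP PU].
have /choice[e eP] : forall j : 'I_n, exists e : R, 0 < e /\
    forall c, normc (c - w0 0 j) < e -> P 0 j c.
  by move=> j; have /normc_near[e e0 eP] := nP 0 j; exists e.
have : \forall d \near 0^'+, forall j, d < e j.
  apply: (@filter_forall R 'I_n (fun j d => d < e j) (0 : R)^'+) => j.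
  by apply: nbhs_right_lt; have [] := eP j.
have := @nbhs_right_gt R 0.
move=> h1 h2; have [d [d0 dP]] := filter_ex (filterI h1 h2).
exists d => // w wd; apply: PU => i j; rewrite (ord1 i).
by apply: (eP j).2; rewrite (lt_trans (wd j)).
Qed.

Lemma nbhs_l1norm w0 (U : set Cn) : nbhs w0 U ->
  exists2 d : R, 0 < d & forall w, l1norm (w - w0) < d -> U w.
Proof.
move=> /nbhs_coord[d d0 dU]; exists d => // w wd; apply: dU => j.
by have := normc_le_l1norm (w - w0) j; rewrite !mxE => /le_lt_trans; apply.
Qed.

(** Indexing the rational points by naturals makes countable suprema sequences and
    countable intersections of full sets immediate. *)
Definition rational_point (k : nat) : Cn :=
  let q : 'rV[rat * rat]_n := odflt (const_mx (0, 0)) (unpickle k) in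
  \row_j (ratr (q 0 j).1 +i* ratr (q 0 j).2)%C.

Lemma rational_point_dense w d : 0 < d ->
  exists k, l1norm (rational_point k - w) < d.
Proof.
move=> d0; have n0 : 0 < 2 * n%:R + 1 :> R by rewrite ltr_wpDl// mulr_ge0.
pose e := d / (2 * n%:R + 1); have e0 : 0 < e by rewrite divr_gt0.
have near x : exists q, `|ratr q - x| <= e.
  have : x - e < x + e by rewrite ltrBlDr -addrA ltrDl addr_gt0.
  move=> /rat_in_itvoo[q]; rewrite in_itv/= => /andP[q1 q2].
  by exists q; rewrite ler_norml; apply/andP; split; lra.
have /choice[q1 q1P] : forall j, exists q, `|ratr q - complex.Re (w 0 j)| <= e.
  by move=> j; exact: near.
have /choice[q2 q2P] : forall j, exists q, `|ratr q - complex.Im (w 0 j)| <= e.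
  by move=> j; exact: near.
pose q : 'rV[rat * rat]_n := \row_j (q1 j, q2 j).
exists (pickle q); apply: (@le_lt_trans _ _ ((2 * n%:R) * e)).
  apply: l1norm_le_coord => j; rewrite /rational_point pickleK/= !mxE/=.
  have := q1P j; have := q2P j.
  by case: (w 0 j) => x y /=.
by rewrite /e mulrA ltr_pdivrMr// mulrC ltr_pM2l// ltrDl.
Qed.

Lemma cdotDr z w v : cdot z (w + v) = cdot z w + cdot z v.
Proof.
by rewrite /cdot -big_split/=; apply: eq_bigr => j _; rewrite mxE mulrDr.
Qed.

Lemma cdotZr z (a : C) w : cdot z (a *: w) = a * cdot z w.
Proof.
by rewrite /cdot mulr_sumr; apply: eq_bigr => j _; rewrite mxE mulrCA.
Qed.

Lemma cdotC z w : cdot z w = cdot w z.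
Proof. by rewrite /cdot; apply: eq_bigr => j _; rewrite mulrC. Qed.

Lemma cdot0 w : cdot 0 w = 0.
Proof. by rewrite /cdot big1// => j _; rewrite mxE mul0r. Qed.

Lemma Re_cdot_convex z w v a :
  complex.Re (cdot z (a%:C *: w + (1 - a)%:C *: v)) =
  a * complex.Re (cdot z w) + (1 - a) * complex.Re (cdot z v).
Proof. by rewrite cdotDr !cdotZr Re_add !Re_realM. Qed.

Lemma normc_le_enorm w j : normc (w 0 j) <= enorm w.
Proof.
rewrite -(ler_pXn2r (n := 2))// ?nnegrE ?normc_ge0 ?sqrtr_ge0//.
rewrite sqr_sqrtr; last by apply: sumr_ge0 => k _; exact: sqr_ge0.
by rewrite (bigD1 j)//= lerDl; apply: sumr_ge0 => k _; exact: sqr_ge0.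
Qed.

Lemma Re_cdot_le z w : `|complex.Re (cdot z w)| <= l1norm z * enorm w.
Proof.
rewrite /cdot /l1norm mulr_suml.
elim/big_rec2 : _ => [|j x y _ h]; first by rewrite normr0.
rewrite Re_add (le_trans (ler_normD _ _))// lerD//.
rewrite (le_trans (normc_Re _))// normcM ler_pM ?normc_ge0//.
  exact: normc_sum2.
exact: normc_le_enorm.
Qed.

Lemma Re_cdot_convex_fun z : convex_fun (fun w => complex.Re (cdot z w)).
Proof. by move=> w v a _; rewrite Re_cdot_convex. Qed.

Lemma Re_cdot_locally_bounded z : locally_bounded (fun w => complex.Re (cdot z w)).
Proof.
move=> r; exists (l1norm z * r) => w wr; rewrite (le_trans (Re_cdot_le _ _))//.
by rewrite ler_wpM2l ?l1norm_ge0// (le_trans (enorm_le_l1norm _)).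
Qed.

(** The threshold [x0] is where [c * x ^ (p - 1)] catches up with [r]. *)
Lemma young_inequality (p c r : R) : 1 < p -> 0 < c -> 0 <= r ->
  exists D, forall x, 0 <= x -> r * x <= c * x `^ p + D.
Proof.
move=> p1 c0 r0; have p10 : 0 < p - 1 by rewrite subr_gt0.
pose x0 := (r / c) `^ (p - 1)^-1.
exists (r * x0) => x; rewrite le_eqVlt => /predU1P[<-|x1].
  by rewrite mulr0 addr_ge0// mulr_ge0// ?powR_ge0// ltW.
have [xx0|xx0] := leP x x0.
  by rewrite ler_wpDl ?mulr_ge0 ?powR_ge0 ?(ltW c0)// ler_wpM2l.
rewrite ler_wpDr ?mulr_ge0 ?powR_ge0//.
have -> : x `^ p = x * x `^ (p - 1).
  rewrite -{2}(powRr1 (ltW x1)) -powRD ?subrKC//.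
  by rewrite (gt_eqF x1) implybT.
rewrite mulrCA mulrC ler_wpM2l ?(ltW x1)// mulrC -ler_pdivrMr//.
have -> : r / c = x0 `^ (p - 1).
  by rewrite /x0 -powRrM mulVf ?gt_eqF// powRr1// divr_ge0// ltW.
by rewrite ge0_ler_powR// ?nnegrE ?powR_ge0 ?ltW.
Qed.

Lemma lipschitz_step (M d e : R) : 0 <= d -> d * (6 * (2 * M + 1)) <= e ->
  2 * M * (d + d) <= e / 3.
Proof. by move=> d0 h; lra. Qed.

Lemma dist_three_thirds (x y x' y' e : R) :
  `|x - y| <= e / 3 -> `|y - y'| < e / 3 -> `|x' - y'| <= e / 3 -> `|x - x'| < e.
Proof.
rewrite !ler_norml !ltr_norml => /andP[? ?] /andP[? ?] /andP[? ?].
by apply/andP; split; lra.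
Qed.

End vectors.

(** * Boundary values of vector Hardy functions *)

Section hardy_space.
Context {R : realType} {n : nat}.
Local Notation C := R[i].
Local Notation Cn := 'rV[R[i]]_n.
Local Notation mu := (@lebesgue_measure R).
Local Notation int01 := (Rintegral (@lebesgue_measure R) `[0, 1]).
Local Notation itv01 := (`[0, 1]%classic : set R).
Local Notation circle := (@unit_circle R : set (borel C)).
Variables (q : R) (f : C -> Cn).
Hypotheses (q1 : 1 < q) (hf : hardy q f).
Implicit Types (v w : Cn) (t z : C).

Let ae_filter_mu : Filter (nbhs (almost_everywhere mu)).
Proof. exact: ae_filter_ringOfSetsType. Qed.

Lemma ae_interval01 (Q : R -> Prop) : {ae mu, forall y, 0 < y < 1 -> Q y} ->
  {ae mu, forall y, itv01 y -> Q y}.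
Proof.
have aeF := ae_filter_mu.
move=> h; have n0 : {ae mu, forall y : R, y != 0 /\ y != 1}.
  exists ([set (0 : R)] `|` [set 1]); split.
  - by apply: measurableU; exact: measurable_set1.
  - by apply: countable_lebesgue_measure0; apply: finite_set_countable; exact: finite_set2.
  - move=> y /= h'; have [y0|y0] := eqVneq y 0; first by left.
    have [y1|y1] := eqVneq y 1; first by right.
    by exfalso; apply: h'.
apply: filterS2 h n0 => y hy [y0 y1] /=.
by rewrite in_itv/= => /andP[? ?]; apply: hy; rewrite !lt_neqAle eq_sym y0 y1; apply/andP.
Qed.

Lemma derivable_coord (g : C -> Cn) (j : 'I_n) z :
  derivable g z 1 -> derivable (fun z => g z 0 j) z 1.
Proof.
move=> /cvg_ex[l gl]; apply/cvg_ex; exists (l 0 j).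
have := cvg_comp _ _ gl ((@coord_continuous _ 1 n 0 j) l); apply: cvg_trans.
by apply: near_eq_cvg; apply: nearW => h /=; rewrite !mxE.
Qed.

Lemma hardy_derivable v z : normc z < 1 -> derivable (fun z => cdot (f z) v) z 1.
Proof.
move=> z1; have df j := @derivable_coord f j z (hf.1 z z1); rewrite /cdot.
have : forall s : seq 'I_n, derivable (fun z => \sum_(j <- s) f z 0 j * v 0 j) z 1.
  elim=> [|j s ih].
    rewrite (_ : (fun _ => _) = fun=> 0); first exact: derivable_cstC.
    by apply/funext => u; rewrite big_nil.
  rewrite (_ : (fun _ => _) =
      fun z => f z 0 j * v 0 j + \sum_(j <- s) f z 0 j * v 0 j); last first.
    by apply/funext => u; rewrite big_cons.
  apply: derivable_addC ih.
  have dc := @derivable_cstC R (v 0 j) z.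
  exact: (@derivable_mulC R (fun z => f z 0 j) (fun=> v 0 j) z (df j) dc).
exact.
Qed.

Lemma continuous_hardy_circle v (r : R) s : 0 < r < 1 -> unit_circle s ->
  {for s, continuous (fun s => complex.Re (cdot (f (r%:C * s)) v))}.
Proof.
move=> /andP[r0 r1] s1; have rs1 : normc (r%:C * s) < 1.
  by rewrite normcM normc_real (_ : normc s = 1)// mulr1 gtr0_norm.
have dg : derivable (fun s => cdot (f (r%:C * s)) v) s 1.
  have dv := @hardy_derivable v _ rs1.
  exact: (@derivable_scaleC R (fun z => cdot (f z) v) r%:C s dv).
have cg := derivable_normc_continuous dg.
exact: (@continuous_comp _ _ _ (fun s => cdot (f (r%:C * s)) v) (@complex.Re R) s cg
  (@continuous_Re R _)).
Qed.

(** For [v] of norm at most 1 the integrand is dominated by the Euclidean norm to the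
    power [q], for which membership in the Hardy space gives the bound. *)
Lemma hardy_power_bound : exists M, forall v, l1norm v <= 1 -> forall r, 0 < r < 1 ->
  int01 (fun y => `|complex.Re (cdot (f (r%:C * e_ y)) v)| `^ q) <= M.
Proof.
have := hf.2; set S := ereal_sup _ => Sfin.
have [M SM] : exists M : R, (S <= M%:E)%E.
  by case: S Sfin => [x _|//|_]; [exists x|exists 0; exact: leNye].
exists M => v v1 r r01; rewrite -lee_fin (le_trans _ SM)//.
apply: (@le_trans _ _ (\int[sigma R]_(s in circle) (enorm (f (r%:C * s)) `^ q)%:E)%E); last first.
  by apply: ereal_sup_ubound; exists r.
have mRe : measurable_fun circle (fun s => `|complex.Re (cdot (f (r%:C * s)) v)| `^ q).
  apply: (measurableT_comp (measurable_powR q)).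
  apply: measurableT_comp; first exact: normr_measurable.
  apply/measurable_EFinP; apply: continuous_measurable_circle => s s1.
  exact: continuous_hardy_circle.
have mE : measurable_fun circle
    (fun s => (`|complex.Re (cdot (f (r%:C * s)) v)| `^ q)%:E).
  exact/measurable_EFinP.
apply: (@le_trans _ _ (\int[sigma R]_(s in circle)
    (`|complex.Re (cdot (f (r%:C * s)) v)| `^ q)%:E)%E); last first.
  apply: le_integral_nonmeasurable => s s1; rewrite lee_fin.
  rewrite ge0_ler_powR ?nnegrE ?sqrtr_ge0//; first by rewrite (le_trans ler01)// ltW.
  rewrite cdotC (le_trans (Re_cdot_le _ _))// ler_piMl ?sqrtr_ge0//.
rewrite (integral_circle mE).
have [ie|] := pselect (mu.-integrable itv01
    (EFin \o (fun y => `|complex.Re (cdot (f (r%:C * e_ y)) v)| `^ q))).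
  by rewrite EFin_int01.
move=> nie; rewrite /Rintegral.
set I := (\int[_]_(_ in _) _)%E; have I0 : (0 <= I)%E.
  by apply: integral_ge0 => y _; rewrite lee_fin powR_ge0.
by case: I I0 => //= x; rewrite lee_fin.
Qed.

Lemma hardy_radial_cdot v : exists h : R -> R,
  [/\ mu.-integrable itv01 (EFin \o h),
      forall t, normc t < 1 ->
        int01 (fun y => h y * poisson_kernel t y) = complex.Re (cdot (f t) v) &
      {ae mu, forall y, 0 < y < 1 ->
        complex.Re (cdot (f (r%:C * e_ y)) v) @[r --> 1^'-] --> h y}].
Proof.
have aeF := ae_filter_mu.
have [M MP] := hardy_power_bound.
pose k := l1norm v + 1; have k0 : 0 < k by rewrite ltr_wpDl// l1norm_ge0.
pose v' : Cn := (k^-1)%:C *: v.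
have v'1 : l1norm v' <= 1.
  by rewrite l1normZ ger0_norm ?invr_ge0 ?(ltW k0)// mulrC ler_pdivrMr// mul1r lerDl.
have vE (z : Cn) : complex.Re (cdot z v) = k * complex.Re (cdot z v').
  by rewrite cdotZr Re_realM mulrA divff ?gt_eqF// mul1r.
have [h [ih hP hl]] := @hardy_radial R (fun z => cdot (f z) v') q M q1
  (@hardy_derivable v') (MP v' v'1).
exists (fun y => k * h y); split.
- exact: integrable01Z.
- move=> t t1; rewrite vE -(hP t t1).
  under [LHS]eq_Rintegral do rewrite -mulrA.
  by rewrite int01Z//; exact: integrable_poisson_kernel.
- apply: filterS hl => y /[apply] yl.
  under eq_fun do rewrite vE.
  by apply: cvgM yl; exact: cvg_cst.
Qed.

(** Radial limits of the vector exist almost everywhere because those of the real and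
    imaginary parts of its coordinates do. *)
Lemma hardy_radial_vector : {ae mu, forall y, 0 < y < 1 ->
  exists l : Cn, f (r%:C * e_ y) @[r --> (1 : R)^'-] --> l}.
Proof.
have aeF := ae_filter_mu.
have /choice[h1 h1P] := fun j : 'I_n => hardy_radial_cdot (delta_mx 0 j).
(* Pairing with [-i] times a basis vector extracts the imaginary part. *)
have /choice[h2 h2P] := fun j : 'I_n => hardy_radial_cdot ((0 -i* 1)%C *: delta_mx 0 j).
have cE z (u : Cn) j (a : C) : cdot u (a *: delta_mx 0 j) = a * u 0 j.
  rewrite cdotZr /cdot (bigD1 j)//= big1 ?addr0 ?mxE ?eqxx ?mulr1//.
  by move=> k kj; rewrite mxE (negbTE kj) mulr0.
have ReE (u : Cn) j : complex.Re (cdot u (delta_mx 0 j)) = complex.Re (u 0 j).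
  by rewrite -[delta_mx 0 j]scale1r cE ?mul1r.
have ImE (u : Cn) j : complex.Re (cdot u ((0 -i* 1)%C *: delta_mx 0 j)) = complex.Im (u 0 j).
  by rewrite cE//; case: (u 0 j) => x y /=; rewrite mul0r sub0r mulNr mul1r opprK.
have : {ae mu, forall y, forall j : 'I_n, 0 < y < 1 ->
    complex.Re (f (r%:C * e_ y) 0 j) @[r --> 1^'-] --> h1 j y /\
    complex.Im (f (r%:C * e_ y) 0 j) @[r --> 1^'-] --> h2 j y}.
  apply: filter_forall => j.
  have [_ _ a1] := h1P j; have [_ _ a2] := h2P j.
  apply: filterS2 a1 a2 => y a1 a2 y01; split.
    by have := a1 y01; under eq_fun do rewrite ReE.
  by have := a2 y01; under eq_fun do rewrite ImE.
apply: filterS => y hy y01; exists (\row_j (h1 j y +i* h2 j y)%C) => U /nbhs_coord[d d0 dU].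
have : \forall r \near (1 : R)^'-, forall j : 'I_n,
    normc (f (r%:C * e_ y) 0 j - (h1 j y +i* h2 j y)%C) < d.
  apply: (@filter_forall R 'I_n (fun j r =>
    normc (f (r%:C * e_ y) 0 j - (h1 j y +i* h2 j y)%C) < d) (1 : R)^'-) => j.
  have d20 : 0 < d / 2 by rewrite divr_gt0.
  have [/cvgrPdist_lt/(_ _ d20) b1 /cvgrPdist_lt/(_ _ d20) b2] := hy j y01.
  apply: filterS2 b1 b2 => r; case: (f _ 0 j) => x x' b1 b2.
  rewrite distrC in b1; rewrite distrC in b2.
  by apply: (le_lt_trans (normc_sum2 _)); rewrite [ltRHS]splitr; exact: ltrD b1 b2.
apply: filterS => r rd; apply: dU => j; rewrite mxE; exact: rd.
Qed.

Lemma continuous_Re_cdot w : continuous (fun z : Cn => complex.Re (cdot w z)).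
Proof.
by apply: convex_continuous; [exact: Re_cdot_convex_fun|exact: Re_cdot_locally_bounded].
Qed.

(** Where the radial limit of [f] exists, pairing it with [w] gives the limit of the
    scalar function [f . w], which is the integrable function of its Poisson formula. *)
Lemma hardy_radial_limit w : exists h : R -> R,
  [/\ mu.-integrable itv01 (EFin \o h),
      forall t, normc t < 1 ->
        int01 (fun y => h y * poisson_kernel t y) = complex.Re (cdot (f t) w) &
      {ae mu, forall y, itv01 y ->
        complex.Re (cdot (radial_limit f (e_ y)) w) = h y /\
        complex.Re (cdot (f (r%:C * e_ y)) w) @[r --> 1^'-] --> h y}].
Proof.
have aeF := ae_filter_mu.
have [h [ih hP hl]] := hardy_radial_cdot w; exists h; split => //.
apply: ae_interval01; apply: filterS2 hl hardy_radial_vector => y yl yv y01.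
have [l fl] := yv y01; have yh := yl y01; split => //.
have -> : radial_limit f (e_ y) = l by apply: cvg_lim fl; exact: norm_hausdorff.
have : complex.Re (cdot (f (r%:C * e_ y)) w) @[r --> (1 : R)^'-] --> complex.Re (cdot l w).
  under eq_fun do rewrite cdotC; rewrite (cdotC l).
  exact: (cvg_comp _ _ fl ((@continuous_Re_cdot w) l)).
move=> /(cvg_lim (@norm_hausdorff _ R)) <-.
exact: (cvg_lim (@norm_hausdorff _ R) yh).
Qed.

End hardy_space.

(** * The interpolated family *)

Section conjugate_family.
Context {R : realType} {n : nat}.
Local Notation C := R[i].
Local Notation Cn := 'rV[R[i]]_n.
Local Notation circle := (@unit_circle R : set (borel C)).
Variables (p : R) (phi : C -> Cn -> R) (c K A : R).
Hypothesis p1 : 1 < p.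
Hypothesis phi_conv : measurable_convex_family phi.
Hypotheses (c0 : 0 < c) (K0 : 0 < K).
Hypothesis growth : forall s, unit_circle s -> forall w : Cn,
  c * enorm w `^ p - A <= phi s w <= K * enorm w `^ p + A.
Implicit Types (s : C) (w z : Cn).

Lemma phi_ge s w : unit_circle s -> - A <= phi s w.
Proof.
move=> s1; have /andP[+ _] := growth s1 w; apply: le_trans.
by rewrite lerDr mulr_ge0 ?powR_ge0// ltW.
Qed.

Lemma phi_bounded r : exists M, forall s w, unit_circle s -> l1norm w <= r ->
  `|phi s w| <= M.
Proof.
exists (K * r `^ p + A) => s w s1 wr.
have r0 : 0 <= r by rewrite (le_trans (l1norm_ge0 w)).
rewrite ler_norml; apply/andP; split.
  rewrite (le_trans _ (phi_ge w s1))// lerN2 lerDr mulr_ge0 ?powR_ge0//.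
  exact: ltW.
have /andP[_ h] := growth s1 w; rewrite (le_trans h)// lerD2r ler_pM2l//.
rewrite ge0_ler_powR ?nnegrE ?sqrtr_ge0//; first by rewrite (le_trans ler01)// ltW.
by rewrite (le_trans (enorm_le_l1norm w)).
Qed.

Lemma phi_locally_bounded s : unit_circle s -> locally_bounded (phi s).
Proof.
by move=> s1 r; have [M MP] := phi_bounded r; exists M => w wr; exact: MP.
Qed.

Lemma phi_convex_fun s : unit_circle s -> convex_fun (phi s).
Proof. by move=> s1 w z a a01; exact: phi_conv.2. Qed.

(** The conjugate as a real function, since it is finite at points of the circle. *)
Definition conj_phi s z : R := fine (legendre phi s z).

(** The lower growth bound makes [Re (z . w) - phi s w] bounded above in [w], uniformly in
    [s]; the value at [w = 0] gives the lower bound. *)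
Lemma legendre_bounded r : exists D, forall s z, unit_circle s -> l1norm z <= r ->
  ((- A)%:E <= legendre phi s z <= D%:E)%E.
Proof.
have [D DP] := young_inequality p1 c0 (le_trans (lexx 0) (normr_ge0 r)).
exists (D + A) => s z s1 zr; apply/andP; split.
  apply: (@le_trans _ _ (complex.Re (cdot z 0) - phi s 0)%:E).
    rewrite lee_fin cdotC cdot0 sub0r lerN2.
    have /andP[_] := growth s1 (0 : Cn).
    have -> : enorm (0 : Cn) = 0.
      by apply/le_anti; rewrite sqrtr_ge0 andbT -(@l1norm0 R n) enorm_le_l1norm.
    by rewrite powR0 ?mulr0 ?add0r// gt_eqF// (lt_trans ltr01).
  by apply: ereal_sup_ubound; exists 0.
apply: ge_ereal_sup => _ [w _ <-]; rewrite lee_fin.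
have /andP[h _] := growth s1 w.
have := DP (enorm w) (sqrtr_ge0 _).
have := le_trans (ler_norm _) (Re_cdot_le z w).
have : l1norm z * enorm w <= `|r| * enorm w.
  by rewrite ler_wpM2r ?sqrtr_ge0// (le_trans zr)// ler_norm.
by move: h; move: (_ `^ _) (`|r| * _) (_ * enorm w) (complex.Re _) (phi s w) => *; lra.
Qed.

Lemma legendreE s z : unit_circle s -> legendre phi s z = (conj_phi s z)%:E.
Proof.
move=> s1; have [D /(_ s z s1 (lexx _))] := legendre_bounded (l1norm z).
move=> /andP[h1 h2]; rewrite /conj_phi fineK// fin_numE.
by rewrite gt_eqF ?(lt_le_trans (ltNyr _) h1)// lt_eqF// (le_lt_trans h2 (ltry _)).
Qed.

Lemma conj_phi_bounded r : exists M, forall s z, unit_circle s -> l1norm z <= r ->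
  `|conj_phi s z| <= M.
Proof.
have [D DP] := legendre_bounded r; exists (Num.max A D) => s z s1 zr.
have := DP s z s1 zr; rewrite legendreE// !lee_fin => /andP[h1 h2].
rewrite ler_norml; apply/andP; split.
  by rewrite lerNl le_max lerNl h1.
by rewrite le_max h2 orbT.
Qed.

Lemma conj_phi_ub s z w : unit_circle s ->
  complex.Re (cdot z w) - phi s w <= conj_phi s z.
Proof.
by move=> s1; rewrite -lee_fin -legendreE//; apply: ereal_sup_ubound; exists w.
Qed.

Lemma conj_phi_lub s z m : unit_circle s ->
  (forall w, complex.Re (cdot z w) - phi s w <= m) -> conj_phi s z <= m.
Proof.
move=> s1 h; rewrite -lee_fin -legendreE//; apply: ge_ereal_sup => _ [w _ <-].
by rewrite lee_fin.
Qed.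

Lemma conj_phi_convex s : unit_circle s -> convex_fun (conj_phi s).
Proof.
move=> s1 z z' a /andP[a0 a1]; apply: conj_phi_lub => // w.
rewrite cdotC Re_cdot_convex !(cdotC w).
have h1 := conj_phi_ub z w s1; have h2 := conj_phi_ub z' w s1.
have : a * (complex.Re (cdot z w) - phi s w) <= a * conj_phi s z by rewrite ler_wpM2l.
have : (1 - a) * (complex.Re (cdot z' w) - phi s w) <= (1 - a) * conj_phi s z'.
  by rewrite ler_wpM2l// subr_ge0.
lra.
Qed.

Lemma phi_minus_linear_continuous s z : unit_circle s ->
  continuous (fun w => phi s w - complex.Re (cdot z w)).
Proof.
move=> s1; apply: convex_continuous.
  move=> w v a a01; rewrite Re_cdot_convex.
  have := phi_convex_fun s1 w v a01; lra.
move=> r; have [M MP] := phi_locally_bounded s1 r.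
have [M' MP'] := Re_cdot_locally_bounded z r; exists (M + M') => w wr.
by rewrite (le_trans (ler_normB _ _))// lerD ?MP ?MP'.
Qed.

(** By Fenchel-Moreau, [phi s] is approached from below at each point by its affine
    minorants; the slope may be taken rational because the conjugate is continuous. *)
Lemma conj_phi_biconjugate s w e : unit_circle s -> 0 < e ->
  exists k, phi s w - e <= complex.Re (cdot (rational_point k) w) -
                           conj_phi s (rational_point k).
Proof.
move=> s1 e0; have e20 : 0 < e / 2 by rewrite divr_gt0.
have [z zP] := fenchel_moreau w (phi_convex_fun s1) (phi_locally_bounded s1)
  (fun v => phi_ge v s1) e20.
have hz : conj_phi s z <= complex.Re (cdot z w) - phi s w + e / 2.
  exact: conj_phi_lub.
have cont : continuous (fun z => conj_phi s z - complex.Re (cdot w z)).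
  apply: convex_continuous.
    move=> v v' a a01; rewrite Re_cdot_convex.
    have := conj_phi_convex s1 v v' a01; lra.
  move=> r; have [M MP] := conj_phi_bounded r.
  have [M' MP'] := Re_cdot_locally_bounded w r; exists (M + M') => v vr.
  by rewrite (le_trans (ler_normB _ _))// lerD ?MP ?MP'.
have := cont z => /(@cvgrPdist_lt _ _ _ (nbhs z)) /(_ _ e20).
move=> /nbhs_l1norm[d d0 dP].
have [k kd] := rational_point_dense z d0.
exists k; have := dP _ kd; rewrite ltr_norml => /andP[h _].
rewrite !(cdotC w) in h; lra.
Qed.

Lemma measurable_phi w : measurable_fun circle (fun s => phi s w).
Proof.
pose j (s : borel C) : borel (C * Cn)%type := (s, w).
apply: (@measurable_comp _ _ _ (borel C) (borel (C * Cn)%type) _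
  [set sw | unit_circle sw.1] (fun sw => phi sw.1 sw.2) circle j).
- rewrite (_ : [set sw | _] = ~` [set sw | ~ unit_circle sw.1]); last first.
    by apply/seteqP; split => x /=; [move=> ? []|exact: contrapT].
  apply: measurableC; apply: sub_sigma_algebra.
  have oc : open ((fst : C * Cn -> C) @^-1` (~` (@unit_circle R))).
    apply: open_comp; first by move=> x _; exact: cvg_fst.
    by rewrite openC; exact: closed_circle.
  exact: oc.
- by move=> _ [s s1 <-].
- exact: phi_conv.1.
- move=> mD; apply: (@measurability _ _ (borel C) (borel (C * Cn)%type) circle j
    (@open (C * Cn)%type)) => //.
  move=> _ [U oU <-]; apply: measurableI => //; apply: sub_sigma_algebra.
  have cj : continuous ((fun s => (s, w)) : C -> C * Cn).
    move=> s; have c1 : x @[x --> s] --> s by exact: cvg_id.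
    have c2 := @cst_continuous C Cn w s.
    exact: (cvg_pair c1 c2).
  by have /continuousP/(_ U oU) := cj.
Qed.

(** By continuity of [phi s] the supremum may be taken over rational points. *)
Lemma measurable_conj_phi z : measurable_fun circle (fun s => legendre phi s z).
Proof.
pose f k s : \bar R := (complex.Re (cdot z (rational_point k)) - phi s (rational_point k))%:E.
apply: (@eq_measurable_fun _ _ (borel C) _ _ (fun s => esups (f ^~ s) 0)).
  move=> s; rewrite inE => s1; apply/eqP; rewrite eq_le; apply/andP; split.
    apply: ge_ereal_sup => _ [k _ <-]; apply: ereal_sup_ubound.
    by exists (rational_point k).
  apply: ge_ereal_sup => _ [w _ <-]; apply/lee_addgt0Pr => e e0.
  have := (@phi_minus_linear_continuous s z s1) (w : Cn).
  move=> /(@cvgrPdist_lt _ _ _ (nbhs w)) /(_ _ e0) /nbhs_l1norm[d d0 dP].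
  have [k kd] := rational_point_dense w d0.
  apply: (@le_trans _ _ (f k s + e%:E)%E).
    have := dP _ kd; rewrite ltr_norml => /andP[h _].
    rewrite /f -EFinD lee_fin; lra.
  by rewrite leeD2r//; apply: ereal_sup_ubound; exists k.
apply: measurable_fun_esups => k; apply/measurable_EFinP.
apply: measurable_funB; first exact: measurable_cst.
exact: measurable_phi.
Qed.

Local Notation mu := (@lebesgue_measure R).
Local Notation int01 := (Rintegral (@lebesgue_measure R) `[0, 1]).
Local Notation itv01 := (`[0, 1]%classic : set R).

Lemma measurable_conj_phi_real z : measurable_fun circle (fun s => conj_phi s z).
Proof.
apply/measurable_EFinP.
apply: (@eq_measurable_fun _ _ (borel C) _ _ (fun s => legendre phi s z)).
  by move=> s; rewrite inE => s1; rewrite legendreE.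
exact: measurable_conj_phi.
Qed.

Lemma conj_phi_bounded1 z : exists M, forall s, unit_circle s -> `|conj_phi s z| <= M.
Proof.
by have [M MP] := conj_phi_bounded (l1norm z); exists M => s s1; exact: MP.
Qed.

Lemma phi_bounded1 w : exists M, forall s, unit_circle s -> `|phi s w| <= M.
Proof.
by have [M MP] := phi_bounded (l1norm w); exists M => s s1; exact: MP.
Qed.

Lemma hardy_cst (q : R) (z : Cn) : hardy q (cst z).
Proof.
split=> [t _|]; first exact: derivable_cst.
apply: (@le_lt_trans _ _ (enorm z `^ q)%:E); last exact: ltry.
apply: ge_ereal_sup => _ [rho _ <-].
have -> : (\int[sigma R]_(s in circle) (enorm (cst z (rho%:C * s)) `^ q)%:E =
    \int[mu]_(y in itv01) (enorm z `^ q)%:E)%E.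
  rewrite (@integral_circle R (fun=> (enorm z `^ q)%:E))//.
rewrite integral_cst//.
by rewrite /= lebesgue_measure_itv/= lte01 -EFinB subr0 mule1.
Qed.

Lemma radial_limit_cst (z : Cn) s : radial_limit (cst z) s = z.
Proof. by rewrite /radial_limit; exact: lim_cst. Qed.

(** The constant map [z] is a competitor in the supremum. *)
Lemma interpolated_ge t z w : normc t < 1 ->
  ((complex.Re (cdot z w) - circle_poisson (fun s => conj_phi s z) t)%:E <=
   interpolated p phi t w)%E.
Proof.
move=> t1; have [M MP] := conj_phi_bounded1 z.
apply: ereal_sup_ubound; exists (cst z); first exact: hardy_cst.
rewrite [RHS]EFinB; congr (_ - _)%E.
rewrite -(poissonE t1 (measurable_conj_phi_real z) MP).
apply: eq_integral => s; rewrite inE => s1.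
by rewrite radial_limit_cst legendreE.
Qed.

Section interpolated_upper_bound.
Variables (f : C -> Cn) (w : Cn).
Hypothesis hf : hardy (p / (p - 1)) f.

Let q1 : 1 < p / (p - 1).
Proof. by rewrite ltr_pdivlMr ?subr_gt0// mul1r ltrBlDr ltrDl. Qed.

Let rk (k : nat) : R := 1 - (k.+2%:R)^-1.

Let rk01 k : 0 < rk k < 1.
Proof.
by rewrite /rk subr_gt0 invf_lt1 ?ltr0n// ltr1n ltrBlDr ltrDl invr_gt0 ltr0n.
Qed.

(* An upper limit along radii tending to 1, so that the boundary values of [f . w] are
   a Borel function of the point of the circle. *)
Let G s : \bar R := limn_esup (fun k => (complex.Re (cdot (f ((rk k)%:C * s)) w))%:E).

Let measurable_G : measurable_fun circle G.
Proof.
apply: measurable_fun_limn_esup => k.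
apply: continuous_measurable_circle => s s1.
exact: (@continuous_hardy_circle R n _ f hf w (rk k) s (rk01 k) s1).
Qed.

(** The integrand dominates the kernel times [Re (f . w) - phi], which is the
    inequality of Young for the pair of conjugate functions. To apply monotonicity
    everywhere, this minorant is lowered to the constant [- A] on the null set where the
    boundary values are not those of [f]. *)
Lemma poisson_conj_ge t : normc t < 1 ->
  ((complex.Re (cdot (f t) w) - circle_poisson (fun s => phi s w) t)%:E <=
   poisson (fun s => legendre phi s (radial_limit f s)) t)%E.
Proof.
move=> t1; have [h [ih hP hae]] := hardy_radial_limit q1 hf w.
have Gh : {ae mu, forall y, itv01 y -> G (e_ y) = (h y)%:E /\
    complex.Re (cdot (radial_limit f (e_ y)) w) = h y}.
  case: hae => N [mN N0 NP]; exists N; split => // y /= nG; apply: NP => /= hy.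
  apply: nG => /hy[yw yh]; split => //; apply: (cvg_limn_einf_sup _).2.
  apply: cvg_EFin; first exact: nearW.
  move/cvg_at_leftP : yh; apply; split; first by move=> k; have /andP[] := rk01 k.
  rewrite -[X in _ --> X](subr0 1); apply: cvgB; first exact: cvg_cst.
  have := @cvg_harmonic R; rewrite -(cvg_shiftS (harmonic : R^nat)).
  exact.
have Gae : {ae mu, forall y, itv01 y ->
    G (e_ y) = (complex.Re (cdot (radial_limit f (e_ y)) w))%:E}.
  case: Gh => N [mN N0 NP]; exists N; split => // y /= nG; apply: NP => /= hy.
  by apply: nG => /hy[-> ->].
have [B [mB B0 BP]] :=
  @ae_circle_set R (fun s => G s = (complex.Re (cdot (radial_limit f s) w))%:E) Gae.
pose H s : R := \1_B s * - A + (1 - \1_B s) * (fine (G s) - phi s w).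
have mH : measurable_fun circle H.
  have mI : measurable_fun circle (fun s => \1_B s : R).
    by apply: measurable_funTS; exact: measurable_indic.
  apply: measurable_funD; apply: measurable_funM => //.
    by apply: measurable_funB => //; exact: measurable_cst.
  apply: measurable_funB; last exact: measurable_phi.
  by apply: measurableT_comp => //; exact: fine_measurable.
have mHk : measurable_fun circle (fun s => (circle_kernel t s * H s)%:E).
  apply/measurable_EFinP; apply: measurable_funM => //.
  exact: measurable_circle_kernel.
apply: (@le_trans _ _ (\int[sigma R]_(s in circle) (circle_kernel t s * H s)%:E)%E);
  last first.
  apply: le_integral_nonmeasurable => s s1; rewrite legendreE// -EFinM lee_fin.
  rewrite ler_wpM2l ?circle_kernel_ge0// /H indicE.
  have [sB|sB] := boolP (s \in B).
    rewrite mul1r subrr mul0r addr0 -lee_fin -legendreE//.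
    have [D DP] := legendre_bounded (l1norm (radial_limit f s)).
    by have /andP[] := DP s _ s1 (lexx _).
  rewrite mul0r add0r subr0 mul1r BP//; last by move=> /mem_set; rewrite (negbTE sB).
  exact: conj_phi_ub.
rewrite (integral_circle mHk).
have [M MP] := phi_bounded1 w.
have ip : mu.-integrable itv01 (EFin \o (fun y => phi (e_ y) w * poisson_kernel t y)).
  apply: integrable_poisson_kernel => //.
  exact: (circle_integrable (measurable_phi w) MP).
have ihk := integrable_poisson_kernel t1 ih.
rewrite -(hP t t1) /circle_poisson -int01B// EFin_int01; last exact: integrable01B.
rewrite le_eqVlt; apply/orP; left; apply/eqP.
have m01 : measurable (itv01 : set (measurableTypeR R)) by exact: measurable_itv.
apply: ae_eq_integral => //.
- exact: (measurable_int mu (integrable01B ihk ip)).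
- by apply: measurable_funTS; exact: (measurable_comp_e mHk).
- have B'0 : {ae mu, forall y, itv01 y -> ~ B (e_ y)}.
    exists (itv01 `&` (e_ : R -> C) @^-1` B); split => //.
      apply: measurableI => //; rewrite -[X in measurable X]setTI.
      exact: (@measurable_circle_param R measurableT _ mB).
    by move=> y /= /not_implyP[y01 /contrapT].
  have aeF : Filter (nbhs (almost_everywhere mu)) by exact: ae_filter_ringOfSetsType.
  apply: filterS2 Gh B'0 => y Gy By y01; have [yG _] := Gy y01.
  have yH : H (e_ y) = h y - phi (e_ y) w.
    by rewrite /H indicE memNset ?yG ?mul0r ?add0r ?subr0 ?mul1r//; exact: By.
  by rewrite circle_kernel_e yH -mulrBl mulrC.
Qed.

End interpolated_upper_bound.

(** Each competitor [f] is bounded by the same Poisson integral, because [Re (f t . w)]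
    cancels against the Poisson integral of its boundary values. *)
Lemma interpolated_le t w : normc t < 1 ->
  (interpolated p phi t w <= (circle_poisson (fun s => phi s w) t)%:E)%E.
Proof.
move=> t1; apply: ge_ereal_sup => _ [f hf <-].
have := poisson_conj_ge w hf t1; case: (poisson _ t) => [x| |].
- rewrite -EFinB !lee_fin; lra.
- by rewrite addeNy leNye.
- by rewrite leeNy_eq.
Qed.

Definition real_interpolated t w : R := fine (interpolated p phi t w).

Lemma interpolatedE t w : normc t < 1 ->
  interpolated p phi t w = (real_interpolated t w)%:E.
Proof.
move=> t1; have h1 := interpolated_le w t1; have h2 := interpolated_ge 0 w t1.
rewrite /real_interpolated fineK// fin_numE.
by rewrite gt_eqF ?(lt_le_trans (ltNyr _) h2)// lt_eqF// (le_lt_trans h1 (ltry _)).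
Qed.

Lemma real_interpolated_le t w : normc t < 1 ->
  real_interpolated t w <= circle_poisson (fun s => phi s w) t.
Proof. by move=> t1; rewrite -lee_fin -interpolatedE// interpolated_le. Qed.

Lemma real_interpolated_ge t z w : normc t < 1 ->
  complex.Re (cdot z w) - circle_poisson (fun s => conj_phi s z) t <=
  real_interpolated t w.
Proof. by move=> t1; rewrite -lee_fin -interpolatedE// interpolated_ge. Qed.

Lemma real_interpolated_bounded r : exists M, forall t w, normc t < 1 ->
  l1norm w <= r -> `|real_interpolated t w| <= M.
Proof.
have [M1 M1P] := phi_bounded r; have [M2 M2P] := conj_phi_bounded1 0.
exists (Num.max M1 M2) => t w t1 wr; rewrite ler_norml; apply/andP; split.
  have := real_interpolated_ge 0 w t1; rewrite cdot0 sub0r; apply: le_trans.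
  rewrite lerN2 le_max; apply/orP; right.
  rewrite (le_trans (ler_norm _))//.
  exact: (circle_poisson_bounded t1 (measurable_conj_phi_real 0) M2P).
rewrite (le_trans (real_interpolated_le w t1))// le_max; apply/orP; left.
rewrite (le_trans (ler_norm _))//.
apply: (circle_poisson_bounded t1 (measurable_phi w)) => s s1; exact: M1P.
Qed.

(** A supremum of functions affine in [w]; the infinite values of the subtracted integral
    are harmless, one giving [-oo] and the other being excluded by finiteness. *)
Lemma real_interpolated_convex t : normc t < 1 -> convex_fun (real_interpolated t).
Proof.
move=> t1 w v a /andP[a0 a1]; rewrite -lee_fin -interpolatedE//.
apply: ge_ereal_sup => _ [f hf <-]; rewrite Re_cdot_convex.
have fle u : ((complex.Re (cdot (f t) u))%:E -
    poisson (fun s => legendre phi s (radial_limit f s)) t <=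
    (real_interpolated t u)%:E)%E.
  by rewrite -interpolatedE//; apply: ereal_sup_ubound; exists f.
have := fle w; have := fle v; case: (poisson _ t) => [x| |]/=.
- rewrite -!EFinB !lee_fin => h1 h2.
  have k1 := ler_wpM2l a0 h2.
  have k2 : (1 - a) * (complex.Re (cdot (f t) v) - x) <=
    (1 - a) * real_interpolated t v by rewrite ler_wpM2l// subr_ge0.
  move: k1 k2; move: (complex.Re _) (complex.Re _) (real_interpolated t w) (real_interpolated t v).
  move=> b c' d g k1 k2; lra.
- by move=> _ _; rewrite addeNy leNye.
- by [].
Qed.

Section radial_convergence.
Variable s : C.
Hypothesis s1 : unit_circle s.
Hypothesis phi_radial : forall k,
  circle_poisson (fun s => phi s (rational_point k)) (r%:C * s) @[r --> (1 : R)^'-] -->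
  phi s (rational_point k).
Hypothesis conj_phi_radial : forall k,
  circle_poisson (fun s => conj_phi s (rational_point k)) (r%:C * s) @[r --> (1 : R)^'-] -->
  conj_phi s (rational_point k).

Let radius1 : \forall r \near (1 : R)^'-, normc (r%:C * s) < 1.
Proof.
near=> r; rewrite normcM normc_real (_ : normc s = 1)// mulr1 ger0_norm.
  by near: r; exact: nbhs_left_lt.
by near: r; apply: nbhs_left_ge; rewrite ltr01.
Unshelve. all: by end_near. Qed.

(** The bounds of [interpolated_le] and [interpolated_ge] tend to [phi s] and to an affine
    minorant of [phi s] that is almost equal to it at the point. *)
Lemma interpolated_radial_rational k e : 0 < e -> \forall r \near (1 : R)^'-,
  `|real_interpolated (r%:C * s) (rational_point k) - phi s (rational_point k)| < e.
Proof.
move=> e0; have e20 : 0 < e / 2 by rewrite divr_gt0.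
have [l lP] := conj_phi_biconjugate (rational_point k) s1 e20.
have /cvgrPdist_lt/(_ _ e0) n1 := @phi_radial k.
have /cvgrPdist_lt/(_ _ e20) n2 := @conj_phi_radial l.
apply: filterS3 n1 n2 radius1 => r n1 n2 r1.
have := real_interpolated_le (rational_point k) r1.
have := real_interpolated_ge (rational_point l) (rational_point k) r1.
move: n1 n2; rewrite !ltr_norml => /andP[? ?] /andP[? ?] ? ?.
by apply/andP; split; lra.
Qed.

(** Convexity and the bound uniform in [r] make the functions equi-Lipschitz near [w0], so
    that convergence at rational points is uniform on a compact box. *)
Lemma interpolated_locally_uniform :
  cvg_left1_locally_uniformly (fun r w => interpolated p phi (r%:C * s) w) (phi s).
Proof.
move=> w0; pose K0' := [set w : Cn | forall j, `|complex.Re (w 0 j - w0 0 j)| <= 1 /\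
                                  `|complex.Im (w 0 j - w0 0 j)| <= 1].
exists K0'.
  have := l1norm_near w0 ltr01; apply: filterS => w w1 j.
  have := normc_le_l1norm (w - w0) j; rewrite !mxE => h.
  have h1 := le_trans h (ltW w1).
  by split; [exact: le_trans (normc_Re _) h1|exact: le_trans (normc_Im _) h1].
move=> e e0; pose rad : R := 2 * n%:R + 1.
have n0 : 0 <= 2 * n%:R :> R by rewrite mulr_ge0.
have [M1 M1P] := phi_bounded (l1norm w0 + (rad + 1)).
have [M2 M2P] := real_interpolated_bounded (l1norm w0 + (rad + 1)).
have ballP w : l1norm (w - w0) <= rad + 1 -> l1norm w <= l1norm w0 + (rad + 1).
  move=> wr; rewrite -[w](subrK w0) (le_trans (l1normD _ _))// addrC.
  by rewrite lerD2l.
pose M := Num.max M1 M2.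
have bphi w : l1norm (w - w0) <= rad + 1 -> `|phi s w| <= M.
  by move=> /ballP wr; rewrite le_max M1P.
have btau r w : normc (r%:C * s) < 1 -> l1norm (w - w0) <= rad + 1 ->
    `|real_interpolated (r%:C * s) w| <= M.
  by move=> r1 /ballP wr; rewrite le_max M2P ?orbT.
have M0 : 0 <= M.
  by rewrite (le_trans (normr_ge0 (phi s w0)))// bphi// subrr l1norm0 addr_ge0// addr_ge0.
pose d := Num.min (1 / 2) (e / (6 * (2 * M + 1))).
have M21 : 0 < 2 * M + 1 by rewrite ltr_wpDl// mulr_ge0.
have d0 : 0 < d by rewrite lt_min !divr_gt0// mulr_gt0.
have dM : 2 * M * (d + d) <= e / 3.
  have : d <= e / (6 * (2 * M + 1)) by rewrite ge_min lexx orbT.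
  rewrite ler_pdivlMr ?mulr_gt0//; exact: (lipschitz_step (ltW d0)).
have d12 : d <= 1 / 2 by rewrite ge_min lexx.
have /compact_near_coveringP cK : compact K0' by exact: compact_box.
have : \forall r \near (1 : R)^'-,
    K0' `<=` (fun w => `|real_interpolated (r%:C * s) w - phi s w| < e).
  apply: cK => x xK.
  have xr : l1norm (x - w0) <= 2 * n%:R.
    rewrite -[leRHS]mulr1; apply: l1norm_le_coord => j.
    by have := xK j; rewrite !mxE.
  have [k kd] := rational_point_dense x d0.
  have e30 : 0 < e / 3 by rewrite divr_gt0.
  have nk := filterI (interpolated_radial_rational k e30) radius1.
  exists ([set w | l1norm (w - x) < d], [set r | `|real_interpolated (r%:C * s)
    (rational_point k) - phi s (rational_point k)| < e / 3 /\ normc (r%:C * s) < 1]).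
    by split; [exact: l1norm_near|exact: nk].
  move=> [w r] /= [wd [kr r1]].
  have near_in v : l1norm (v - x) < d -> l1norm (v - w0) <= rad.
    move=> vd; rewrite (_ : v - w0 = (v - x) + (x - w0)); last by rewrite addrA subrK.
    rewrite (le_trans (l1normD _ _))// /rad addrC lerD// (le_trans (ltW vd))//.
    by rewrite (le_trans d12)//; lra.
  have wk : l1norm (w - rational_point k) <= d + d.
    rewrite (_ : w - _ = (w - x) + (x - rational_point k)); last by rewrite addrA subrK.
    by rewrite (le_trans (l1normD _ _))// lerD ?(ltW wd)// l1norm_distC ltW.
  have l1 := convex_lipschitz (phi_convex_fun s1) bphi (near_in w wd) (near_in _ kd).
  have l2 := convex_lipschitz (real_interpolated_convex r1) (fun v => btau r v r1)
    (near_in w wd) (near_in _ kd).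
  have Mwk : 2 * M * l1norm (w - rational_point k) <= e / 3.
    by rewrite (le_trans _ dM)// ler_wpM2l// mulr_ge0.
  exact: (dist_three_thirds (le_trans l2 Mwk) kr (le_trans l1 Mwk)).
move=> near1; apply: filterS2 near1 radius1 => r rP r1 w wU.
by rewrite interpolatedE// -EFinB lte_fin; exact: rP.
Qed.

End radial_convergence.

Lemma ae_interpolated_locally_uniform :
  {ae @sigma R, forall s, unit_circle s ->
    cvg_left1_locally_uniformly (fun r w => interpolated p phi (r%:C * s) w) (phi s)}.
Proof.
have aeF : Filter (nbhs (almost_everywhere mu)) by exact: ae_filter_ringOfSetsType.
have ae1 : {ae mu, forall y, forall k, itv01 y ->
    circle_poisson (fun s => phi s (rational_point k)) (r%:C * e_ y) @[r --> (1 : R)^'-] -->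
    phi (e_ y) (rational_point k)}.
  apply/ae_foralln => k; apply: ae_interval01.
  have [M MP] := phi_bounded1 (rational_point k).
  exact: (circle_poisson_radial (measurable_phi (rational_point k)) MP).
have ae2 : {ae mu, forall y, forall k, itv01 y ->
    circle_poisson (fun s => conj_phi s (rational_point k)) (r%:C * e_ y) @[r --> (1 : R)^'-] -->
    conj_phi (e_ y) (rational_point k)}.
  apply/ae_foralln => k; apply: ae_interval01.
  have [M MP] := conj_phi_bounded1 (rational_point k).
  exact: (circle_poisson_radial (measurable_conj_phi_real (rational_point k)) MP).
apply: ae_circle; apply: filterS2 ae1 ae2 => y h1 h2 y01.
apply: interpolated_locally_uniform; first exact: circle_e.
  by move=> k; exact: h1.
by move=> k; exact: h2.
Qed.

End conjugate_family.

Theorem proposition5 (R : realType) (n : nat) (n_ge1 : (1 <= n)%N)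
    (p : R) (p_gt1 : 1 < p) (phi : R[i] -> 'rV[R[i]]_n -> R)
    (phi_convex : measurable_convex_family phi)
    (phi_growth : uniform_growth p phi) :
  {ae @sigma R, forall s, unit_circle s ->
    cvg_left1_locally_uniformly
      (fun (r : R) w => interpolated p phi (r%:C * s) w) (phi s)}.
Proof.
have [c [K [A [c0 K0 _ growth]]]] := phi_growth.
exact: (ae_interpolated_locally_uniform p_gt1 phi_convex c0 K0 growth).
Qed.
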